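(* Let $d=1$. For $k=1,\dots,K$ let $-\infty<\underline a_k<\overline a_k<\infty$, and put $\underline a=\sum_kw_k\underline a_k$, $\overline a=\sum_kw_k\overline a_k$. Let $\mu_0\in\mathcal P_{2,\mathrm{ac}}(\mathbb R)$ have support $[\underline a,\overline a]$ and density $f_{\mu_0}$ with $\zeta_0^{-1}\le f_{\mu_0}\le\zeta_0$ on $[\underline a,\overline a]$ for some $\zeta_0\ge1$; for $k=1,\dots,K$ let $\nu_k\in\mathcal P_{2,\mathrm{ac}}(\mathbb R)$ have support $[\underline a_k,\overline a_k]$ and density $f_{\nu_k}$ with $\zeta_k^{-1}\le f_{\nu_k}\le\zeta_k$ on $[\underline a_k,\overline a_k]$ for some $\zeta_k\ge1$. Let $\kappa_0,\dots,\kappa_K:\mathbb R\to(0,\infty)$ be continuous with $\kappa_k(x)\ge\kappa_k(x')$ whenever $|x'|\ge|x|$, $\int_{\mathbb R}\kappa_k(x)\,dx=1$, $\int_{\mathbb R}x^2\kappa_k(x)\,dx<\infty$ for $0\le k\le K$. Run the stochastic fixed-point scheme of the context with $\Theta=(0,\infty)^2$, $\widehat\Theta_{t-1,k}=(b_{t-1,k},h_{t-1,k})$, where for $t\in\mathbb N$, $1\le k\le K$, $$\widehat G_{t,k}(x)=\frac1{\widehat M_{t-1,k}}\sum_{i=1}^{\widehat M_{t-1,k}}\frac{\int_{\underline a}^x\kappa_0\big(\frac{z-X_{t,k,i}}{b_{t-1,k}}\big)dz}{\int_{\underline a}^{\overline a}\kappa_0\big(\frac{z-X_{t,k,i}}{b_{t-1,k}}\big)dz}\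 (x\in[\underline a,\overline a]),\qquad \widehat F_{t,k}(x)=\frac1{\widehat N_{t-1,k}}\sum_{j=1}^{\widehat N_{t-1,k}}\frac{\int_{\underline a_k}^x\kappa_k\big(\frac{z-Y_{t,k,j}}{h_{t-1,k}}\big)dz}{\int_{\underline a_k}^{\overline a_k}\kappa_k\big(\frac{z-Y_{t,k,j}}{h_{t-1,k}}\big)dz}\ (x\in[\underline a_k,\overline a_k]),$$ $\widehat T_{t,k}(x)=\underline a_k$ for $x<\underline a$, $\widehat T_{t,k}(x)=\widehat F_{t,k}^{-1}(\widehat G_{t,k}(x))$ for $x\in[\underline a,\overline a]$, $\widehat T_{t,k}(x)=\overline a_k$ for $x>\overline a$, and $\widehat\mu_t=\big[\sum_{k=1}^Kw_k\widehat T_{t,k}\big]\sharp\widehat\mu_{t-1}$. Let $\bar\mu$ be the unique $\mathcal W_2$-barycenter of $\nu_1,\dots,\nu_K$ with weights $w_1,\dots,w_K$. Then: (i) The regularity assumption holds: at least one $\nu_k$ has $\mathcal L^\infty$-bounded density, and each $\widehat T_{t,k}$ belongs to $\mathcal C_{\mathrm{lin}}(\mathbb R,\mathbb R)$ and has a Borel dependency on $(X_{t,k,1},\dots,X_{t,k,\widehat M_{t-1,k}},Y_{t,k,1},\dots,Y_{t,k,\widehat N_{t-1,k}},\widehat\Theta_{t-1,k})$. (ii) For any $\beta\in(0,1)$ and $t\in\mathbb N$ one can choose $\widehat M_{t-1,k}=O(\beta^{-2t})$, $\widehat N_{t-1,k}=O(\beta^{-2t})$, $b_{t-1,k}=O(\beta^{t/2})$,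 $h_{t-1,k}=O(\beta^{t/2})$ such that $$\mathbb E\big[\|\widehat T_{t,k}-T^{\widehat\mu_{t-1}}_{\nu_k}\|^2_{\mathcal L^2(\widehat\mu_{t-1})}\big|\mathcal F_{t-1}\big]\le\beta^t\ (1\le k\le K)\quad\text{and}\quad\mathbb E\Big[\mathcal W_2\big(\big[\textstyle\sum_{k}w_k\widehat T_{t,k}\big]\sharp\widehat\mu_{t-1},\widehat\mu_t\big)^2\Big|\mathcal F_{t-1}\Big]\le\beta^t,$$ where the constants in the $O$-notation depend on $\widehat\mu_{t-1},(\nu_k)_{k=1}^K,(\kappa_k)_{k=0}^K$ and not on $\beta^t$. (iii) $G$ has a unique fixed point. (iv) $\mathbb E[V(\widehat\mu_t)]-V(\bar\mu)\le\mathbb E[\mathcal W_2(\widehat\mu_t,G(\widehat\mu_t))^2]$ for all $t\in\mathbb N_0$. (v) $\mathbb E[V(\widehat\mu_t)]-V(\bar\mu)\ge\mathbb E[\mathcal W_2(\widehat\mu_t,\bar\mu)^2]$ for all $t\in\mathbb N_0$. Consequently, with $\beta\in(0,1)$ and the choices in (ii) made for every $t\in\mathbb N$, $(\widehat\mu_t)_{t\in\mathbb N_0}$ converges $\mathbb P$-almost surely in $\mathcal W_2$ to $\bar\mu$, $\mathbb E[V(\widehat\mu_t)]-V(\bar\mu)\le4\beta^t$ for all $t\in\mathbb N$, and $\mathbb E[\mathcal W_2(\widehat\mu_t,\bar\mu)^2]\le4\beta^t$ for all $t\in\mathbb N$.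
   Context: Notation. $\mathbb N=\{1,2,\dots\}$, $\mathbb N_0=\mathbb N\cup\{0\}$. $\mathcal P_2(\mathbb R)$ is the set of Borel probability measures on $\mathbb R$ with finite second moment, equipped with the metric $\mathcal W_2(\mu,\nu)=\big(\inf_\pi\int|x-y|^2d\pi(x,y)\big)^{1/2}$ (infimum over couplings) and its Borel $\sigma$-algebra; $\mathcal P_{2,\mathrm{ac}}(\mathbb R)$ is the subset of measures absolutely continuous with respect to Lebesgue measure. $T\sharp\mu=\mu\circ T^{-1}$. For $\mu\in\mathcal P_{2,\mathrm{ac}}(\mathbb R)$, $\nu\in\mathcal P_2(\mathbb R)$, $T^\mu_\nu$ is the ($\mu$-a.e. unique) optimal transport map from $\mu$ to $\nu$ for the squared cost. $\|T\|_{\mathcal L^2(\mu)}=(\int|T|^2d\mu)^{1/2}$. $\mathcal C_{\mathrm{lin}}(\mathbb R,\mathbb R)$ is the Banach space of continuous $T:\mathbb R\to\mathbb R$ with norm $\sup_x|T(x)|/(1+|x|)<\infty$. Weights $w_1,\dots,w_K\in(0,1)$ satisfy $\sum_kw_k=1$. $V(\mu)=\sum_{k=1}^Kw_k\mathcal W_2(\mu,\nu_k)^2$ on $\mathcal P_2(\mathbb R)$; a $\mathcal W_2$-barycenter is a minimizer of $V$ over $\mathcal P_2(\mathbb R)$. $G(\mu)=\big[\sum_kw_kT^\mu_{\nu_k}\big]\sharp\mu$ for $\mu\in\mathcal P_{2,\mathrm{ac}}(\mathbb R)$; a fixed point is $\mu\in\mathcal P_{2,\mathrm{ac}}(\mathbb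 R)$ with $G(\mu)=\mu$. Stochastic fixed-point scheme (on a probability space $(\Omega,\mathcal F,\mathbb P)$). Start from $\widehat\mu_0=\mu_0$ and deterministic sample sizes $\widehat M_{0,k},\widehat N_{0,k}\in\mathbb N$ and hyperparameters $\widehat\Theta_{0,k}\in\Theta$. For $t=1,2,\dots$: for each $k$, conditionally on $\mathcal F_{t-1}$, independent samples $X_{t,k,i}$ ($1\le i\le\widehat M_{t-1,k}$) from $\widehat\mu_{t-1}$ and independent samples $Y_{t,k,j}$ ($1\le j\le\widehat N_{t-1,k}$) from $\nu_k$ are drawn; the estimators $\widehat T_{t,k}$ and then the measure $\widehat\mu_t$ are formed as specified in the claim; then $\widehat M_{t,k},\widehat N_{t,k}\in\mathbb N$, $\widehat\Theta_{t,k}\in\Theta$ are chosen $\mathcal F_t$-measurably. Here $\mathcal F_0=\{\emptyset,\Omega\}$ and $\mathcal F_t$ is the $\sigma$-algebra generated by $\mathcal F_{t-1}$ and the samples of iteration $t$. Borel dependency: for all $m,n\in\mathbb N$ there is a Borel map $h_{m,n}:\mathbb R^{m+n}\times\Theta\to\mathcal C_{\mathrm{lin}}(\mathbb R,\mathbb R)$ such that, $\mathbb P$-a.s. on $\{\widehat M_{t-1,k}=m,\widehat N_{t-1,k}=n\}$, $\widehat T_{t,k}=h_{m,n}(X_{t,k,1},\dots,X_{t,k,m},Y_{t,k,1},\dots,Y_{t,k,n},\widehat\Theta_{t-1,k})$. *)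

(* Defs.v *)
From HB Require Import structures.
From mathcomp Require Import all_boot all_order all_algebra.
From mathcomp Require Import all_classical all_reals all_analysis.
From mathcomp Require Import measurable_realfun.

Set Implicit Arguments.
Unset Strict Implicit.
Unset Printing Implicit Defensive.

Import Order.TTheory GRing.Theory Num.Theory.
Import numFieldNormedType.Exports.

Local Open Scope classical_set_scope.
Local Open Scope ring_scope.

Notation prob R := (probability (measurableTypeR R) R).

Section wasserstein.
Context {R : realType}.
Implicit Types (mu nu : prob R) (m n : set (measurableTypeR R) -> \bar R).

(* Several notions below take set functions rather than bundled measures, so
   that they apply to [pushforward], whose value is a measure only when the map
   is measurable. A [probability] is also defined on non-measurable sets, hence
   measures are identified when they agree on the measurable ones. *)
Definition meas_eq m n : Prop :=
  forall A : set (measurableTypeR R), measurable A -> m A = n A.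

Definition P2 : set (prob R) :=
  [set mu | (\int[mu]_x (((x : measurableTypeR R) ^+ 2)%:E) < +oo)%E].

Definition P2ac : set (prob R) :=
  [set mu | P2 mu /\ mu `<< (@lebesgue_measure R)].

Definition coupling m n :
    set (probability (measurableTypeR R * measurableTypeR R)%type R) :=
  [set pi | meas_eq (pushforward pi fst) m /\ meas_eq (pushforward pi snd) n].

Definition W2 m n : \bar R :=
  ((ereal_inf [set (\int[pi]_z ((`|z.1 - z.2| ^+ 2)%:E))%E | pi in coupling m n])
     `^ 2^-1)%E.

Definition W2_open (U : set (prob R)) : Prop :=
  U `<=` P2 /\
  forall mu, U mu -> exists2 e : R, 0 < e &
    forall nu, P2 nu -> (W2 mu nu < e%:E)%E -> U nu.

Definition borel_P2 : set (set (prob R)) := <<s P2, W2_open >>.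

Definition is_ot_map mu nu (T : R -> R) : Prop :=
  [/\ measurable_fun [set: measurableTypeR R] (T : _ -> measurableTypeR R),
      meas_eq (pushforward mu (T : _ -> measurableTypeR R)) nu &
      (\int[mu]_x ((`|(x : measurableTypeR R) - T x| ^+ 2)%:E) = W2 mu nu ^+ 2)%E].

(* For [mu] absolutely continuous the optimal map exists and is [mu]-a.e.
   unique, so the chosen representative does not matter. *)
Definition ot_map mu nu : R -> R := xget (id : R -> R) (is_ot_map mu nu).

Definition msupport mu : set R :=
  [set x | forall U : set R, open U -> U x -> (0 < mu U)%E].

Definition is_density mu (f : R -> R) : Prop :=
  [/\ measurable_fun [set: measurableTypeR R] f,
      forall x, 0 <= f x &
      forall A : set (measurableTypeR R), measurable A ->
        mu A = (\int[lebesgue_measure]_(x in A) (f x)%:E)%E].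

Definition regular_on (lo hi : R) mu : Prop :=
  [/\ P2ac mu, msupport mu = `[lo, hi]%classic &
      exists (f : R -> R) (zeta : R),
        [/\ is_density mu f, 1 <= zeta &
            forall x, lo <= x <= hi -> zeta^-1 <= f x <= zeta]].

Definition bounded_density mu : Prop :=
  exists2 f : R -> R, is_density mu f &
    ('N[@lebesgue_measure R]_+oo[EFin \o f] < +oo)%E.

End wasserstein.

Section barycenter.
Context {R : realType} {K : nat}.
Variables (w : 'I_K -> R) (nu : 'I_K -> prob R).

Definition Vbar (m : set (measurableTypeR R) -> \bar R) : \bar R :=
  (\sum_(k < K) (w k)%:E * W2 m (nu k) ^+ 2)%E.

Definition is_barycenter (mu : prob R) : Prop :=
  P2 mu /\ forall mu' : prob R, P2 mu' -> (Vbar mu <= Vbar mu')%E.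

Definition Gmap (mu : prob R) : set (measurableTypeR R) -> \bar R :=
  pushforward mu
    ((fun x => \sum_(k < K) w k * ot_map mu (nu k) x) : _ -> measurableTypeR R).

Definition is_fixpoint (mu : prob R) : Prop := P2ac mu /\ meas_eq (Gmap mu) mu.

End barycenter.

Section Clin.
Context {R : realType}.
Implicit Types T S : R -> R.

Definition clin_norm T : \bar R :=
  ereal_sup [set ((`|T x| / (1 + `|x|))%:E)%E | x in [set: R]].

Definition Clin : set (R -> R) :=
  [set T | continuous T /\ (clin_norm T < +oo)%E].

Definition clin_open (U : set (R -> R)) : Prop :=
  U `<=` Clin /\
  forall T, U T -> exists2 e : R, 0 < e &
    forall S, Clin S -> (clin_norm (fun x => (S x - T x)%R) < e%:E)%E -> U S.

Definition borel_Clin : set (set (R -> R)) := <<s Clin, clin_open >>.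

End Clin.

Section estimator.
Context {R : realType}.

Definition is_kernel (kap : R -> R) : Prop :=
  [/\ (forall x, 0 < kap x) /\ continuous kap,
      forall x x', `|x| <= `|x'| -> kap x' <= kap x,
      (\int[lebesgue_measure]_x (kap x)%:E = 1)%E &
      (\int[lebesgue_measure]_x (x ^+ 2 * kap x)%:E < +oo)%E].

Definition kernel_cdf (kap : R -> R) (lo hi b : R) (n : nat) (xs : nat -> R)
    (x : R) : R :=
  n%:R^-1 * \sum_(i < n)
    ((\int[lebesgue_measure]_(z in `[lo, x]) kap ((z - xs i) / b)) /
     (\int[lebesgue_measure]_(z in `[lo, hi]) kap ((z - xs i) / b))).

(* [G] is a distribution function on [lo, hi] and [F] on [lo', hi']. *)
Definition monotone_map (lo hi lo' hi' : R) (G F : R -> R) (x : R) : R :=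
  if x < lo then lo'
  else if x <= hi then 'pinv_(cst lo') `[lo', hi']%classic F (G x)
  else hi'.

End estimator.

Section conditional_expectation.
Context {R : realType} d (Omega : measurableType d) (P : probability Omega R).

Definition is_condexp (F : set (set Omega)) (Z Y : Omega -> \bar R) : Prop :=
  [/\ P.-integrable setT Z, P.-integrable setT Y,
      forall B : set (\bar R), measurable B -> F (Y @^-1` B) &
      forall A, F A -> (\int[P]_(o in A) Y o = \int[P]_(o in A) Z o)%E].

(* E[Z | F] <= c almost surely. *)
Definition condexp_le (F : set (set Omega)) (Z : Omega -> \bar R) (c : R) : Prop :=
  exists2 Y, is_condexp F Z Y & {ae P, forall o, (Y o <= c%:E)%E}.

End conditional_expectation.

Section scheme.
Context {R : realType} {K : nat} d (Omega : measurableType d).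

(* Time indices are those of the mathematical description: [smpX t] and
   [smpY t] (t >= 1) are the samples drawn at iteration t, [numX t], [numY t],
   [bwX t], [bwY t] are chosen after iteration t. Sample numbers start at 0, and
   only the samples numbered [i < numX t.-1 k o] (resp. [j < numY t.-1 k o])
   are drawn; the values of the remaining ones are never used. *)
Record run := Run {
  smpX : nat -> 'I_K -> nat -> {mfun Omega >-> measurableTypeR R} ;
  smpY : nat -> 'I_K -> nat -> {mfun Omega >-> measurableTypeR R} ;
  numX : nat -> 'I_K -> Omega -> nat ;
  numY : nat -> 'I_K -> Omega -> nat ;
  bwX : nat -> 'I_K -> Omega -> R ;
  bwY : nat -> 'I_K -> Omega -> R ;
  muhat : nat -> Omega -> prob R }.

Variable s : run.

Definition drawn (t : nat) : set (set Omega) :=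
  [set E | exists k i (B : set (measurableTypeR R)), measurable B /\
     (E = [set o | (i < numX s t.-1 k o)%N /\ B (smpX s t k i o)] \/
      E = [set o | (i < numY s t.-1 k o)%N /\ B (smpY s t k i o)])].

Fixpoint filt (t : nat) : set (set Omega) :=
  if t is t'.+1 then <<s filt t' `|` drawn t >> else [set set0; setT].

Variables (w lo hi : 'I_K -> R) (kappa0 : R -> R) (kappa : 'I_K -> R -> R).

Definition wavg (a : 'I_K -> R) : R := \sum_(k < K) w k * a k.

Definition Ghat t k o : R -> R :=
  kernel_cdf kappa0 (wavg lo) (wavg hi) (bwX s t.-1 k o)
    (numX s t.-1 k o) (fun i => smpX s t k i o).

Definition Fhat t k o : R -> R :=
  kernel_cdf (kappa k) (lo k) (hi k) (bwY s t.-1 k o)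
    (numY s t.-1 k o) (fun j => smpY s t k j o).

Definition That t k o : R -> R :=
  monotone_map (wavg lo) (wavg hi) (lo k) (hi k) (Ghat t k o) (Fhat t k o).

Definition That_push t o : set (measurableTypeR R) -> \bar R :=
  pushforward (muhat s t.-1 o)
    ((fun x => \sum_(k < K) w k * That t k o x) : _ -> measurableTypeR R).

Definition adapted dT (T : measurableType dT) t (f : Omega -> T) : Prop :=
  forall B, measurable B -> filt t (f @^-1` B).

Variables (P : probability Omega R) (nu : 'I_K -> prob R) (mu0 : prob R).

(* Conditionally on [filt t.-1], the samples X_{t,k,i} drawn from
   [muhat t.-1] and Y_{t,k,j} drawn from [nu k] are independent; this is
   expressed on each event on which the two sample sizes are fixed. *)
Definition cond_indep_samples t k : Prop :=
  forall (m n : nat) (E : set Omega) (A B : nat -> set (measurableTypeR R)),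
    filt t.-1 E ->
    (forall i, measurable (A i)) -> (forall j, measurable (B j)) ->
    let E' := E `&` [set o | numX s t.-1 k o = m /\ numY s t.-1 k o = n] in
    P (E' `&` [set o | (forall i, (i < m)%N -> A i (smpX s t k i o)) /\
                       (forall j, (j < n)%N -> B j (smpY s t k j o))]) =
    (\int[P]_(o in E')
       ((\prod_(i < m) fine (muhat s t.-1 o (A i))) *
        (\prod_(j < n) fine (nu k (B j))))%:E)%E.

(* As [filt 0] is trivial, the choices made at time 0 are deterministic. *)
Definition is_scheme : Prop :=
  [/\ forall o, muhat s 0 o = mu0,
      forall t o, (0 < t)%N -> meas_eq (muhat s t o) (That_push t o),
      forall t k, (0 < t)%N -> cond_indep_samples t k,
      forall t k o, [/\ (0 < numX s t k o)%N, (0 < numY s t k o)%N,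
                        0 < bwX s t k o & 0 < bwY s t k o] &
      forall t k, [/\ adapted t (numX s t k), adapted t (numY s t k),
                      adapted t (bwX s t k : _ -> measurableTypeR R) &
                      adapted t (bwY s t k : _ -> measurableTypeR R)]].

(* The Borel map has domain R^(m+n) * (0,oo)^2. *)
Definition borel_dependency t k : Prop :=
  forall m n : nat, (0 < m)%N -> (0 < n)%N ->
    exists h : (m + n).-tuple (measurableTypeR R) *
               (measurableTypeR R * measurableTypeR R) -> (R -> R),
      let D := [set z | 0 < z.2.1 /\ 0 < z.2.2] in
      [/\ forall z, D z -> Clin (h z),
          forall U, borel_Clin U -> measurable (D `&` h @^-1` U) &
          {ae P, forall o, numX s t.-1 k o = m -> numY s t.-1 k o = n ->
             That t k o =
             h ([tuple of [tuple (smpX s t k i o : measurableTypeR R) | i < m] ++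
                          [tuple (smpY s t k j o : measurableTypeR R) | j < n]],
                (bwX s t.-1 k o, bwY s t.-1 k o))}].

Definition growth_le (C beta : R) (t m n : nat) (b h : R) : Prop :=
  [/\ m%:R <= C * beta ^- (2 * t), n%:R <= C * beta ^- (2 * t),
      b <= C * beta `^ (t%:R / 2) & h <= C * beta `^ (t%:R / 2)].

Definition good_choice (C : prob R -> R) (beta : R) (t : nat) : Prop :=
  [/\ {ae P, forall o k, growth_le (C (muhat s t.-1 o)) beta t
        (numX s t.-1 k o) (numY s t.-1 k o) (bwX s t.-1 k o) (bwY s t.-1 k o)},
      forall k, condexp_le P (filt t.-1)
        (fun o => ('N[muhat s t.-1 o]_2%:E[(fun x =>
            (That t k o x - ot_map (muhat s t.-1 o) (nu k) x)%:E)] ^+ 2)%E)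
        (beta ^+ t) &
      condexp_le P (filt t.-1)
        (fun o => (W2 (That_push t o) (muhat s t o) ^+ 2)%E) (beta ^+ t)].

End scheme.

Arguments run : clear implicits.

(* A rule prescribing sample sizes or bandwidths from the current measure. *)
Definition borel_rule (R : realType) dT (T : measurableType dT)
    (f : prob R -> T) : Prop :=
  forall B, measurable B -> borel_P2 (P2 `&` f @^-1` B).

(* Main.v *)
(** On the line everything is read off quantile functions. The quantile
coupling is optimal, so [W2 m n ^+ 2] is the squared L2(0,1) distance of the
quantiles [quantile m] and [quantile n]. Hence [V(m)] splits as
[W2 m mubar ^+ 2 + V(mubar)], where [mubar] has the weighted mean of the
quantiles of the [nu k] as its quantile: it is the barycenter, it is [G(m)]
for every atomless [m], and (iii)-(v) follow, (iv) and (v) being equalities.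

The estimated maps are increasing and bi-Lipschitz on the support, so each
[muhat t o] keeps a Lipschitz distribution function, and its quantile is the
composite of the averaged map with the previous quantile. The error of
[That t k] is bounded by the sup deviations of the two smoothed distribution
functions, which, up to bandwidth and grid errors, are bounded by the
deviations of the empirical distribution functions at finitely many points;
these have conditional variance of order one over the sample size. All
parameters are functions of the least integer Lipschitz constant of the
current distribution function, which depends on the measure in a Borel way.
Finally the expected squared distance to [mubar] contracts to the averaged
loss, at most [beta ^+ t], which is summable. *)
Require Import Defs.
From HB Require Import structures.
From mathcomp Require Import all_boot all_order all_algebra.
From mathcomp Require Import all_classical all_reals all_analysis.
From mathcomp Require Import measurable_realfun ring lra.

Set Implicit Arguments.
Unset Strict Implicit.
Unset Printing Implicit Defensive.

Import Order.TTheory GRing.Theory Num.Theory.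
Import numFieldNormedType.Exports.

Local Open Scope classical_set_scope.
Local Open Scope ring_scope.

(** * Distribution functions and quantile functions *)

Section distribution_functions.
Context {R : realType}.
Implicit Types m n : prob R.

(** [ot_map] is an arbitrary choice among optimal maps, so the error of [That] can be evaluated only
    once every optimal map is known to agree with the monotone one along the quantiles. Uniqueness
    is proved quantitatively, from the cost saved by exchanging crossing mass. Measurability in the
    outcome passes through the quantile of [muhat] as a joint function of outcome and level, not
    through a sigma-algebra on measures. The error aimed at is [r = beta^(t/2)] in L2. A grid of
    about 1/r nodes stands in for a uniform inequality on empirical distribution functions, so about
    r^-3 samples suffice, within the allowed r^-4 = beta^-(2t). Bandwidths only have to be small, so
    no rate in the bandwidth is extracted from the kernels. Since [C] is quantified before the
    weights and [mu0], its constants involve only the [nu k], the interval lengths and the Lipschitz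
    level of the current measure. Independence is given on events only, as integrals of products of
    random probabilities; variance bounds are therefore proved on slices where the relevant random
    quantities are almost constant. *)

Lemma measurable_fun_leP d (T : measurableType d) (D : set T) (f : T -> R) :
  measurable D -> (forall y, measurable (D `&` [set t | f t <= y])) ->
  measurable_fun D f.
Proof.
move=> mD H; apply: (measurability _ (RGenOInfty.measurableE R)) => //.
move=> _ [_ [y ->] <-]; rewrite (_ : _ `&` _ = D `\` (D `&` [set t | f t <= y])).
  exact: measurableD.
apply/seteqP; split => t /=; rewrite in_itv/= andbT.
  by move=> [Dt yf]; split => // -[_]; rewrite leNgt yf.
by move=> [Dt H']; split => //; rewrite ltNge; apply/negP => ?; exact: H'.
Qed.

Definition cdfr m x : R := fine (m `]-oo, x]%classic).

Lemma cdfrE m x : (cdfr m x)%:E = m `]-oo, x]%classic.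
Proof. by rewrite fineK// fin_num_measure. Qed.

Lemma cdfr_nd m x y : x <= y -> cdfr m x <= cdfr m y.
Proof.
move=> xy; rewrite -lee_fin !cdfrE le_measure ?inE//.
exact: subset_itvl.
Qed.

Lemma cdfr_ge0 m x : 0 <= cdfr m x.
Proof. by rewrite -lee_fin cdfrE. Qed.

Lemma cdfr_le1 m x : cdfr m x <= 1.
Proof. by rewrite -lee_fin cdfrE probability_le1. Qed.

Let idTR : measurableTypeR R -> R := idfun.

#[local] HB.instance Definition _ :=
  @isMeasurableFun.Build _ _ _ _ idTR (@measurable_id _ _ setT).

Lemma cdfr_cvgy m : cdfr m @ +oo --> (1 : R).
Proof. by apply: fine_cvg; exact: (@cvg_cdfy1 _ _ _ m idTR). Qed.

Lemma cdfr_cvgNy m : cdfr m @ -oo --> (0 : R).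
Proof. by apply: fine_cvg; exact: (@cvg_cdfNy0 _ _ _ m idTR). Qed.

Lemma cdfr_right_continuous m : right_continuous (cdfr m).
Proof.
move=> x; apply: fine_cvg; rewrite cdfrE.
exact: (@cdf_right_continuous _ _ _ m idTR).
Qed.

Lemma cdfr_large m u : u < 1 -> exists x, u < cdfr m x.
Proof.
move=> u1; have /cvgr_gt/(_ _ u1) := @cdfr_cvgy m.
by move=> [M [_ H]]; exists (M + 1); apply: H; rewrite ltrDl.
Qed.

Lemma cdfr_small m u : 0 < u -> exists x, cdfr m x < u.
Proof.
move=> u0; have /cvgr_lt/(_ _ u0) := @cdfr_cvgNy m.
by move=> [M [_ H]]; exists (M - 1); apply: H; rewrite ltrBlDr ltrDl.
Qed.

Lemma cdfr_rc m x u : (forall y, x < y -> u <= cdfr m y) -> u <= cdfr m x.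
Proof.
move=> H; have /cvgP cx := @cdfr_right_continuous m x.
rewrite -(cvg_lim _ (@cdfr_right_continuous m x))//.
apply: limr_ge => //; near=> y; apply: H.
by near: y; exact: nbhs_right_gt.
Unshelve. all: by end_near. Qed.

Lemma cdfr_rclt m x u : cdfr m x < u -> exists2 y, x < y & cdfr m y < u.
Proof.
move=> xu; apply: contrapT => H.
suff : u <= cdfr m x by rewrite leNgt xu.
by apply: cdfr_rc => y xy; rewrite leNgt; apply/negP => yu; apply: H; exists y.
Qed.

Lemma prob_itvoc m x y : x <= y -> m `]x, y]%classic = (cdfr m y - cdfr m x)%:E.
Proof.
move=> xy; rewrite EFinB !cdfrE.
have -> : `]x, y]%classic = `]-oo, y]%classic `\` `]-oo, x]%classic :> set R.
  by rewrite -[RHS]setCK setCD setCitvl setUC -[LHS]setCK setCitv.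
rewrite measureD// ?setIidr//; last by rewrite -ge0_fin_numE// fin_num_measure.
exact: subset_itvl.
Qed.

Lemma cdfr_measurable m : measurable_fun [set: measurableTypeR R] (cdfr m).
Proof. by apply: nondecreasing_measurable => // x y; exact: cdfr_nd. Qed.

Lemma prob_cdfr_eq m n : (forall x, cdfr m x = cdfr n x) -> meas_eq m n.
Proof.
move=> mn A mA.
have ocE x y : (m `]x, y]%classic = n `]x, y]%classic)%E.
  have [xy|yx] := leP x y; first by rewrite !prob_itvoc// !mn.
  by rewrite set_itv_ge ?measure0// bnd_simp -leNgt ltW.
apply: (@measure_unique _ _ (measurableTypeR R) (@ocitv R)
  (fun i => `]- i%:R, i%:R]%classic)) => //.
- exact: ocitvI.
- by move=> i; exists (- i%:R, i%:R).
- apply/seteqP; split => // x _; exists (Num.truncn `|x|).+1 => //=.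
  rewrite in_itv/=; have /ltr_normlP[x1 x2] := truncnS_gt `|x|.
  by rewrite ltrNl x1 ltW.
- by move=> _ [[x y] _ <-]; exact: ocE.
- by move=> k; rewrite -ge0_fin_numE// fin_num_measure.
Qed.

Lemma meas_eq_cdfr m n : meas_eq m n -> cdfr m = cdfr n.
Proof. by move=> mn; apply/funext => x; rewrite /cdfr mn. Qed.

(* The value 0 outside ]0, 1[ keeps the quantile function measurable on the whole line. *)
Definition quantile m u : R :=
  if 0 < u < 1 then inf [set x | u <= cdfr m x] else 0.

(** Right continuity of the distribution function makes the infimum attained, which gives this
    Galois connection. Later order arguments on quantiles use it in place of the infimum. *)
Lemma quantile_le m u x : 0 < u < 1 -> (quantile m u <= x) = (u <= cdfr m x).
Proof.
move=> u01; rewrite /quantile u01; case/andP: u01 => u0 u1.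
set S := [set y | u <= cdfr m y].
have hS : has_inf S.
  split; first by have [y /ltW] := cdfr_large m u1; exists y.
  have [y yu] := cdfr_small m u0; exists y => z /= uz.
  rewrite leNgt; apply/negP => zy.
  by have := le_lt_trans (le_trans uz (cdfr_nd m (ltW zy))) yu; rewrite ltxx.
apply/idP/idP => [Sx|ux]; last exact: ge_inf (proj2 hS) _ ux.
apply: cdfr_rc => y xy.
have e0 : 0 < y - inf S by rewrite subr_gt0 (le_lt_trans Sx).
have [z Sz] := inf_adherent e0 hS.
by rewrite addrC subrK => /ltW zy; exact: le_trans Sz (cdfr_nd m zy).
Qed.

Lemma quantile_gt m u x : 0 < u < 1 -> (x < quantile m u) = (cdfr m x < u).
Proof. by move=> u01; rewrite !ltNge quantile_le. Qed.

Lemma quantile_uniq m u y : 0 < u < 1 ->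
  (forall x, (y <= x) = (u <= cdfr m x)) -> quantile m u = y.
Proof.
move=> u01 H; apply/eqP; rewrite eq_le quantile_le// -H lexx/=.
by rewrite H -(quantile_le m _ u01).
Qed.

Lemma measurable_quantile m :
  measurable_fun setT (quantile m : measurableTypeR R -> measurableTypeR R).
Proof.
rewrite (_ : quantile m = quantile m \_ `]0, 1[).
  apply/(measurable_restrictT (quantile m)) => //.
  apply: measurable_fun_leP => // y.
  rewrite (_ : _ `&` _ = `]0, 1[%classic `&` `]-oo, cdfr m y]%classic).
    exact: measurableI.
  by apply/seteqP; split => u /= []; rewrite !in_itv/= => u01;
    rewrite quantile_le.
apply/funext => u; rewrite patchE.
case: ifPn => //; rewrite notin_setE/= in_itv/= => /negP/negbTE.
by rewrite /quantile => ->.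
Qed.

End distribution_functions.

(** * The uniform law on the unit interval and inverse transform sampling *)

Section law.
Context {R : realType}.

Lemma measurable_set_bool d (T : measurableType d) (b : T -> bool) :
  measurable_fun setT b -> measurable [set x | b x].
Proof.
by move=> mb; rewrite -[X in measurable X]setTI; exact: (mb measurableT [set true]).
Qed.

Lemma measurable_bool_EFin d (T : measurableType d) (b : T -> bool) :
  measurable_fun setT b -> measurable_fun setT (fun x => ((b x)%:R : R)%:E).
Proof.
move=> mb; have -> : (fun x => ((b x)%:R : R)%:E) =
    (fun x => (\1_[set x | b x] x : R)%:E).
  by apply/funext => x; rewrite indicE; congr ((nat_of_bool _)%:R%:E); apply/idP/idP; rewrite inE.
by apply/measurable_EFinP; apply: measurable_indic; exact: measurable_set_bool.
Qed.

Lemma integral_bool d (T : measurableType d) (mu : {measure set T -> \bar R})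
    (b : T -> bool) : measurable_fun setT b ->
  (\int[mu]_x ((b x)%:R)%:E = mu [set x | b x])%E.
Proof.
move=> mb; rewrite -[in RHS](setIT [set x | b x]) -integral_indic//; last first.
  exact: measurable_set_bool.
apply: eq_integral => x _; rewrite indicE; congr ((nat_of_bool _)%:R%:E).
by apply/idP/idP; rewrite inE.
Qed.

Definition unif : prob R := uniform_prob (@ltr01 R).

Lemma unif_itv (i : interval R) : [set` i] `<=` `[0, 1]%classic ->
  unif [set` i] = lebesgue_measure [set` i].
Proof.
move=> i01; rewrite /unif /=/uniform_prob integral_uniform_pdf setIidl//.
transitivity (\int[lebesgue_measure]_(x in [set` i]) (cst 1%E x : \bar R))%E.
  apply: eq_integral => x; rewrite inE/= => /i01/=.
  by rewrite in_itv/= /uniform_pdf => ->; rewrite subr0 invr1.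
by rewrite integral_cst// mul1e.
Qed.

Lemma unif_le u : 0 <= u <= 1 -> unif [set x | 0 < x < 1 /\ x <= u] = u%:E.
Proof.
(* For [u = 1] the constraint [x < 1] makes the set open on the right, so this case is treated
   apart. *)
move=> /andP[u0 u1]; have [->|uN1] := eqVneq u 1.
  rewrite (_ : [set _ | _] = `]0, 1[%classic).
    rewrite unif_itv ?lebesgue_measure_itv/= ?lte_fin ?ltr01 ?oppr0 ?adde0//.
    exact: subset_itv_oo_cc.
  apply/seteqP; split => x /=; rewrite in_itv/=; first by case.
  by move=> x01; split => //; case/andP: x01 => _ /ltW.
rewrite (_ : [set _ | _] = `]0, u]%classic).
  rewrite unif_itv ?lebesgue_measure_itv/=; last first.
    by move=> x /=; rewrite !in_itv/= => /andP[/ltW-> /le_trans->].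
  rewrite lte_fin; case: ltP => [_|u0']; first by rewrite oppr0 adde0.
  by congr EFin; apply/eqP; rewrite eq_le u0 u0'.
apply/seteqP; split => x /=; rewrite in_itv/=; first by move=> [/andP[->]].
by move=> /andP[-> xu]; rewrite xu (le_lt_trans xu)// lt_neqAle uN1.
Qed.

Lemma unif01 : {ae unif, forall u, 0 < u < 1}.
Proof.
exists (~` `]0, 1[); split => //; first exact: measurableC.
- rewrite probability_setC// unif_itv; last exact: subset_itv_oo_cc.
  by rewrite lebesgue_measure_itv/= lte_fin ltr01 oppr0 adde0 subee.
Qed.

Lemma ae_imp d (T : measurableType d) (mu : {measure set T -> \bar R})
    (A B : T -> Prop) :
  {ae mu, forall x, A x} -> (forall x, A x -> B x) -> {ae mu, forall x, B x}.
Proof.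
move=> [N [mN N0 sN]] AB; exists N; split => // x /= Bx.
by apply: sN => /= Ax; exact/Bx/AB.
Qed.

Lemma unif_ae (Q : R -> Prop) :
  (forall u, 0 < u < 1 -> Q u) -> {ae unif, forall u, Q u}.
Proof. by move=> H; exact: ae_imp unif01 H. Qed.

Definition law d (T : measurableType d) d' (T' : measurableType d')
    (P : probability T R) (f : T -> T') (mf : measurable_fun setT f) :
  probability T' R := distribution P (mfun_Sub (mem_set mf)).

Definition lawR d (T : measurableType d) (P : probability T R) (f : T -> R)
    (mf : measurable_fun setT (f : T -> measurableTypeR R)) : prob R := law P mf.

Lemma meas_eq_integral (m n : prob R) (D : set R) (f : R -> \bar R) :
  meas_eq m n -> (\int[m]_(x in D) f x = \int[n]_(x in D) f x)%E.
Proof. by move=> mn; apply: eq_measure_integral => A mA _; exact: mn. Qed.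

Lemma measure_ae_eq d (T : measurableType d) (mu : {measure set T -> \bar R})
    (A B : set T) : measurable A -> measurable B ->
  {ae mu, forall x, A x <-> B x} -> mu A = mu B.
Proof.
move=> mA mB AB; rewrite -(setIT A) -(setIT B) -!integral_indic//.
apply: ge0_ae_eq_integral => //.
- by apply/measurable_EFinP; exact: measurable_indic.
- by apply/measurable_EFinP; exact: measurable_indic.
- apply: filterS AB => x ABx _; rewrite !indicE; congr ((nat_of_bool _)%:R%:E).
  by apply/idP/idP; rewrite !inE ABx.
Qed.

Lemma law_le_quantile (m : prob R) x :
  unif (quantile m @^-1` `]-oo, x]%classic) = (cdfr m x)%:E.
Proof.
rewrite -(@unif_le (cdfr m x)) ?cdfr_ge0 ?cdfr_le1//.
have mq : measurable (quantile m @^-1` `]-oo, x]%classic).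
  by rewrite -[X in measurable X]setTI; exact: measurable_quantile.
have mu : measurable [set u | 0 < u < 1 /\ u <= cdfr m x].
  rewrite (_ : [set _ | _] = `]0, 1[%classic `&` `]-oo, cdfr m x]%classic).
    exact: measurableI.
  by apply/seteqP; split => u /=; rewrite !in_itv.
apply: measure_ae_eq => //.
apply: unif_ae => u u01 /=; rewrite in_itv/= quantile_le// u01.
by split => // -[].
Qed.

(** Inverse transform sampling: all measures are thereby realized by functions on one common
    probability space. *)
Lemma law_quantile (m : prob R) : meas_eq (lawR unif (measurable_quantile m)) m.
Proof.
by apply: prob_cdfr_eq => x; apply: EFin_inj; rewrite cdfrE -law_le_quantile.
Qed.

Lemma ge0_integral_law d (T : measurableType d) d' (T' : measurableType d')
    (P : probability T R) (f : T -> T') (mf : measurable_fun setT f)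
    (g : T' -> \bar R) : measurable_fun setT g -> (forall x, 0 <= g x)%E ->
  (\int[law P mf]_x g x = \int[P]_x g (f x))%E.
Proof. by move=> mg g0; rewrite /law ge0_integral_pushforward. Qed.

Lemma ge0_integral_quantile (m : prob R) (g : R -> \bar R) :
  measurable_fun [set: measurableTypeR R] g -> (forall x, 0 <= g x)%E ->
  (\int[m]_x g x = \int[unif]_u g (quantile m u))%E.
Proof.
move=> mg g0; rewrite -(meas_eq_integral _ _ (law_quantile m)).
exact: ge0_integral_law.
Qed.

End law.

(** * The quadratic cost as an integral of joint tail probabilities *)

Section coupling_cost.
Context {R : realType}.
Local Notation leb := (@lebesgue_measure R).

(** The factor [max 0 (b - s)] is the length of the section at [s] of the triangle [a <= s < t < b],
    so this is the outer integral of its area. *)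
Lemma integral_posB (a b : R) :
  (\int[leb]_s (((a <= s)%R%:R * Num.max 0 (b - s))%:E) =
   ((Num.max 0 (b - a)) ^+ 2 / 2)%:E)%E.
Proof.
have [ab|ba] := ltP a b; last first.
  rewrite integral0_eq ?mul0r//; last first.
    move=> s _; case: leP => as_; rewrite ?mul0r//.
    by rewrite max_l ?mulr0// subr_le0 (le_trans ba).
  by rewrite max_l ?subr_le0// expr0n/= mul0r.
rewrite (_ : (fun s : R => _) = (fun s => (b - s)%:E) \_ `[a, b]); last first.
  apply/funext => s; rewrite patchE; case: ifPn; rewrite ?inE ?notin_setE/= in_itv/=.
    by move=> /andP[-> sb]; rewrite mul1r max_r ?subr_ge0.
  move=> /negP; rewrite negb_and -!ltNge => /orP[sa|bs].
    by rewrite leNgt sa mul0r.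
  by rewrite max_l ?mulr0// subr_le0 ltW.
rewrite -integral_mkcond.
have dF (x : R) : is_derive x 1 (fun s => - ((b - s) ^+ 2 / 2)) (b - x).
  apply: is_derive_eq.
  by rewrite /GRing.scale/=; field.
have cF (x : R) : {for x, continuous (fun s => - ((b - s) ^+ 2 / 2))}.
  by apply: differentiable_continuous; apply/derivable1_diffP; have [] := dF x.
rewrite (@continuous_FTC2 _ _ (fun s => - ((b - s) ^+ 2 / 2))) => //.
- rewrite subrr expr0n/= mul0r oppr0 -EFinB sub0r opprK max_r// subr_ge0 ltW//.
- apply: continuous_subspaceT => x; apply: cvgB; [exact: cvg_cst|exact: cvg_id].
- split.
  + by move=> x _; have [] := dF x.
  + by apply: cvg_at_right_filter; exact: cF.
  + by apply: cvg_at_left_filter; exact: cF.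
- by move=> x _; rewrite derive1E; exact: (derive_val (is_derive:=dF x)).
Qed.

Lemma triangle_area (a b : R) :
  (\int[leb]_s \int[leb]_t (((a <= s) && (s < t) && (t < b))%R%:R : R)%:E =
   ((Num.max 0 (b - a)) ^+ 2 / 2)%:E)%E.
Proof.
rewrite -integral_posB; apply: eq_integral => s _.
case: (leP a s) => as_ /=; last by rewrite mul0r integral0.
rewrite mul1r integral_bool; last first.
  by apply: measurable_and; exact: measurable_fun_ltr.
rewrite (_ : [set _ | _] = `]s, b[%classic); last first.
  by apply/seteqP; split => x /=; rewrite in_itv.
rewrite [LHS](_ : _ = leb `]s, b[%classic)// lebesgue_measure_itv/= lte_fin; case: ltP => sb; rewrite -?EFinB.
  by rewrite max_r// subr_ge0 ltW.
by rewrite max_l// subr_le0.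
Qed.

(** The cut-off at [s < t] is there because only pairs of levels in this order lie in the triangle
    over an upward move from [X] to [Y]. *)
Definition tail d (T : measurableType d) (P : probability T R) (X Y : T -> R)
    (z : measurableTypeR R * measurableTypeR R) : \bar R :=
  if z.1 < z.2 then P [set o | ((X o <= z.1) && (z.2 < Y o))%R] else 0%E.

Section half_cost.
Context d (T : measurableType d) (P : probability T R) (X Y : T -> R).
Hypotheses (mX : measurable_fun setT X) (mY : measurable_fun setT Y).

Let q (z : measurableTypeR R * measurableTypeR R * T) :=
  (X z.2 <= z.1.1) && (z.1.1 < z.1.2) && (z.1.2 < Y z.2).

Let mq : measurable_fun setT q.
Proof.
apply: measurable_and; first apply: measurable_and.
- by apply: measurable_fun_ler; [exact: measurableT_comp|do 2 apply: measurableT_comp => //].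
- by apply: measurable_fun_ltr => //; do 2 apply: measurableT_comp => //.
- by apply: measurable_fun_ltr => //; [do 2 apply: measurableT_comp => //|exact: measurableT_comp].
Qed.

Let q0 z : (0 <= ((q z)%:R : R)%:E)%E. Proof. by rewrite lee_fin. Qed.

Let tailE z : tail P X Y z = (\int[P]_o ((q (z, o))%:R)%:E)%E.
Proof.
rewrite integral_bool; last first.
  by apply: (measurableT_comp mq); exact: measurable_fun_pair.
rewrite /tail; case: ifPn => st; last first.
  rewrite (_ : [set _ | _] = set0) ?measure0//; apply/seteqP; split => // o.
  by rewrite /q/= (negbTE st) andbF.
by congr (P _); apply/seteqP; split => o; rewrite /q/= st andbT.
Qed.

Lemma measurable_tail : measurable_fun setT (tail P X Y).
Proof.
rewrite (_ : tail P X Y = fubini_F P (fun z => ((q z)%:R)%:E)); last first.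
  by apply/funext => z; rewrite tailE.
by apply: measurable_fun_fubini_tonelli_F => //; exact: measurable_bool_EFin.
Qed.

Lemma tail_ge0 z : (0 <= tail P X Y z)%E.
Proof. by rewrite /tail; case: ifP. Qed.

(* The positive part of [Y - X] squared is twice the area of
   [X <= s < t < Y]; Tonelli turns its expectation into an integral of joint
   tail probabilities. *)
Lemma half_cost :
  (\int[P]_o ((Num.max 0 (Y o - X o)) ^+ 2 / 2)%:E =
   \int[leb]_s \int[leb]_t tail P X Y (s, t))%E.
Proof.
have mqE := measurable_bool_EFin (R := R) mq.
pose r (z : T * measurableTypeR R * measurableTypeR R) : \bar R :=
  ((q (z.1.2, z.2, z.1.1))%:R)%:E.
have mr : measurable_fun setT r.
  apply: (measurableT_comp mqE); apply: measurable_fun_pair.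
    by apply: measurable_fun_pair => //; exact: measurableT_comp.
  exact: measurableT_comp.
have r0 z : (0 <= r z)%E by rewrite lee_fin.
transitivity (\int[P]_o \int[leb]_s \int[leb]_t r (o, s, t))%E.
  by apply: eq_integral => o _; rewrite -triangle_area.
rewrite (fubini_tonelli (fun z => \int[leb]_t r (z, t)))%E; last 2 first.
  exact: (measurable_fun_fubini_tonelli_F (m2 := leb) r mr r0).
  by move=> z; apply: integral_ge0 => t _; exact: r0.
apply: eq_integral => s _ /=.
pose rs (z : T * measurableTypeR R) := r (z.1, s : measurableTypeR R, z.2).
have mrs : measurable_fun setT rs.
  by apply: (measurableT_comp mr); apply: measurable_fun_pair => //; exact: measurable_fun_pair.
rewrite (fubini_tonelli rs) => //; last by move=> z; exact: r0.
by apply: eq_integral => t _ /=; rewrite tailE.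
Qed.

End half_cost.

End coupling_cost.

(** * Comonotone pairs minimize the cost for given marginals *)

Section comonotone.
Context {R : realType} d1 (T1 : measurableType d1) d2 (T2 : measurableType d2).
Local Notation leb := (@lebesgue_measure R).
Variables (P1 : probability T1 R) (P2 : probability T2 R).
Variables (X1 Y1 : T1 -> R) (X2 Y2 : T2 -> R).
Hypotheses (mX1 : measurable_fun setT X1) (mY1 : measurable_fun setT Y1).
Hypotheses (mX2 : measurable_fun setT X2) (mY2 : measurable_fun setT Y2).
Hypothesis XE : forall s, P1 [set o | X1 o <= s] = P2 [set o | X2 o <= s].
Hypothesis YE : forall s, P1 [set o | Y1 o <= s] = P2 [set o | Y2 o <= s].
Hypothesis comonotone : forall s t,
  P1 [set o | (X1 o <= s) && (t < Y1 o)] = 0%E \/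
  P1 [set o | (Y1 o <= t) && (s < X1 o)] = 0%E.

Let mle d (T : measurableType d) (X : T -> R) s :
  measurable_fun setT X -> measurable [set o | X o <= s].
Proof. by move=> mX; apply: measurable_set_bool; exact: measurable_fun_ler. Qed.

Let mlelt d (T : measurableType d) (X Y : T -> R) s t :
  measurable_fun setT X -> measurable_fun setT Y ->
  measurable [set o | (X o <= s) && (t < Y o)].
Proof.
move=> mX mY; apply: measurable_set_bool; apply: measurable_and.
  exact: measurable_fun_ler.
exact: measurable_fun_ltr.
Qed.

(** Both sides split the event that [X <= s] or [Y <= t] into two disjoint pieces. The marginals
    thus determine the difference of the two opposite crossing probabilities. *)
Let exchange d (T : measurableType d) (P : probability T R) (X Y : T -> R) s t :
  measurable_fun setT X -> measurable_fun setT Y ->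
  (P [set o | (X o <= s)%R && (t < Y o)%R] + P [set o | (Y o <= t)%R] =
   P [set o | (X o <= s)%R] + P [set o | (Y o <= t)%R && (s < X o)%R])%E.
Proof.
move=> mX mY; rewrite -!measureU; try by [exact: mle|exact: mlelt].
- congr (P _); apply/seteqP; split => o /=; rewrite !ltNge;
    by case: (X o <= s); case: (Y o <= t) => //=; tauto.
- by apply/seteqP; split => // o [/= H /andP[_]]; rewrite ltNge H.
- by apply/seteqP; split => // o [/= /andP[_]]; rewrite ltNge => /negP.
Qed.

(** The marginals fix the difference of the two crossing probabilities by [exchange]; when one of
    them vanishes, the other takes its least possible value. *)
Lemma comonotone_tail s t : (P1 [set o | (X1 o <= s)%R && (t < Y1 o)%R] <=
  P2 [set o | (X2 o <= s)%R && (t < Y2 o)%R])%E.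
Proof.
have [->//|E0] := comonotone s t.
have e1 := exchange P1 s t mX1 mY1; have e2 := exchange P2 s t mX2 mY2.
move: e1; rewrite E0 adde0 XE YE => e1.
have : (P1 [set o | (X1 o <= s)%R && (t < Y1 o)%R] + P2 [set o | (Y2 o <= t)%R] <=
        P2 [set o | (X2 o <= s)%R && (t < Y2 o)%R] + P2 [set o | (Y2 o <= t)%R])%E.
  by rewrite e1 e2 leeDl.
by rewrite leeD2rE// fin_num_measure//; exact: mle.
Qed.

(** The same comparison with slack: mass [c] crossing in both directions could be exchanged away, so
    the excess over the comonotone pair is at least [c]. *)
Lemma comonotone_tail_gap s t (c : \bar R) :
  (c <= P2 [set o | (X2 o <= s)%R && (t < Y2 o)%R])%E ->
  (c <= P2 [set o | (Y2 o <= t)%R && (s < X2 o)%R])%E ->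
  (P1 [set o | (X1 o <= s)%R && (t < Y1 o)%R] + c <=
   P2 [set o | (X2 o <= s)%R && (t < Y2 o)%R])%E.
Proof.
move=> ca cb; have [->|E0] := comonotone s t; first by rewrite add0e.
have e1 := exchange P1 s t mX1 mY1; have e2 := exchange P2 s t mX2 mY2.
move: e1; rewrite E0 adde0 XE YE => e1.
have : (P1 [set o | (X1 o <= s)%R && (t < Y1 o)%R] + c + P2 [set o | (Y2 o <= t)%R] <=
        P2 [set o | (X2 o <= s)%R && (t < Y2 o)%R] + P2 [set o | (Y2 o <= t)%R])%E.
  by rewrite addeAC e1 e2 leeD2l.
by rewrite leeD2rE// fin_num_measure//; exact: mle.
Qed.

Lemma comonotone_half_cost_le :
  (\int[P1]_o ((Num.max 0 (Y1 o - X1 o)) ^+ 2 / 2)%:E <=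
   \int[P2]_o ((Num.max 0 (Y2 o - X2 o)) ^+ 2 / 2)%:E)%E.
Proof.
rewrite !half_cost//.
have m1 := measurable_tail P1 mX1 mY1; have m2 := measurable_tail P2 mX2 mY2.
apply: ge0_le_integral => //.
- by move=> s _; apply: integral_ge0 => t _; exact: tail_ge0.
- exact: (measurable_fun_fubini_tonelli_F (m2 := leb) _ m1 (tail_ge0 _ _ _)).
- exact: (measurable_fun_fubini_tonelli_F (m2 := leb) _ m2 (tail_ge0 _ _ _)).
move=> s _; apply: ge0_le_integral => //.
- by move=> t _; exact: tail_ge0.
- by apply: (measurableT_comp m1); exact: measurable_fun_pair.
- by apply: (measurableT_comp m2); exact: measurable_fun_pair.
by move=> t _; rewrite /tail/=; case: ifP => // _; exact: comonotone_tail.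
Qed.

(** Integrates the gain [c] over a rectangle of levels. The condition [s1 <= t0] places the
    rectangle where [s < t], hence where [tail] is not cut off. *)
Lemma comonotone_half_cost_gap (s0 s1 t0 t1 c : R) :
  s0 <= s1 -> s1 <= t0 -> t0 <= t1 -> 0 <= c ->
  (forall s t, s0 < s <= s1 -> t0 < t <= t1 ->
    (c%:E <= P2 [set o | (X2 o <= s)%R && (t < Y2 o)%R])%E /\
    (c%:E <= P2 [set o | (Y2 o <= t)%R && (s < X2 o)%R])%E) ->
  (\int[P1]_o ((Num.max 0 (Y1 o - X1 o)) ^+ 2 / 2)%:E +
     (c * (s1 - s0) * (t1 - t0))%:E <=
   \int[P2]_o ((Num.max 0 (Y2 o - X2 o)) ^+ 2 / 2)%:E)%E.
Proof.
move=> s01 st t01 c0 H; rewrite !half_cost//.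
have m1 := measurable_tail P1 mX1 mY1; have m2 := measurable_tail P2 mX2 mY2.
pose box (z : measurableTypeR R * measurableTypeR R) : R :=
  c * (\1_`]s0, s1] z.1 * \1_`]t0, t1] z.2).
have mi (a b : R) : measurable_fun setT (\1_`]a, b] : measurableTypeR R -> R).
  exact: measurable_indic.
have box0 z : (0 <= (box z)%:E)%E by rewrite lee_fin mulr_ge0.
have mbox : measurable_fun setT (fun z => (box z)%:E).
  apply/measurable_EFinP; apply: measurable_funM => //.
  by apply: measurable_funM; apply: measurableT_comp (mi _ _) _.
have itvE (a b : R) : a <= b -> leb `]a, b]%classic = (b - a)%:E.
  move=> ab; rewrite lebesgue_measure_itv/= lte_fin; case: ltP => ba.
    by rewrite EFinB.
  by rewrite (_ : b = a) ?subrr//; apply/eqP; rewrite eq_le ab ba.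
have boxE : (\int[leb]_s \int[leb]_t (box (s, t))%:E = (c * (s1 - s0) * (t1 - t0))%:E)%E.
  transitivity (\int[leb]_s ((c * (t1 - t0))%:E * (\1_`]s0, s1] s)%:E))%E.
    apply: eq_integral => s _; rewrite /box/=.
    transitivity (\int[leb]_t ((c * \1_`]s0, s1] s)%:E * (\1_`]t0, t1] t)%:E))%E.
      by apply: eq_integral => t _; rewrite -EFinM mulrA.
    rewrite ge0_integralZl//; last 2 first.
    - by apply/measurable_EFinP.
    - by rewrite lee_fin mulr_ge0.
    rewrite integral_indic// setIT [X in (_ * X)%E](_ : _ = (t1 - t0)%:E); last exact: itvE.
    by rewrite -!EFinM mulrAC.
  rewrite ge0_integralZl//; last 2 first.
  - by apply/measurable_EFinP.
  - by rewrite lee_fin mulr_ge0// subr_ge0.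
  rewrite integral_indic// setIT [X in (_ * X)%E](_ : _ = (s1 - s0)%:E); last exact: itvE.
  by rewrite -EFinM mulrAC.
have mI1 := measurable_fun_fubini_tonelli_F (m2 := leb) _ m1 (tail_ge0 _ _ _).
have mI2 := measurable_fun_fubini_tonelli_F (m2 := leb) _ m2 (tail_ge0 _ _ _).
have mIb := measurable_fun_fubini_tonelli_F (m2 := leb) _ mbox box0.
have mpair s : measurable_fun setT
    (fun t : measurableTypeR R => (s, t) : measurableTypeR R * measurableTypeR R).
  exact: measurable_fun_pair.
rewrite -boxE -ge0_integralD//; last 2 first.
- by move=> s _; apply: integral_ge0 => t _; exact: tail_ge0.
- by move=> s _; apply: integral_ge0.
apply: ge0_le_integral => //.
- by move=> s _; apply: adde_ge0; apply: integral_ge0 => t _//; exact: tail_ge0.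
- exact: emeasurable_funD.
move=> s _; rewrite -ge0_integralD//; last 3 first.
- by move=> t _; exact: tail_ge0.
- exact: (measurableT_comp m1 (mpair s)).
- exact: (measurableT_comp mbox (mpair s)).
apply: ge0_le_integral => //.
- by move=> t _; apply: adde_ge0 => //; exact: tail_ge0.
- apply: emeasurable_funD; first exact: (measurableT_comp m1 (mpair s)).
  exact: (measurableT_comp mbox (mpair s)).
- exact: (measurableT_comp m2 (mpair s)).
move=> t _; rewrite /box/= !indicE.
have [/andP[sin tin]|] := boolP ((s \in `]s0, s1]%classic) && (t \in `]t0, t1]%classic)).
  rewrite sin tin !mulr1; move: sin tin; rewrite !inE/= !in_itv/= => sin tin.
  have lst : s < t.
    by case/andP: sin => _ /le_lt_trans; apply; case/andP: tin => /(le_lt_trans st).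
  rewrite /tail/= lst; have [ca cb] := H s t sin tin.
  exact: comonotone_tail_gap.
rewrite negb_and => /orP[]/negbTE ->; rewrite ?mul0r ?mulr0 adde0 /tail/=;
  by case: ifP => // _; exact: comonotone_tail.
Qed.

End comonotone.

(** * The squared Wasserstein distance as an L2 distance of quantiles *)

Section wasserstein_quantile.
Context {R : realType}.
Implicit Types m n : prob R.

Lemma sqr_half_costs (x y : R) : (x - y) ^+ 2 =
  2 * ((Num.max 0 (y - x)) ^+ 2 / 2 + (Num.max 0 (x - y)) ^+ 2 / 2).
Proof.
case: (leP x y) => xy.
  by rewrite max_r ?subr_ge0// max_l ?subr_le0//; field.
by rewrite max_l ?subr_le0 1?ltW// max_r ?subr_ge0 1?ltW//; field.
Qed.

Lemma measurable_half_cost d (T : measurableType d) (X Y : T -> R) :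
  measurable_fun setT X -> measurable_fun setT Y ->
  measurable_fun setT (fun o => ((Num.max 0 (Y o - X o)) ^+ 2 / 2)%:E).
Proof.
move=> mX mY; apply/measurable_EFinP; apply: measurable_funM => //.
apply: measurable_funX; apply: measurable_maxr => //; exact: measurable_funB.
Qed.

Lemma cost_half_costs d (T : measurableType d) (P : probability T R) (X Y : T -> R) :
  measurable_fun setT X -> measurable_fun setT Y ->
  (\int[P]_o ((X o - Y o) ^+ 2)%:E =
   2%:E * (\int[P]_o ((Num.max 0 (Y o - X o)) ^+ 2 / 2)%:E +
           \int[P]_o ((Num.max 0 (X o - Y o)) ^+ 2 / 2)%:E))%E.
Proof.
move=> mX mY; have h0 (x : R) : (0 <= (Num.max 0 x ^+ 2 / 2)%:E)%E.
  by rewrite lee_fin mulr_ge0// sqr_ge0.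
have m1 := measurable_half_cost mX mY; have m2 := measurable_half_cost mY mX.
rewrite -ge0_integralD// -ge0_integralZl//.
- by apply: eq_integral => o _; rewrite sqr_half_costs EFinM EFinD.
- exact: emeasurable_funD.
- by move=> o _; exact: adde_ge0.
Qed.

Lemma comonotone_cost_le d1 (T1 : measurableType d1) d2 (T2 : measurableType d2)
    (P1 : probability T1 R) (P2 : probability T2 R) (X1 Y1 : T1 -> R) (X2 Y2 : T2 -> R) :
  measurable_fun setT X1 -> measurable_fun setT Y1 ->
  measurable_fun setT X2 -> measurable_fun setT Y2 ->
  (forall s, P1 [set o | X1 o <= s] = P2 [set o | X2 o <= s]) ->
  (forall s, P1 [set o | Y1 o <= s] = P2 [set o | Y2 o <= s]) ->
  (forall s t, P1 [set o | (X1 o <= s) && (t < Y1 o)] = 0%E \/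
               P1 [set o | (Y1 o <= t) && (s < X1 o)] = 0%E) ->
  (\int[P1]_o ((X1 o - Y1 o) ^+ 2)%:E <= \int[P2]_o ((X2 o - Y2 o) ^+ 2)%:E)%E.
Proof.
move=> mX1 mY1 mX2 mY2 XE YE co; rewrite !cost_half_costs// lee_pmul2l//.
apply: leeD; apply: comonotone_half_cost_le => //.
by move=> s t; case: (co t s); [right|left].
Qed.

(** Both quantiles increase with the same variable [u]: if [cdfr m s <= cdfr n t], then
    [quantile m u <= s] forces [quantile n u <= t]. The other case is symmetric. *)
Lemma quantile_comonotone m n s t :
  unif [set u | (quantile m u <= s) && (t < quantile n u)] = 0%E \/
  unif [set u | (quantile n u <= t) && (s < quantile m u)] = 0%E.
Proof.
wlog : m n s t / cdfr m s <= cdfr n t.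
  move=> H; have [/H//|/ltW/H[]] := leP (cdfr m s) (cdfr n t); [by right|by left].
move=> mn; left; rewrite -[RHS](measure0 unif); apply: measure_ae_eq => //.
  apply: measurable_set_bool; apply: measurable_and.
    by apply: measurable_fun_ler => //; exact: measurable_quantile.
  by apply: measurable_fun_ltr => //; exact: measurable_quantile.
apply: unif_ae => u u01 /=; split => //.
by rewrite quantile_le// quantile_gt// => /andP[/le_trans/(_ mn)]; rewrite leNgt => /negP.
Qed.

Definition qdist m n : \bar R := (\int[unif]_u ((quantile m u - quantile n u) ^+ 2)%:E)%E.

Lemma qdist_ge0 m n : (0 <= qdist m n)%E.
Proof. by apply: integral_ge0 => u _; rewrite lee_fin sqr_ge0. Qed.

Lemma quantile_pair_measurable m n : measurable_fun setT
  (fun u : measurableTypeR R => (quantile m u : measurableTypeR R, quantile n u : measurableTypeR R)).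
Proof. by apply: measurable_fun_pair; exact: measurable_quantile. Qed.

Lemma measurable_sqrB d (T : measurableType d) (f g : T -> R) :
  measurable_fun setT f -> measurable_fun setT g ->
  measurable_fun setT (fun x => ((f x - g x) ^+ 2)%:E).
Proof.
by move=> mf mg; apply/measurable_EFinP; apply: measurable_funX; exact: measurable_funB.
Qed.

Lemma sqr_sqrt_poweR (x : \bar R) : (0 <= x)%E -> ((x `^ 2^-1) ^+ 2 = x)%E.
Proof.
case: x => [r|_|//].
- rewrite lee_fin => r0; rewrite poweR_EFin -EFin_expe -powR_mulrn ?powR_ge0//.
  by rewrite -powRrM mulVf// powRr1.
- by rewrite poweRyr ?invr_eq0//= expe2 mulyy.
Qed.

(** The joint law of the two quantiles is an admissible coupling, and it is comonotone with the same
    marginals as any other one, so it attains the infimum. *)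
Lemma W2_sqr m n : (W2 m n ^+ 2 = qdist m n)%E.
Proof.
rewrite /W2; set S := [set _ | _ in _].
have -> : ereal_inf S = qdist m n.
  apply/eqP; rewrite eq_le; apply/andP; split.
    apply: ereal_inf_lbound; exists (law unif (quantile_pair_measurable m n)).
      by split => A mA; [exact: (law_quantile m)|exact: (law_quantile n)].
    rewrite ge0_integral_law//=.
    - by apply: eq_integral => u _; rewrite real_normK// num_real.
    - apply/measurable_EFinP; apply: measurable_funX.
      by apply: measurableT_comp => //; exact: measurable_funB.
  apply: le_ereal_inf_tmp => _ [pi [pim pin] <-].
  under eq_integral do rewrite real_normK ?num_real//.
  apply: comonotone_cost_le => //.
  - exact: measurable_quantile.
  - exact: measurable_quantile.
  - move=> s; rewrite (_ : [set _ | _] = quantile m @^-1` `]-oo, s]%classic); last first.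
      by apply/seteqP; split => u /=; rewrite in_itv.
    by rewrite law_le_quantile cdfrE -pim.
  - move=> s; rewrite (_ : [set _ | _] = quantile n @^-1` `]-oo, s]%classic); last first.
      by apply/seteqP; split => u /=; rewrite in_itv.
    by rewrite law_le_quantile cdfrE -pin.
  - exact: quantile_comonotone.
by rewrite sqr_sqrt_poweR// qdist_ge0.
Qed.

Lemma W2_ge0 (m n : set (measurableTypeR R) -> \bar R) : (0 <= W2 m n)%E.
Proof. exact: poweR_ge0. Qed.

Lemma W2_meas_eq (m m' n n' : set (measurableTypeR R) -> \bar R) :
  meas_eq m m' -> meas_eq n n' -> W2 m n = W2 m' n'.
Proof.
move=> mm nn; rewrite /W2; congr (ereal_inf _ `^ _)%E; congr (image _ _).
apply/seteqP; split => pi [pim pin]; split => A mA.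
- by rewrite pim// mm.
- by rewrite pin// nn.
- by rewrite pim// -mm.
- by rewrite pin// -nn.
Qed.

Lemma quantile_meas_eq m n : meas_eq m n -> quantile m = quantile n.
Proof. by move=> /meas_eq_cdfr mn; apply/funext => u; rewrite /quantile mn. Qed.

Lemma qdist_refl m n : meas_eq m n -> qdist m n = 0%E.
Proof.
move=> /quantile_meas_eq mn; rewrite /qdist mn integral0_eq// => u _.
by rewrite subrr expr0n.
Qed.

Lemma qdist_eq0 m n : qdist m n = 0%E -> meas_eq m n.
Proof.
move=> q0; have mq : measurable_fun setT
    (fun u : measurableTypeR R => ((quantile m u - quantile n u) ^+ 2)%:E).
  by apply: measurable_sqrB; exact: measurable_quantile.
have /ae_eq_integral_abs : measurable_fun setT
    (fun u : measurableTypeR R => ((quantile m u - quantile n u) ^+ 2)%:E) by [].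
move=> /(_ unif measurableT)[H _].
have {H}/H H : (\int[unif]_u `|((quantile m u - quantile n u) ^+ 2)%:E| = 0)%E.
  by rewrite -[RHS]q0; apply: eq_integral => u _; rewrite gee0_abs// lee_fin sqr_ge0.
apply: prob_cdfr_eq => x; apply: EFin_inj; rewrite -!law_le_quantile.
have mp (p : prob R) :
    measurable (quantile p @^-1` `]-oo, x]%classic : set (measurableTypeR R)).
  by rewrite -[X in measurable X]setTI; exact: measurable_quantile.
apply: measure_ae_eq => //.
have {}H : {ae unif, forall u, setT u -> ((quantile m u - quantile n u) ^+ 2)%:E = cst 0%E u}.
  exact: H.
apply: (ae_imp H) => u /= /(_ I)[] /eqP.
by rewrite sqrf_eq0 subr_eq0 => /eqP ->.
Qed.

Lemma quantile_nd m u v : 0 < u -> u <= v -> v < 1 -> quantile m u <= quantile m v.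
Proof.
move=> u0 uv v1; rewrite quantile_le ?u0 ?(le_lt_trans uv)//.
apply: (le_trans uv); rewrite -(quantile_le m) ?lexx// v1 andbT; exact: lt_le_trans uv.
Qed.

Lemma quantile_lc m v x : 0 < v < 1 ->
  (forall u, 0 < u < v -> quantile m u <= x) -> quantile m v <= x.
Proof.
move=> /andP[v0 v1] H; rewrite quantile_le ?v0//; apply/ler_addgt0Pr => e e0.
have [ev|ve] := ltP e v; last by rewrite (le_trans ve)// lerDr cdfr_ge0.
rewrite -lerBlDr -quantile_le ?subr_gt0 ?ev/=; last first.
  by rewrite (lt_trans _ v1)// ltrBlDr ltrDl.
by apply: H; rewrite subr_gt0 ev ltrBlDr ltrDl.
Qed.

(** Nondecreasing and left continuous on the open unit interval: under monotonicity a single point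
    below [v] with a nearby value is enough. Together these properties single out quantile
    functions, and they pass to weighted sums and to composites with continuous nondecreasing
    maps. *)
Definition quantile_like (q : R -> R) : Prop :=
  (forall u v, 0 < u -> u <= v -> v < 1 -> q u <= q v) /\
  (forall v e, 0 < v < 1 -> 0 < e -> exists2 u, 0 < u < v & q v - e <= q u).

Lemma quantile_likeP m : quantile_like (quantile m).
Proof.
split; first exact: quantile_nd.
move=> v e v01 e0; apply: contrapT => H.
suff : quantile m v <= quantile m v - e by rewrite leNgt ltrBlDr ltrDl e0.
apply: quantile_lc => // u uv; rewrite leNgt; apply/negP => /ltW qe.
by apply: H; exists u.
Qed.

Lemma quantile_like_sum (I : finType) (w : I -> R) (q : I -> R -> R) :
  (forall k, 0 <= w k) -> (forall k, quantile_like (q k)) ->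
  quantile_like (fun u => \sum_k w k * q k u).
Proof.
move=> w0 Hq; split=> [u v u0 uv v1|v e v01 e0].
  by apply: ler_sum => k _; rewrite ler_wpM2l//; apply: (Hq k).1.
(* The summand 1 keeps [W] positive; the total weight is at most [W], so an error [e / W] in each
   function adds up to at most [e]. *)
pose W := 1 + \sum_k w k.
have W0 : 0 < W by rewrite ltr_pwDl// sumr_ge0.
have eW : 0 < e / W by rewrite divr_gt0.
have /choice[f Hf] : forall k, exists u, 0 < u < v /\ q k v - e / W <= q k u.
  by move=> k; have [u uv H] := (Hq k).2 v _ v01 eW; exists u.
case/andP: (v01) => v0 v1.
(* By monotonicity the largest of the individual points serves all functions at once. The default
   [v / 2] makes it positive, also for an empty family. *)
pose u := \big[Num.max/v / 2]_k f k.
have uv : u < v.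
  apply/bigmax_ltP; split; last by move=> k _; have [/andP[]] := Hf k.
  by rewrite ltr_pdivrMr// ltr_pMr// ltr1n.
have u0 : 0 < u by apply: lt_le_trans (bigmax_ge_id _ _ _ _); rewrite divr_gt0.
exists u; first by rewrite u0.
apply: (@le_trans _ _ (\sum_k w k * (q k v - e / W))).
  under [X in _ <= X]eq_bigr do rewrite mulrBr.
  rewrite sumrB lerD2l lerN2 -mulr_suml mulrCA ler_piMr ?(ltW e0)//.
  by rewrite ler_pdivrMr// mul1r lerDr.
apply: ler_sum => k _; rewrite ler_wpM2l//; have [/andP[f0 _] H] := Hf k.
by apply: (le_trans H); apply: (Hq k).1 => //; [exact: le_bigmax|exact: lt_trans v1].
Qed.

Lemma quantile_like_comp (S q : R -> R) :
  continuous S -> {homo S : x y / x <= y} -> quantile_like q ->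
  quantile_like (S \o q).
Proof.
move=> cS Snd [qnd qlc]; split=> [u v u0 uv v1 /=|v e v01 e0 /=].
  by apply: Snd; exact: qnd.
have /cvgrPdist_lt/(_ _ e0) := cS (q v).
move=> /nbhs_ballP[d/= d0 Hd].
have [u uv H] := qlc v (d / 2) v01 (divr_gt0 d0 (ltr0n _ 2)).
exists u => //; case/andP: (uv) => u0 uv'; case/andP: v01 => _ v1.
have quv : q u <= q v by apply: qnd => //; exact: ltW.
have /Hd /= : ball (q v) d (q u).
  rewrite /ball/= ger0_norm ?subr_ge0//.
  by rewrite (@le_lt_trans _ _ (d / 2))// ?ltr_pdivrMr ?ltr_pMr ?ltr1n// lerBlDr -lerBlDl.
by rewrite ger0_norm ?subr_ge0 ?Snd// => /ltW; rewrite lerBlDr -lerBlDl.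
Qed.

(** The set where [q <= x] is an initial segment of the unit interval, and the distribution function
    at [x] is its length. Left continuity closes the segment on the right, as the Galois connection
    requires. *)
Lemma quantile_law (q : R -> R)
    (mq : measurable_fun setT (q : measurableTypeR R -> measurableTypeR R)) :
  quantile_like q -> forall u, 0 < u < 1 -> quantile (lawR unif mq) u = q u.
Proof.
move=> [qnd qlc'] v v01.
have qlc y z : 0 < y < 1 -> (forall u, 0 < u < y -> q u <= z) -> q y <= z.
  move=> y01 H; apply/ler_addgt0Pr => e e0.
  by have [u /H uz uy] := qlc' y e y01 e0; rewrite -lerBlDr (le_trans uy).
 apply: quantile_uniq => // x.
have mqx : measurable (q @^-1` `]-oo, x]%classic : set (measurableTypeR R)).
  by rewrite -[X in measurable X]setTI; exact: mq.
have cE : (cdfr (lawR unif mq) x)%:E = unif [set u | 0 < u < 1 /\ q u <= x].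
  rewrite cdfrE; transitivity (unif (q @^-1` `]-oo, x]%classic)); first by [].
  apply: measure_ae_eq.
  - exact: mqx.
  - rewrite (_ : [set _ | _] = `]0, 1[%classic `&` q @^-1` `]-oo, x]%classic).
      exact: measurableI.
    by apply/seteqP; split => u /=; rewrite !in_itv.
  - by apply: unif_ae => u u01 /=; rewrite in_itv/=; split => // -[].
have mS : measurable [set u : measurableTypeR R | 0 < u < 1 /\ q u <= x].
  rewrite (_ : [set _ | _] = `]0, 1[%classic `&` q @^-1` `]-oo, x]%classic).
    exact: measurableI.
  by apply/seteqP; split => u /=; rewrite !in_itv.
have mv w : measurable [set u : measurableTypeR R | 0 < u < 1 /\ u <= w].
  rewrite (_ : [set _ | _] = `]0, 1[%classic `&` `]-oo, w]%classic).
    exact: measurableI.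
  by apply/seteqP; split => u /=; rewrite !in_itv.
case/andP: (v01) => v0 v1; apply/idP/idP => H.
  rewrite -lee_fin cE -(@unif_le _ v) ?(ltW v0) ?(ltW v1)//.
  apply: le_measure; rewrite ?inE// => u /= [u01 uv]; split => //.
  by apply: le_trans H; apply: qnd => //; case/andP: u01.
apply: (qlc _ _ v01) => u /andP[u0 uv]; rewrite leNgt; apply/negP => xq.
suff : cdfr (lawR unif mq) x <= u by rewrite leNgt (lt_le_trans uv).
rewrite -lee_fin cE -(@unif_le _ u) ?(ltW u0) ?(ltW (lt_trans uv v1))//.
apply: le_measure; rewrite ?inE// => w /= [w01 wx]; split => //.
rewrite leNgt; apply/negP => uw.
have : q u <= x by apply: le_trans wx; apply: qnd (ltW uw) _; [|case/andP: w01].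
by rewrite leNgt xq.
Qed.

End wasserstein_quantile.

(** * Second moments in terms of quantiles *)

Section second_moments.
Context {R : realType}.
Implicit Types m n : prob R.

Lemma ge0_integral_unif_eq (f g : R -> \bar R) :
  measurable_fun [set: measurableTypeR R] f -> measurable_fun [set: measurableTypeR R] g ->
  (forall u, 0 < u < 1 -> f u = g u) ->
  (\int[unif]_u f u = \int[unif]_u g u)%E.
Proof.
move=> mf mg fg; apply: ae_eq_integral => //.
by apply: unif_ae => u u01 _; exact: fg.
Qed.

Lemma ge0_integral_unif_le (f g : R -> \bar R) :
  measurable_fun [set: measurableTypeR R] f -> measurable_fun [set: measurableTypeR R] g ->
  (forall u, 0 <= f u)%E -> (forall u, 0 <= g u)%E ->
  (forall u, 0 < u < 1 -> (f u <= g u)%E) ->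
  (\int[unif]_u f u <= \int[unif]_u g u)%E.
Proof.
move=> mf mg f0 g0 fg; apply: ae_ge0_le_integral => //.
by apply: unif_ae => u u01 _; exact: fg.
Qed.

Lemma unif_integral_cst (c : R) : (\int[unif]_u c%:E = c%:E :> \bar R)%E.
Proof. by rewrite (integral_cst unif measurableT) [X in (_ * X)%E]probability_setT mule1. Qed.

Definition qmoment2 m : \bar R := (\int[unif]_u ((quantile m u) ^+ 2)%:E)%E.

Lemma measurable_quantile_sqr m :
  measurable_fun setT (fun u : measurableTypeR R => ((quantile m u) ^+ 2)%:E).
Proof. by apply/measurable_EFinP; apply: measurable_funX; exact: measurable_quantile. Qed.

Lemma P2_qmoment2 m : P2 m <-> (qmoment2 m < +oo)%E.
Proof.
rewrite /P2/= (ge0_integral_quantile m (g := fun x => (x ^+ 2)%:E))//.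
- by apply/measurable_EFinP; exact: measurable_funX.
- by move=> x; rewrite lee_fin sqr_ge0.
Qed.

Lemma qdist_lty m n : P2 m -> P2 n -> (qdist m n < +oo)%E.
Proof.
move=> /P2_qmoment2 m2 /P2_qmoment2 n2.
have mm := measurable_quantile_sqr m; have mn := measurable_quantile_sqr n.
apply: (@le_lt_trans _ _ (2%:E * (qmoment2 m + qmoment2 n))%E); last first.
  by rewrite lte_mul_pinfty// lte_add_pinfty.
have s0 (p : prob R) (u : R) : (0 <= ((quantile p u) ^+ 2)%:E)%E.
  by rewrite lee_fin sqr_ge0.
rewrite -ge0_integralD//.
rewrite -ge0_integralZl//; last 2 first.
- exact: emeasurable_funD.
- by move=> u _; exact: adde_ge0.
apply: ge0_le_integral => //.
- by move=> u _; rewrite lee_fin sqr_ge0.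
- by apply: measurable_sqrB; exact: measurable_quantile.
- by apply: measurable_funeM; exact: emeasurable_funD.
- move=> u _; rewrite -EFinD -EFinM lee_fin -subr_ge0.
  rewrite (_ : _ - _ = (quantile m u + quantile n u) ^+ 2) ?sqr_ge0//.
  by ring.
Qed.

Lemma qdist_fin m n : P2 m -> P2 n -> qdist m n \is a fin_num.
Proof. by move=> m2 n2; rewrite ge0_fin_numE ?qdist_ge0 ?qdist_lty. Qed.

End second_moments.

(** * Weighted averages and the barycenter *)

Section weighted_averages.
Context {R : realType} {K : nat}.
Variable w : 'I_K -> R.
Hypothesis w_gt0 : forall k, 0 < w k.
Hypothesis w_sum1 : \sum_(k < K) w k = 1.

(** Bias-variance decomposition: the cross term vanishes because the weights sum to 1 and [b] is the
    weighted mean. *)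
Lemma weighted_variance (a : 'I_K -> R) (x : R) :
  let b := \sum_(k < K) w k * a k in
  \sum_(k < K) w k * (x - a k) ^+ 2 = (x - b) ^+ 2 + \sum_(k < K) w k * (b - a k) ^+ 2.
Proof.
move=> b; rewrite (eq_bigr (fun k => w k * ((x - b) ^+ 2 + 2 * (x - b) * b)
  + (- (2 * (x - b))) * (w k * a k) + w k * (b - a k) ^+ 2)); last by move=> k _; ring.
rewrite !big_split/= -mulr_suml w_sum1 -mulr_sumr -/b.
by ring.
Qed.

Lemma sqr_weighted_le (a : 'I_K -> R) :
  (\sum_(k < K) w k * a k) ^+ 2 <= \sum_(k < K) w k * a k ^+ 2.
Proof.
have /= := weighted_variance a 0; rewrite sub0r sqrrN.
under eq_bigr do rewrite sub0r sqrrN.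
by move=> ->; rewrite lerDl sumr_ge0// => k _; rewrite mulr_ge0 ?sqr_ge0// ltW.
Qed.

End weighted_averages.

Section barycenter_of_quantiles.
Context {R : realType} {K : nat}.
Variables (w : 'I_K -> R) (nu : 'I_K -> prob R).
Hypothesis w_gt0 : forall k, 0 < w k.
Hypothesis w_sum1 : \sum_(k < K) w k = 1.
Hypothesis nu_P2 : forall k, P2 (nu k).

Definition mean_quantile (u : R) : R := \sum_(k < K) w k * quantile (nu k) u.

Lemma measurable_mean_quantile :
  measurable_fun setT (mean_quantile : measurableTypeR R -> measurableTypeR R).
Proof.
apply: (@measurable_sum _ (measurableTypeR R) R setT _ _ (fun k u => w k * quantile (nu k) u)).
by move=> k; apply: measurable_funM => //; exact: measurable_quantile.
Qed.

Definition bary : prob R := lawR unif measurable_mean_quantile.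

Lemma quantile_bary u : 0 < u < 1 -> quantile bary u = mean_quantile u.
Proof.
apply: quantile_law; apply: quantile_like_sum; last by move=> k; exact: quantile_likeP.
by move=> k; exact: ltW.
Qed.

Lemma VbarE (m : prob R) :
  Vbar w nu m = (\int[unif]_u (\sum_(k < K) w k * (quantile m u - quantile (nu k) u) ^+ 2)%:E)%E.
Proof.
rewrite /Vbar.
transitivity (\sum_(k < K) \int[unif]_u (w k * (quantile m u - quantile (nu k) u) ^+ 2)%:E)%E.
  apply: eq_bigr => k _; rewrite W2_sqr /qdist -ge0_integralZl//.
  - by apply: measurable_sqrB; exact: measurable_quantile.
  - by move=> u _; rewrite lee_fin sqr_ge0.
  - by rewrite lee_fin ltW.
rewrite -ge0_integral_sum//; last 2 first.
- move=> k; apply/measurable_EFinP; apply: measurable_funM => //.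
  by apply: measurable_funX; apply: measurable_funB; exact: measurable_quantile.
- by move=> k u _; rewrite lee_fin mulr_ge0 ?sqr_ge0// ltW.
by apply: eq_integral => u _; rewrite sumEFin.
Qed.

Lemma measurable_spread (q : R -> R) :
  measurable_fun setT (q : measurableTypeR R -> measurableTypeR R) ->
  measurable_fun setT (fun u : measurableTypeR R =>
    (\sum_(k < K) w k * (q u - quantile (nu k) u) ^+ 2)%:E).
Proof.
move=> mq; apply/measurable_EFinP.
apply: (@measurable_sum _ (measurableTypeR R) R setT _ _
  (fun k u => w k * (q u - quantile (nu k) u) ^+ 2)) => k.
apply: measurable_funM => //; apply: measurable_funX; apply: measurable_funB => //.
exact: measurable_quantile.
Qed.

(* The quantile map embeds measures isometrically in a Hilbert space, where
   [V] is a sum of squared distances to fixed points. *)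
Lemma Vbar_bary (m : prob R) : Vbar w nu m = (qdist m bary + Vbar w nu bary)%E.
Proof.
have mm := measurable_spread (measurable_quantile m).
have mb := measurable_spread (measurable_quantile bary).
rewrite !VbarE /qdist -ge0_integralD//; last 3 first.
- by move=> u _; rewrite lee_fin sqr_ge0.
- by apply: measurable_sqrB; exact: measurable_quantile.
- by move=> u _; rewrite lee_fin sumr_ge0// => k _; rewrite mulr_ge0 ?sqr_ge0// ltW.
apply: ge0_integral_unif_eq => //.
  apply: emeasurable_funD => //.
  by apply: measurable_sqrB; exact: measurable_quantile.
by move=> u u01; rewrite -EFinD quantile_bary//; congr EFin; exact: weighted_variance.
Qed.

Lemma P2_bary : P2 bary.
Proof.
apply/P2_qmoment2.
apply: (@le_lt_trans _ _ (\sum_(k < K) (w k)%:E * qmoment2 (nu k))%E); last first.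
  apply: lte_sum_pinfty => k _; rewrite lte_mul_pinfty ?lee_fin ?(ltW (w_gt0 _))//.
  exact/P2_qmoment2.
have s0 (p : prob R) (u : R) : (0 <= ((quantile p u) ^+ 2)%:E)%E.
  by rewrite lee_fin sqr_ge0.
have mk k : measurable_fun setT (fun u : measurableTypeR R =>
    ((w k)%:E * ((quantile (nu k) u) ^+ 2)%:E)%E).
  by apply: measurable_funeM; exact: measurable_quantile_sqr.
under eq_bigr => k _.
  rewrite /qmoment2 -ge0_integralZl//; last 2 first.
  - exact: measurable_quantile_sqr.
  - by rewrite lee_fin ltW.
  over.
rewrite -ge0_integral_sum//; last by move=> k u _; rewrite mule_ge0// lee_fin ltW.
apply: ge0_integral_unif_le => //.
- exact: measurable_quantile_sqr.
- exact: emeasurable_sum.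
- by move=> u; apply: sume_ge0 => k _; rewrite mule_ge0// lee_fin ltW.
move=> u u01; rewrite quantile_bary// sumEFin lee_fin.
exact: sqr_weighted_le.
Qed.

Lemma Vbar_bary_fin : Vbar w nu bary \is a fin_num.
Proof.
rewrite /Vbar ge0_fin_numE.
  apply: lte_sum_pinfty => k _; rewrite W2_sqr lte_mul_pinfty ?lee_fin ?(ltW (w_gt0 _))//.
  by apply: qdist_lty => //; exact: P2_bary.
by apply: sume_ge0 => k _; rewrite W2_sqr mule_ge0 ?qdist_ge0// lee_fin ltW.
Qed.

Lemma bary_is_barycenter : is_barycenter w nu bary.
Proof.
by split; [exact: P2_bary|move=> m _; rewrite (Vbar_bary m) leeDr// qdist_ge0].
Qed.

Lemma barycenter_uniq (m : prob R) : is_barycenter w nu m -> meas_eq m bary.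
Proof.
move=> [_ /(_ _ P2_bary)]; rewrite (Vbar_bary m) => H; apply: qdist_eq0.
apply/eqP; rewrite eq_le qdist_ge0 andbT.
by rewrite -(leeD2rE _ _ Vbar_bary_fin) add0e.
Qed.

End barycenter_of_quantiles.

(** * Optimal maps from an atomless measure: existence and uniqueness *)

Section optimal_maps.
Context {R : realType}.
Implicit Types m n : prob R.

Definition atomless m := forall x, m [set x] = 0%E.

Lemma quantile_prob m (A : set (measurableTypeR R)) : measurable A ->
  m A = unif (quantile m @^-1` A).
Proof. by move=> mA; rewrite -(law_quantile m mA). Qed.

(** If the distribution function jumped past [u] at [y], the quantile would equal [y] on an interval
    of positive length, and [y] would be an atom. *)
Lemma cdfr_quantile m u : atomless m -> 0 < u < 1 -> cdfr m (quantile m u) = u.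
Proof.
move=> m0 u01; have uc : u <= cdfr m (quantile m u) by rewrite -quantile_le.
apply/eqP; rewrite eq_le uc andbT leNgt; apply/negP => cu.
set y := quantile m u in uc cu.
have : (unif `]u, cdfr m y[%classic <= 0)%E.
  rewrite -(m0 y) (quantile_prob m)//; apply: le_measure; rewrite ?inE//.
    by rewrite -[X in measurable X]setTI; exact: measurable_quantile.
  move=> v /=; rewrite in_itv/= => /andP[uv vc].
  have v01 : 0 < v < 1.
    by rewrite (lt_trans _ uv)/= ?(lt_le_trans vc (cdfr_le1 _ _))//; case/andP: u01.
  apply/eqP; rewrite eq_le quantile_le// (ltW vc)/= /y; apply: quantile_nd.
  - by case/andP: u01.
  - exact: ltW.
  - by case/andP: v01.
rewrite unif_itv; last first.
  move=> v /=; rewrite !in_itv/= => /andP[uv vc]; apply/andP; split.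
    by apply: ltW; apply: lt_trans uv; case/andP: u01.
  exact: ltW (lt_le_trans vc (cdfr_le1 _ _)).
by rewrite lebesgue_measure_itv/= lte_fin cu -EFinB lee_fin leNgt subr_gt0 cu.
Qed.

Lemma unif_mono (A B : set (measurableTypeR R)) : measurable A -> measurable B ->
  (forall u, 0 < u < 1 -> A u -> B u) -> (unif A <= unif B)%E.
Proof.
move=> mA mB AB; rewrite (@measure_ae_eq _ _ _ unif A (A `&` `]0, 1[))//.
- apply: le_measure; rewrite ?inE//; first exact: measurableI.
  by move=> u [Au]; rewrite /= in_itv/= => u01; exact: AB.
- exact: measurableI.
- by apply: unif_ae => u u01; split => [Au|[]//]; split => //=; rewrite in_itv.
Qed.

Lemma unif_gt0_ex (A : set (measurableTypeR R)) : measurable A -> (0 < unif A)%E ->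
  exists2 u, 0 < u < 1 & A u.
Proof.
move=> mA A0; apply: contrapT => H.
have : (unif A <= unif set0)%E.
  by apply: unif_mono => // u u01 Au; apply: H; exists u.
by rewrite measure0 leNgt A0.
Qed.

Lemma measure_bigcup_null d (T : measurableType d) (mu : {measure set T -> \bar R})
    (F : (set T)^nat) : (forall i, measurable (F i)) -> (forall i, mu (F i) = 0%E) ->
  mu (\bigcup_i F i) = 0%E.
Proof.
move=> mF F0; apply: measure_negligible; first exact: bigcup_measurable.
by apply: negligible_bigcup => i; exists (F i); split => //; exact: F0.
Qed.

Definition monotone_ot m n (x : R) : R := quantile n (cdfr m x).

Lemma measurable_monotone_ot m n :
  measurable_fun setT (monotone_ot m n : measurableTypeR R -> measurableTypeR R).
Proof. exact: measurableT_comp (measurable_quantile n) (cdfr_measurable m). Qed.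

Lemma monotone_ot_quantile m n u : atomless m -> 0 < u < 1 ->
  monotone_ot m n (quantile m u) = quantile n u.
Proof. by move=> m0 u01; rewrite /monotone_ot cdfr_quantile. Qed.

Lemma monotone_ot_is_ot m n : atomless m -> is_ot_map m n (monotone_ot m n).
Proof.
move=> m0; split; first exact: measurable_monotone_ot.
- move=> A mA; rewrite /pushforward (quantile_prob n)// (quantile_prob m); last first.
    by rewrite -[X in measurable X]setTI; exact: measurable_monotone_ot.
  apply: measure_ae_eq.
  + rewrite -[X in measurable X]setTI.
    exact: (measurableT_comp (measurable_monotone_ot m n) (measurable_quantile m)).
  + by rewrite -[X in measurable X]setTI; exact: measurable_quantile.
  + by apply: unif_ae => u u01 /=; rewrite monotone_ot_quantile.
- have mf := measurable_sqrB (@measurable_id _ (measurableTypeR R) setT)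
    (measurable_monotone_ot m n).
  under eq_integral do rewrite real_normK ?num_real//.
  rewrite (ge0_integral_quantile m mf); last by move=> x; rewrite lee_fin sqr_ge0.
  rewrite W2_sqr; apply: ge0_integral_unif_eq.
  + exact: (measurableT_comp mf (measurable_quantile m)).
  + by apply: measurable_sqrB; exact: measurable_quantile.
  + by move=> u u01; rewrite monotone_ot_quantile.
Qed.

(* A positive measure of disagreement with the monotone rearrangement leaves
   room for a whole rectangle of exchanges, each of which lowers the cost. *)
Lemma rearrangement_gap m n (Y : R -> R) (s0 t0 t1 : R) :
  measurable_fun setT (Y : measurableTypeR R -> measurableTypeR R) ->
  (forall s, unif [set u | Y u <= s] = unif [set u | quantile n u <= s]) ->
  t0 < t1 ->
  (0 < unif [set u | (quantile m u <= s0)%R && (t1 < Y u)%R])%E ->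
  (0 < unif [set u | (Y u <= t0)%R && (s0 < quantile m u)%R])%E ->
  (qdist m n < +oo)%E ->
  (qdist m n < \int[unif]_u ((quantile m u - Y u) ^+ 2)%:E)%E.
Proof.
move=> mY YE t01 ca cb fin.
have mQ := measurable_quantile m; have mN := measurable_quantile n.
set X := quantile m in mQ ca cb *.
have mYX t s : measurable [set u : measurableTypeR R | (Y u <= t) && (s < X u)].
  apply: measurable_set_bool; apply: measurable_and; first exact: measurable_fun_ler.
  exact: measurable_fun_ltr.
have mXY s t : measurable [set u : measurableTypeR R | (X u <= s) && (t < Y u)].
  apply: measurable_set_bool; apply: measurable_and; first exact: measurable_fun_ler.
  exact: measurable_fun_ltr.
(* The event [s0 < X] is the union of the events [s0 + 1/(i+1) < X], so one of these keeps positive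
   mass. This gives the rectangle its width in the direction of [s]. *)
have [s1 s01 cb1] : exists2 s1, s0 < s1 &
    (0 < unif [set u | (Y u <= t0)%R && (s1 < X u)%R])%E.
  apply: contrapT => H.
  have : unif (\bigcup_i [set u | (Y u <= t0) && (s0 + i.+1%:R^-1 < X u)]) = 0%E.
    apply: measure_bigcup_null => // i.
    apply/eqP; rewrite eq_le measure_ge0 andbT leNgt; apply/negP => Hi.
    by apply: H; exists (s0 + i.+1%:R^-1) => //; rewrite ltrDl.
  move=> H0; move: cb; rewrite (_ : [set _ | _] =
    \bigcup_i [set u | (Y u <= t0) && (s0 + i.+1%:R^-1 < X u)]) ?H0 ?ltxx//.
  apply/seteqP; split => u /=.
    move=> /andP[Yu]; rewrite -subr_gt0 => /ltr_add_invr[i].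
    by rewrite add0r ltrBrDl => Hi; exists i => //=; rewrite Yu.
  by move=> [i _ /= /andP[-> /(lt_trans _)->]]//; rewrite ltrDl.
have [c c0 [ca' cb']] : exists2 c : R, 0 < c &
    (c%:E <= unif [set u | (X u <= s0)%R && (t1 < Y u)%R])%E /\
    (c%:E <= unif [set u | (Y u <= t0)%R && (s1 < X u)%R])%E.
  exists (Num.min (fine (unif [set u | (X u <= s0)%R && (t1 < Y u)%R]))
                  (fine (unif [set u | (Y u <= t0)%R && (s1 < X u)%R]))).
    by rewrite lt_min -!lte_fin !fineK ?fin_num_measure// ca.
  by split; rewrite -[leRHS]fineK ?fin_num_measure// lee_fin ge_min lexx ?orbT.
have Hc s t : s0 < s <= s1 -> t0 < t <= t1 ->
    (c%:E <= unif [set u | (X u <= s)%R && (t < Y u)%R])%E /\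
    (c%:E <= unif [set u | (Y u <= t)%R && (s < X u)%R])%E.
  move=> /andP[s0s ss1] /andP[t0t tt1]; split.
    apply: (le_trans ca'); apply: le_measure; rewrite ?inE// => u /= /andP[Xu Yu].
    by rewrite (le_trans Xu (ltW s0s)) (le_lt_trans tt1 Yu).
  apply: (le_trans cb'); apply: le_measure; rewrite ?inE// => u /= /andP[Yu Xu].
  by rewrite (le_trans Yu (ltW t0t)) (le_lt_trans ss1 Xu).
have XE s : unif [set u | X u <= s] = unif [set u | X u <= s] by [].
have YE' s : unif [set u | quantile n u <= s] = unif [set u | Y u <= s] by rewrite YE.
have co s t := quantile_comonotone m n s t.
have co' s t : unif [set u | (quantile n u <= s) && (t < X u)] = 0%E \/
    unif [set u | (X u <= t) && (s < quantile n u)] = 0%E.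
  by case: (co t s); [right|left].
have le1 := comonotone_half_cost_le mQ mN mQ mY XE YE' co.
have le2 := comonotone_half_cost_le mN mQ mY mQ YE' XE co'.
set i1 := (\int[unif]_o (Num.max 0 (quantile n o - X o) ^+ 2 / 2)%:E)%E in le1.
set j1 := (\int[unif]_o (Num.max 0 (Y o - X o) ^+ 2 / 2)%:E)%E in le1.
set i2 := (\int[unif]_o (Num.max 0 (X o - quantile n o) ^+ 2 / 2)%:E)%E in le2.
set j2 := (\int[unif]_o (Num.max 0 (X o - Y o) ^+ 2 / 2)%:E)%E in le2.
have h0 (x : R) : (0 <= (Num.max 0 x ^+ 2 / 2)%:E)%E.
  by rewrite lee_fin mulr_ge0// sqr_ge0.
have i10 : (0 <= i1)%E by apply: integral_ge0.
have i20 : (0 <= i2)%E by apply: integral_ge0.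
have [A A0 HA] : exists2 A : R, 0 < A & (i1 + i2 + A%:E <= j1 + j2)%E.
  (* If [t1 <= s0], the rectangle lies on the side of the diagonal seen by downward moves, and the
     gain appears in the other half of the cost. *)
  have [ts|st] := leP t1 s0.
    exists (c * (t1 - t0) * (s1 - s0)); first by rewrite !mulr_gt0 ?subr_gt0.
    rewrite -addeA; apply: leeD => //.
    apply: (comonotone_half_cost_gap mN mQ mY mQ YE' XE co') => //; rewrite ?ltW//.
    by move=> t s ht hs; have [] := Hc s t hs ht.
  (* Otherwise part of the rectangle lies above the diagonal; [q] separates the levels kept for [s]
     from those kept for [t]. *)
  pose p := Num.max s0 t0; pose q := (p + t1) / 2.
  have pt : p < t1 by rewrite gt_max st.
  have pq : p < q by rewrite midf_lt.
  have qt : q < t1 by rewrite midf_lt.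
  have sp : s0 <= p by rewrite le_max lexx.
  have tp : t0 <= p by rewrite le_max lexx orbT.
  have sq : s0 < Num.min s1 q by rewrite lt_min s01 (le_lt_trans sp pq).
  exists (c * (Num.min s1 q - s0) * (t1 - q)); first by rewrite !mulr_gt0 ?subr_gt0.
  rewrite addeAC; apply: leeD => //.
  apply: (comonotone_half_cost_gap mQ mN mQ mY XE YE' co) => //; rewrite ?(ltW sq) ?(ltW qt) ?(ltW c0)//.
    by rewrite ge_min lexx orbT.
  move=> s t /andP[s0s]; rewrite le_min => /andP[ss1 _] /andP[qt' tt1]; apply: Hc.
    by rewrite s0s.
  by rewrite tt1 (le_lt_trans tp)// (lt_trans pq).
rewrite /qdist !cost_half_costs// -/i1 -/i2 -/j1 -/j2.
have ifin : (i1 + i2)%E \is a fin_num.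
  have i12 := adde_ge0 i10 i20; rewrite ge0_fin_numE; last exact: i12.
  move: fin; rewrite /qdist cost_half_costs// -/i1 -/i2.
  by move=> /(le_lt_trans _); apply; apply: lee_pemull => //; rewrite lee_fin ler1n.
rewrite lte_pmul2l//; apply: lt_le_trans HA.
by rewrite lteDl// lte_fin.
Qed.

(** Along the quantile of [m], an optimal [T] becomes a variable [Y] with law [n] and minimal cost.
    By [rearrangement_gap], mass crossing in both directions would push the cost strictly above the
    minimum, so [Y] must agree with the quantile of [n]. *)
Lemma ot_map_uniq m n (T : R -> R) : atomless m -> P2 m -> P2 n ->
  is_ot_map m n T -> {ae unif, forall u, T (quantile m u) = quantile n u}.
Proof.
move=> m0 m2 n2 [mT Tn Tc].
have mQ := measurable_quantile m; have mN := measurable_quantile n.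
pose Y := T \o quantile m.
have mY : measurable_fun setT (Y : measurableTypeR R -> measurableTypeR R).
  exact: measurableT_comp mT mQ.
have YE s : unif [set u | Y u <= s] = unif [set u | quantile n u <= s].
  transitivity (n `]-oo, s]%classic).
    rewrite -Tn// /pushforward (quantile_prob m); last first.
      by rewrite -[X in measurable X]setTI; exact: mT.
    by [].
  by rewrite (quantile_prob n).
have costY : (\int[unif]_u ((quantile m u - Y u) ^+ 2)%:E = qdist m n)%E.
  rewrite -W2_sqr -Tc (ge0_integral_quantile m).
  - by apply: eq_integral => u _; rewrite real_normK// num_real.
  - apply/measurable_EFinP; apply: measurable_funX; apply: measurableT_comp => //.
    exact: measurable_funB.
  - by move=> x; rewrite lee_fin exprn_ge0.
have fin := qdist_lty m2 n2.
have mA s t : measurable [set u : measurableTypeR R | (quantile n u <= s) && (t < Y u)].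
  apply: measurable_set_bool; apply: measurable_and; first exact: measurable_fun_ler.
  exact: measurable_fun_ltr.
have mB s t : measurable [set u : measurableTypeR R | (Y u <= s) && (t < quantile n u)].
  apply: measurable_set_bool; apply: measurable_and; first exact: measurable_fun_ler.
  exact: measurable_fun_ltr.
have mYs s : measurable [set u : measurableTypeR R | Y u <= s].
  by apply: measurable_set_bool; exact: measurable_fun_ler.
have mNs s : measurable [set u : measurableTypeR R | quantile n u <= s].
  by apply: measurable_set_bool; exact: measurable_fun_ler.
(* Both variables have the same law, so as much mass crosses the level [t] in one direction as in
   the other. *)
have swap t : unif [set u | (quantile n u <= t)%R && (t < Y u)%R] =
    unif [set u | (Y u <= t)%R && (t < quantile n u)%R].
  have e : (unif [set u | (quantile n u <= t)%R && (t < Y u)%R] + unif [set u | (Y u <= t)%R] =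
      unif [set u | (Y u <= t)%R && (t < quantile n u)%R] + unif [set u | (quantile n u <= t)%R])%E.
    rewrite -!measureU//.
    - congr (unif _); apply/seteqP; split => u /=; rewrite !ltNge;
        by case: (quantile n u <= t); case: (Y u <= t) => //=; tauto.
    - by apply/seteqP; split => // u [/= /andP[_]] + H; rewrite ltNge H.
    - by apply/seteqP; split => // u [/= /andP[_]] + H; rewrite ltNge H.
  rewrite -[LHS](@addeK R (unif [set u | (Y u <= t)%R])) ?fin_num_measure//.
  by rewrite e YE addeK// fin_num_measure.
(* The two sets lie on either side of [v = cdfr n t]. Since [m] has no atoms, [quantile m v]
   separates them in the way [rearrangement_gap] asks for. *)
have key t0 t1 t : t0 < t1 -> t0 <= t <= t1 ->
    (0 < unif [set u | (quantile n u <= t)%R && (t1 < Y u)%R])%E ->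
    (0 < unif [set u | (Y u <= t0)%R && (t < quantile n u)%R])%E -> False.
  move=> t01 /andP[t0t tt1] c1 c2.
  have [u1 u101 /= /andP[Qu1 _]] := unif_gt0_ex (mA t t1) c1.
  have [u2 u201 /= /andP[_ Qu2]] := unif_gt0_ex (mB t0 t) c2.
  have v01 : 0 < cdfr n t < 1.
    move: Qu1 Qu2; rewrite quantile_le// quantile_gt//.
    by case/andP: u101 => /lt_le_trans u10 _ /u10 ->; case/andP: u201 => _ /(lt_trans _) H /H.
  set v := cdfr n t in v01; case/andP: (v01) => v0 v1.
  have := @rearrangement_gap m n Y (quantile m v) t0 t1 mY YE t01.
  rewrite costY ltxx => /(_ _ _ fin) H; suff : false by []; apply: H.
    apply: lt_le_trans c1 _; apply: unif_mono.
    + exact: mA.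
    + apply: measurable_set_bool; apply: measurable_and; first exact: measurable_fun_ler.
      exact: measurable_fun_ltr.
    move=> u u01 /= /andP[Qu ->]; rewrite andbT.
    move: Qu; rewrite quantile_le// -/v => uv.
    by apply: quantile_nd => //; case/andP: u01.
  apply: lt_le_trans c2 _; apply: unif_mono.
  + exact: mB.
  + apply: measurable_set_bool; apply: measurable_and; first exact: measurable_fun_ler.
    exact: measurable_fun_ltr.
  move=> u u01 /= /andP[-> ] /=; rewrite !quantile_gt// cdfr_quantile//.
have null1 t0 t1 : t0 < t1 ->
    unif [set u | (quantile n u <= t0)%R && (t1 < Y u)%R] = 0%E.
  move=> t01; apply/eqP; rewrite eq_le measure_ge0 andbT leNgt; apply/negP => c1.
  apply: (key t0 t1 t0) => //; first by rewrite lexx ltW.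
  rewrite -swap; apply: (lt_le_trans c1); apply: le_measure; rewrite ?inE// => u /= /andP[->].
  exact: lt_trans.
have null2 t0 t1 : t0 < t1 ->
    unif [set u | (Y u <= t0)%R && (t1 < quantile n u)%R] = 0%E.
  move=> t01; apply/eqP; rewrite eq_le measure_ge0 andbT leNgt; apply/negP => c2.
  apply: (key t0 t1 t1) => //; first by rewrite lexx ltW.
  rewrite swap; apply: (lt_le_trans c2); apply: le_measure; rewrite ?inE// => u /= /andP[+ ->].
  by move=> /le_trans ->//; exact: ltW.
(* Two rationals between distinct values of [Y u] and [quantile n u] witness the disagreement, which
   leaves countably many null sets. *)
pose D (p : rat * rat) := [set u | ((quantile n u <= ratr p.1) && (ratr p.2 < Y u)) /\ p.1 < p.2]
  `|` [set u | ((Y u <= ratr p.1) && (ratr p.2 < quantile n u)) /\ p.1 < p.2].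
have D0 p : unif.-negligible (D p).
  have [p12|p12] := ltP p.1 p.2; last first.
    rewrite (_ : D p = set0); first exact: negligible_set0.
    by apply/seteqP; split => // u [] [_]; rewrite ltNge p12.
  apply: negligibleU.
    exists [set u | (quantile n u <= ratr p.1) && (ratr p.2 < Y u)]; split => //.
      by apply: null1; rewrite ltr_rat.
    by move=> u [].
  exists [set u | (Y u <= ratr p.1) && (ratr p.2 < quantile n u)]; split => //.
    by apply: null2; rewrite ltr_rat.
  by move=> u [].
have : unif.-negligible (\bigcup_i (if unpickle i is Some p then D p else set0)).
  by apply: negligible_bigcup => i; case: unpickle => [p|]; [exact: D0|exact: negligible_set0].
apply: negligibleS => u /= /eqP; rewrite neq_lt.
have ratbetween (a b : R) : a < b -> exists p : rat * rat,
    [/\ a <= ratr p.1, ratr p.2 < b & p.1 < p.2].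
  move=> ab; have [q1 /andP[aq qb]] := rat_in_itvoo ab.
  have [q2 /andP[q12 q2b]] := rat_in_itvoo qb.
  by exists (q1, q2); split; rewrite /= ?(ltW aq)// -(ltr_rat R).
move=> /orP[|] /ratbetween[p [p1 p2 p12]]; (exists (pickle p); [exact: I|rewrite pickleK]).
  by right; split => //; rewrite p1 p2.
by left; split => //; rewrite p1 p2.
Qed.

End optimal_maps.

(** * Lipschitz distribution functions and expansive quantiles *)

Section lipschitz_cdf.
Context {R : realType}.
Implicit Types m n : prob R.
Local Notation leb := (@lebesgue_measure R).

Definition cdf_lip (L : R) m := forall x y, x <= y -> cdfr m y - cdfr m x <= L * (y - x).

Lemma cdf_lip_ge0 L m : cdf_lip L m -> 0 <= L.
Proof.
move=> /(_ 0 1 ler01); rewrite subr0 mulr1; apply: le_trans.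
by rewrite subr_ge0 cdfr_nd// ler01.
Qed.

Lemma cdf_lip_atomless L m : cdf_lip L m -> atomless m.
Proof.
move=> mL x; have L0 := cdf_lip_ge0 mL; apply/eqP; rewrite eq_le measure_ge0 andbT.
apply/lee_addgt0Pr => e e0; rewrite add0e.
have L1 : 0 < L + 1 by rewrite ltr_pwDr.
have d0 : 0 < e / (L + 1) by rewrite divr_gt0.
apply: (@le_trans _ _ (m `]x - e / (L + 1), x]%classic)).
  apply: le_measure; rewrite ?inE// => y /= ->.
  by rewrite in_itv/= lexx andbT ltrBlDr ltrDl.
have xd : x - e / (L + 1) <= x by rewrite lerBlDr lerDl ltW.
rewrite prob_itvoc// lee_fin (le_trans (mL _ _ xd))//.
rewrite opprB addrCA subrr addr0 mulrA ler_pdivrMr// mulrC ler_wpM2l ?(ltW e0)//.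
by rewrite lerDl.
Qed.

(** A Lebesgue-null set is covered by open intervals of small total length, and each has mass at
    most [L] times its length. *)
Lemma cdf_lip_ac L m : cdf_lip L m -> m `<< leb.
Proof.
move=> mL; have L0 := cdf_lip_ge0 mL.
apply/null_content_dominatesP => A mA A0; apply/eqP; rewrite eq_le measure_ge0 andbT.
have : leb.-negligible A by exists A; split.
move=> /negligible_outer_measure lA0; apply/lee_addgt0Pr => e e0; rewrite add0e.
have L1 : 0 < L + 1 by rewrite ltr_pwDr.
have d0 : 0 < e / (L + 1) by rewrite divr_gt0.
have : ((wlength (@idfun R))^* A)%mu \is a fin_num by rewrite lA0.
rewrite outer_measure_open_itv_cover => /lb_ereal_inf_adherent-/(_ _ d0)[_/= [F AF <-]].
rewrite -outer_measure_open_itv_cover lA0 add0e => Fe.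
case: AF => itvF AF.
have mF i : measurable (F i : set (measurableTypeR R)) by have [ab ->] := itvF i.
apply: (@le_trans _ _ (\sum_(k <oo) m (F k))%E).
  exact: (measure_sigma_subadditive m mF mA AF).
apply: (@le_trans _ _ (\sum_(k <oo) L%:E * wlength (@idfun R) (F k))%E).
  apply: lee_nneseries => // k _; have [[a b] /= ->] := itvF k.
  rewrite wlength_itv/= lte_fin; case: ltP => ab; last first.
    by rewrite set_itv_ge ?measure0 ?mule0// bnd_simp -leNgt.
  apply: (@le_trans _ _ (m `]a, b]%classic)).
    by apply: le_measure; rewrite ?inE//; exact: subset_itv_oo_oc.
  by rewrite (prob_itvoc _ (ltW ab)) -EFinB -EFinM lee_fin mL// ltW.
rewrite nneseriesZl//.
apply: (@le_trans _ _ (L%:E * (e / (L + 1))%:E)%E).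
  by rewrite lee_wpmul2l// ltW.
rewrite -EFinM lee_fin mulrA ler_pdivrMr// mulrC ler_wpM2l ?(ltW e0)//.
by rewrite lerDl.
Qed.

Lemma ac_atomless m : m `<< leb -> atomless m.
Proof.
by move=> /null_content_dominatesP H x; apply: H => //; exact: lebesgue_measure_set1.
Qed.

(** The Lipschitz bound on the distribution function seen from the quantile, with inverse constant.
    Unlike [cdf_lip], this form visibly survives averaging of quantiles and composition with an
    expanding map. *)
Definition expansive (c : R) m :=
  forall u v, 0 < u -> u <= v -> v < 1 -> c * (v - u) <= quantile m v - quantile m u.

Lemma cdf_lip_expansive L m : 0 < L -> cdf_lip L m -> expansive L^-1 m.
Proof.
move=> L0 mL u v u0 uv v1; have m0 := cdf_lip_atomless mL.
rewrite ler_pdivrMl//.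
have -> : v - u = cdfr m (quantile m v) - cdfr m (quantile m u).
  by rewrite !cdfr_quantile// ?u0 ?v1 ?andbT ?(lt_le_trans u0)//= (le_lt_trans uv).
by apply: mL; exact: quantile_nd.
Qed.

Lemma expansive_cdf_lip c m : 0 < c -> expansive c m -> cdf_lip c^-1 m.
Proof.
move=> c0 mc x y xy; rewrite ler_pdivlMl//.
set u := cdfr m x; set v := cdfr m y.
(* The levels are moved inwards by [d], as the quantile is controlled only strictly inside the unit
   interval; [d] makes the total loss [2 * c * d] equal to [e]. *)
apply/ler_addgt0Pr => e e0; pose d := e / (c * 2).
have d0 : 0 < d by rewrite divr_gt0// mulr_gt0.
have [uv|vu] := leP (u + d) (v - d); last first.
  rewrite (@le_trans _ _ e)//; last by rewrite lerDr subr_ge0.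
  rewrite mulrC -ler_pdivlMr// (_ : e / c = d + d); last first.
    by rewrite /d; field; rewrite gt_eqF.
  by rewrite lerBlDl addrA -lerBlDr ltW.
have u0 : 0 <= u := cdfr_ge0 m x.
have v1 : v <= 1 := cdfr_le1 m y.
have u01 : 0 < u + d < 1.
  by rewrite ltr_wpDl//= (le_lt_trans uv)// ltrBlDr ltr_pwDr.
have v01 : 0 < v - d < 1.
  by rewrite (lt_le_trans _ uv) ?ltr_wpDl//= ltrBlDr ltr_pwDr.
have Qv : quantile m (v - d) <= y by rewrite quantile_le// lerBlDr lerDl ltW.
have Qu : x < quantile m (u + d) by rewrite quantile_gt// ltrDl.
case/andP: u01 => ud0 _; case/andP: v01 => _ vd1.
have := mc _ _ ud0 uv vd1.
rewrite (_ : c * _ = c * (v - u) - e); last by rewrite /d; field; rewrite gt_eqF.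
rewrite lerBlDr => /le_trans; apply; rewrite lerD2r lerB//.
exact: ltW.
Qed.

End lipschitz_cdf.

(** * The chosen optimal map and the map G *)

Section ot_map_facts.
Context {R : realType}.
Implicit Types m n : prob R.

Lemma ot_mapP m n : atomless m -> is_ot_map m n (ot_map m n).
Proof.
by move=> m0; apply: xgetPex; exists (monotone_ot m n); exact: monotone_ot_is_ot.
Qed.

Lemma measurable_ot_map m n : atomless m ->
  measurable_fun setT (ot_map m n : measurableTypeR R -> measurableTypeR R).
Proof. by move=> m0; have [] := ot_mapP n m0. Qed.

Lemma ot_map_quantile m n : atomless m -> P2 m -> P2 n ->
  {ae unif, forall u, ot_map m n (quantile m u) = quantile n u}.
Proof. by move=> m0 m2 n2; apply: ot_map_uniq => //; exact: ot_mapP. Qed.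

Lemma ae_ord d (T : measurableType d) (mu : {measure set T -> \bar R}) K
    (A : 'I_K -> T -> Prop) :
  (forall k, {ae mu, forall x, A k x}) -> {ae mu, forall x, forall k, A k x}.
Proof.
move=> HA.
have : {ae mu, forall x, forall i, if insub i is Some k then A k x else True}.
  apply/ae_foralln => i; case: insubP => [k _ _|_]; first exact: HA.
  by exists set0; split => // x; apply.
by move=> H; apply: (ae_imp H) => x {}H k; have := H k; rewrite valK.
Qed.

Lemma Lnorm2_sqr m (f : R -> R) :
  measurable_fun setT (f : measurableTypeR R -> measurableTypeR R) ->
  ('N[m]_2%:E[(fun x => (f x)%:E)] ^+ 2 = \int[unif]_u ((f (quantile m u)) ^+ 2)%:E)%E.
Proof.
move=> mf; rewrite unlock sqr_sqrt_poweR; last first.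
  by apply: integral_ge0 => x _; exact: poweR_ge0.
have mf2 : measurable_fun setT (fun x : measurableTypeR R => ((f x) ^+ 2)%:E).
  by apply/measurable_EFinP; exact: measurable_funX.
rewrite -(ge0_integral_quantile m mf2); last by move=> x; rewrite lee_fin sqr_ge0.
apply: eq_integral => x _; rewrite abse_EFin poweR_EFin powR_mulrn//.
by rewrite real_normK ?num_real.
Qed.

Lemma Lnorm2_ot_map m n (f : R -> R) : atomless m -> P2 m -> P2 n ->
  measurable_fun setT (f : measurableTypeR R -> measurableTypeR R) ->
  ('N[m]_2%:E[(fun x => (f x - ot_map m n x)%:E)] ^+ 2 =
   \int[unif]_u ((f (quantile m u) - quantile n u) ^+ 2)%:E)%E.
Proof.
move=> m0 m2 n2 mf; have mo := measurable_ot_map n m0.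
have mq := measurable_quantile m.
rewrite (Lnorm2_sqr m (f := fun x => f x - ot_map m n x)); last exact: measurable_funB.
apply: ge0_ae_eq_integral => //.
- apply/measurable_EFinP; apply: measurable_funX; apply: measurable_funB.
    exact: measurableT_comp mf mq.
  exact: measurableT_comp mo mq.
- apply: measurable_sqrB; first exact: measurableT_comp mf mq.
  exact: measurable_quantile.
- by move=> u _; rewrite lee_fin sqr_ge0.
- by move=> u _; rewrite lee_fin sqr_ge0.
- by apply: (ae_imp (ot_map_quantile m0 m2 n2)) => u -> _.
Qed.

(** Along the quantile of [m] each optimal map takes the value of the quantile of [nu k], so the
    image measure does not remember [m]. *)
Lemma Gmap_bary K (w : 'I_K -> R) (nu : 'I_K -> prob R) m : atomless m -> P2 m ->
  (forall k, P2 (nu k)) -> meas_eq (Gmap w nu m) (bary w nu).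
Proof.
move=> m0 m2 n2 A mA; rewrite /Gmap /pushforward.
have mS : measurable_fun setT
    ((fun x => \sum_(k < K) w k * ot_map m (nu k) x) : measurableTypeR R -> measurableTypeR R).
  apply: (@measurable_sum _ (measurableTypeR R) R setT _ _ (fun k x => w k * ot_map m (nu k) x)).
  by move=> k; apply: measurable_funM => //; exact: measurable_ot_map.
rewrite (quantile_prob m); last by rewrite -[X in measurable X]setTI; exact: mS.
transitivity (unif (mean_quantile w nu @^-1` A)) => //; apply: measure_ae_eq.
- rewrite -[X in measurable X]setTI.
  exact: (measurableT_comp mS (measurable_quantile m)).
- by rewrite -[X in measurable X]setTI; exact: measurable_mean_quantile.
- apply: (ae_imp (ae_ord (fun k => ot_map_quantile m0 m2 (n2 k)))) => u H.
  by rewrite /= /mean_quantile (eq_bigr (fun k => w k * quantile (nu k) u))// => k _; rewrite H.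
Qed.

Lemma bary_expansive K (w c : 'I_K -> R) (nu : 'I_K -> prob R) :
  (forall k, 0 < w k) -> (forall k, expansive (c k) (nu k)) ->
  expansive (\sum_(k < K) w k * c k) (bary w nu).
Proof.
move=> w0 nc u v u0 uv v1; rewrite !quantile_bary ?u0 ?v1 ?(lt_le_trans u0 uv) ?(le_lt_trans uv v1)//.
rewrite /mean_quantile -sumrB mulr_suml; apply: ler_sum => k _.
by rewrite -mulrBr -mulrA ler_wpM2l//; [exact: ltW|exact: nc].
Qed.

End ot_map_facts.

(** * Measures with density bounded above and below on an interval *)

Section regular_measures.
Context {R : realType}.
Implicit Types m n : prob R.
Local Notation leb := (@lebesgue_measure R).

(** A point outside the support has a null neighbourhood, which contains an interval with rational
    ends around the point; there are countably many such intervals. *)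
Lemma msupport_null m (S : set R) : closed S -> msupport m = S -> m (~` S) = 0%E.
Proof.
move=> cS mS.
have mSc : measurable (~` S : set (measurableTypeR R)).
  by apply: measurableC; exact: closed_measurable.
pose D (p : rat * rat) : set (measurableTypeR R) :=
  if m `]ratr p.1, ratr p.2[%classic == 0%E then `]ratr p.1, ratr p.2[%classic else set0.
have D0 p : m.-negligible (D p).
  rewrite /D; case: ifPn => [/eqP p0|_]; last exact: negligible_set0.
  by exists `]ratr p.1, ratr p.2[%classic; split.
apply: measure_negligible => //.
have : m.-negligible (\bigcup_i (if unpickle i is Some p then D p else set0)).
  by apply: negligible_bigcup => i; case: unpickle => [p|]; [exact: D0|exact: negligible_set0].
apply: negligibleS => x Sx.
have : ~ msupport m x by rewrite mS.
move=> /existsNP[U /not_implyP[oU /not_implyP[Ux /negP]]]; rewrite -leNgt => mU.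
have /nbhs_ballP[e/= e0 eU] : nbhs x U by apply: open_nbhs_nbhs.
have xe1 : x - e < x by rewrite ltrBlDr ltrDl.
have xe2 : x < x + e by rewrite ltrDl.
have [q1 /andP[q1l q1r]] := rat_in_itvoo xe1.
have [q2 /andP[q2l q2r]] := rat_in_itvoo xe2.
have {}q1l : x - e < ratr q1 := q1l.
have {}q1r : ratr q1 < x := q1r.
have {}q2l : x < ratr q2 := q2l.
have {}q2r : ratr q2 < x + e := q2r.
exists (pickle (q1, q2)); [exact: I|rewrite pickleK /D].
rewrite ifT; first by rewrite /= in_itv/= q1r q2l.
apply/eqP/le_anti; rewrite measure_ge0 andbT; apply: le_trans mU.
apply: le_measure; rewrite ?inE//; first exact: open_measurable.
move=> y /=; rewrite in_itv/= => /andP[y1 y2]; apply: eU.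
by rewrite /ball/= ltr_distlC (lt_trans q1l y1) (lt_trans y2 q2r).
Qed.

(** [regular_on] restated without densities: the first two clauses reflect the upper and lower
    density bounds, the last two say that all mass lies between [lo] and [hi]. *)
Definition bi_lip (L lo hi : R) m := [/\ cdf_lip L m,
  forall x y, lo <= x -> x <= y -> y <= hi -> y - x <= L * (cdfr m y - cdfr m x),
  cdfr m lo = 0 & cdfr m hi = 1].

Lemma measure_setI_null m (A N : set (measurableTypeR R)) : measurable A -> measurable N ->
  m (~` N) = 0%E -> m A = m (A `&` N).
Proof.
move=> mA mN N0; apply: measure_ae_eq => //; first exact: measurableI.
exists (~` N); split => //; first exact: measurableC.
by move=> x /= H Nx; apply: H; split => [Ax|[]].
Qed.

Lemma regular_bi_lip lo hi m : lo < hi -> regular_on lo hi m ->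
  exists2 L, 1 <= L & bi_lip L lo hi m.
Proof.
move=> lohi [[m2 mac] msupp [f [z [[mf f0 fE] z1 fz]]]].
have z0 : 0 < z by rewrite (lt_le_trans ltr01).
have out0 : m (~` `[lo, hi]%classic) = 0%E.
  by apply: msupport_null => //; exact: itv_closed.
have m0 : atomless m by exact: ac_atomless.
have mfE : measurable_fun [set: measurableTypeR R] (EFin \o f).
  by apply/measurable_EFinP.
exists z => //; split.
- move=> x y xy; rewrite -lee_fin -prob_itvoc// (measure_setI_null (N := `[lo, hi]%classic))//.
  rewrite fE; last exact: measurableI.
  apply: (@le_trans _ _ (\int[leb]_(t in `]x, y] `&` `[lo, hi]) z%:E)%E).
    apply: ge0_le_integral => //.
    + exact: measurableI.
    + by move=> t _; rewrite lee_fin.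
    + exact: measurable_funTS.
    + move=> t [_]; rewrite /= in_itv/= => /fz /andP[_].
      by rewrite lee_fin.
  rewrite integral_cst; last exact: measurableI.
  rewrite EFinM lee_wpmul2l ?lee_fin ?(ltW z0)//.
  apply: (@le_trans _ _ (leb `]x, y]%classic)).
    by apply: le_measure; rewrite ?inE//; exact: measurableI.
  rewrite lebesgue_measure_itv/= lte_fin; case: ltP => xy'; first by rewrite EFinB.
  by rewrite lee_fin subr_ge0.
- move=> x y lox xy yhi; rewrite -ler_pdivrMl// -lee_fin -prob_itvoc// fE//.
  apply: (@le_trans _ _ (\int[leb]_(t in `]x, y]) (z^-1)%:E)%E); last first.
    apply: ge0_le_integral => //.
    + by move=> t _; rewrite lee_fin invr_ge0 ltW.
    + exact: measurable_funTS.
    + move=> t; rewrite /= in_itv/= => /andP[xt ty]; rewrite lee_fin.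
      have /fz /andP[] // : lo <= t <= hi.
      by rewrite (le_trans lox (ltW xt)) (le_trans ty yhi).
  rewrite integral_cst// EFinM lee_wpmul2l ?lee_fin ?invr_ge0 ?(ltW z0)//.
  rewrite [leRHS](_ : _ = leb `]x, y]%classic)// lebesgue_measure_itv/= lte_fin; case: ltP => xy'; first by rewrite EFinB.
  by rewrite lee_fin subr_le0.
- apply/EFin_inj; rewrite cdfrE; apply/eqP; rewrite eq_le measure_ge0 andbT.
  have -> : `]-oo, lo]%classic = `]-oo, lo[%classic `|` [set lo] :> set R.
    apply/seteqP; split => t /=; rewrite !in_itv/= le_eqVlt.
      by move=> /predU1P[->|]; [right|left].
    by move=> [->|->]; rewrite ?orbT ?eqxx.
  rewrite measureU//; last first.
    by apply/seteqP; split => // t [/=]; rewrite in_itv/= => /[swap] ->; rewrite ltxx.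
  rewrite [X in (_ + X)%E]m0 adde0; apply: (@le_trans _ _ (m (~` `[lo, hi]%classic))); last by rewrite out0.
  apply: le_measure; rewrite ?inE//; first exact: measurableC.
  by move=> t /=; rewrite !in_itv/= => tlo; apply/negP; rewrite negb_and -ltNge tlo.
- apply/EFin_inj; rewrite cdfrE; apply/eqP; rewrite eq_le probability_le1//=.
  rewrite -(probability_setT m) (measure_setI_null measurableT (N := `[lo, hi]%classic))//.
  apply: le_measure; rewrite ?inE//; first by rewrite setTI.
  by move=> t [_ /=]; rewrite !in_itv/= => /andP[].
Qed.

(** The given density is controlled only on the interval; its restriction there is still a density
    because the complement has measure zero. *)
Lemma regular_bounded_density lo hi m : regular_on lo hi m -> bounded_density m.
Proof.
move=> [[m2 mac] msupp [f [z [[mf f0 fE] z1 fz]]]].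
have z0 : 0 < z by rewrite (lt_le_trans ltr01).
have out0 : m (~` `[lo, hi]%classic) = 0%E.
  by apply: msupport_null => //; exact: itv_closed.
have fzb x : 0 <= (f \_ `[lo, hi]) x <= z.
  rewrite patchE; case: ifPn => [|_]; last by rewrite lexx ltW.
  by rewrite inE/= in_itv/= => /fz/andP[_ ->]; rewrite f0.
exists (f \_ `[lo, hi]).
  split.
  - apply/(measurable_restrictT f) => //; exact: measurable_funTS.
  - by move=> x; have /andP[] := fzb x.
  - move=> A mA; rewrite (measure_setI_null mA (N := `[lo, hi]%classic))//.
    rewrite fE; last exact: measurableI.
    by rewrite integral_mkcondr; apply: eq_integral => x _; rewrite restrict_EFin.
rewrite unlock; case: ifPn => // _.
apply: (@le_lt_trans _ _ z%:E); last exact: ltry.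
apply/ess_sup_inf.ess_supP; apply/nearW => x /=; rewrite lee_fin.
by have /andP[z0' zz] := fzb x; rewrite ger0_norm.
Qed.

Lemma bi_lip_quantile L lo hi m u : bi_lip L lo hi m -> 0 < u < 1 -> lo <= quantile m u <= hi.
Proof.
move=> [_ _ l0 h1] u01; rewrite quantile_le// h1; case/andP: (u01) => u0 /ltW ->.
by rewrite andbT ltW// quantile_gt// l0.
Qed.

(** The lower bound on increments of the distribution function turns an error in level into an error
    in position. *)
Lemma bi_lip_quantile_dist L lo hi m u y : bi_lip L lo hi m -> 0 < u < 1 -> lo <= y <= hi ->
  `|y - quantile m u| <= L * `|cdfr m y - u|.
Proof.
move=> mL u01 /andP[loy yhi]; have /andP[loq qhi] := bi_lip_quantile mL u01.
case: mL => mL lowL _ _; have m0 := cdf_lip_atomless mL.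
have Fq := cdfr_quantile m0 u01.
move: loq qhi Fq; set Q := quantile m u => loq qhi Fq; rewrite -Fq.
have [yq|/ltW qy] := leP y Q.
  rewrite ler0_norm ?subr_le0// opprB ler0_norm ?subr_le0 ?cdfr_nd// opprB.
  exact: lowL.
rewrite ger0_norm ?subr_ge0// ger0_norm ?subr_ge0 ?cdfr_nd//.
exact: lowL.
Qed.

Lemma bounded_quantile_P2 lo hi m :
  (forall u, 0 < u < 1 -> lo <= quantile m u <= hi) -> P2 m.
Proof.
move=> H; apply/P2_qmoment2.
pose B := Num.max `|lo| `|hi|.
apply: (@le_lt_trans _ _ (\int[unif]_u (B ^+ 2)%:E)%E); last first.
  by rewrite unif_integral_cst ltry.
apply: ge0_integral_unif_le => //.
- exact: measurable_quantile_sqr.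
- by move=> u; rewrite lee_fin sqr_ge0.
- by move=> u; rewrite lee_fin sqr_ge0.
move=> u /H /andP[lq qh]; rewrite lee_fin -[leLHS]real_normK ?num_real//.
suff : `|quantile m u| <= B by rewrite ler_sqr ?nnegrE// le_max normr_ge0.
rewrite ler_norml le_max lerNl le_max; apply/andP; split; apply/orP.
  by left; apply: (@le_trans _ _ (- lo)); [rewrite lerN2|rewrite -normrN ler_norm].
by right; rewrite (le_trans qh)// ler_norm.
Qed.

End regular_measures.

(** * The antiderivative of a kernel *)

Section kernel_antiderivative.
Context {R : realType}.
Variable kap : R -> R.
Hypothesis kapK : is_kernel kap.
Local Notation leb := (@lebesgue_measure R).

Let kap_gt0 x : 0 < kap x. Proof. by case: kapK => [[]]. Qed.

Let kap_cont : continuous kap. Proof. by case: kapK => [[]]. Qed.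

(** As [x] and [- x] have equal absolute value, the monotonicity condition applies in both
    directions. *)
Lemma kernel_even x : kap (- x) = kap x.
Proof.
by case: kapK => _ H _ _; apply/eqP; rewrite eq_le !H ?normrN.
Qed.

Let mkap : measurable_fun [set: measurableTypeR R] (EFin \o kap).
Proof. by apply/measurable_EFinP; exact: continuous_measurable_fun. Qed.

Lemma kernel_integrable (D : set (measurableTypeR R)) : measurable D ->
  leb.-integrable D (EFin \o kap).
Proof.
move=> mD; apply: (@integrableS _ _ _ _ setT) => //.
apply/integrableP; split => //.
under eq_integral => x _ do rewrite gee0_abs ?lee_fin ?(ltW (kap_gt0 _))//.
by case: kapK => _ _ -> _; rewrite ltry.
Qed.

Definition kernel_primitive (y : R) : R := \int[leb]_(t in `]-oo, y]) kap t.
Local Notation Phi := kernel_primitive.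

Lemma kernel_primitive_derive (y : R) : is_derive y 1 Phi (kap y).
Proof.
have yu : y < y + 1 by rewrite ltrDl.
have intk : leb.-integrable `]-oo, (y + 1)%R] (EFin \o kap) by exact: kernel_integrable.
have [dF F'] := @continuous_FTC1 R kap (BInfty R true) y (y + 1) yu intk (ltNyr y) (@kap_cont y).
by apply: DeriveDef; [exact: dF|rewrite -derive1E].
Qed.

Lemma kernel_primitive_continuous : continuous Phi.
Proof.
move=> y; apply: differentiable_continuous; apply/derivable1_diffP.
by have [] := kernel_primitive_derive y.
Qed.

Lemma kernel_primitive_MVT x y : x <= y ->
  exists2 c, x <= c <= y & Phi y - Phi x = kap c * (y - x).
Proof.
move=> xy; have [|c cxy ->] := @MVT_segment R Phi kap x y xy
  (fun z _ => kernel_primitive_derive z).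
  exact/continuous_subspaceT/kernel_primitive_continuous.
by exists c => //; move: cxy; rewrite in_itv.
Qed.

Lemma kernel_primitive_lt x y : x < y -> Phi x < Phi y.
Proof.
move=> xy; have [c _] := kernel_primitive_MVT (ltW xy).
by rewrite -subr_gt0 => ->; rewrite mulr_gt0// subr_gt0.
Qed.

Lemma kernel_primitive_le x y : x <= y -> Phi x <= Phi y.
Proof. by rewrite le_eqVlt => /predU1P[->//|/kernel_primitive_lt/ltW]. Qed.

Lemma kernel_primitive_fin y :
  (\int[leb]_(t in `]-oo, y]) (kap t)%:E = (Phi y)%:E)%E.
Proof.
rewrite /Phi /Rintegral fineK//.
have /integrableP[_] := @kernel_integrable `]-oo, y]%classic (measurable_itv _).
rewrite ge0_fin_numE; last by apply: integral_ge0 => t _; rewrite lee_fin ltW.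
suff -> : (\int[leb]_(t in `]-oo, y]) `|(EFin \o kap) t| =
           \int[leb]_(t in `]-oo, y]) (kap t)%:E)%E by [].
by apply: eq_integral => x _; rewrite gee0_abs// lee_fin ltW.
Qed.

Lemma kernel_primitive_ge0 y : 0 <= Phi y.
Proof. by apply: Rintegral_ge0 => t _; exact: ltW. Qed.

Lemma kernel_primitive_large e : 0 < e -> exists2 N : nat, (0 < N)%N & 1 - e < Phi N%:R.
Proof.
move=> e0.
have nd : nondecreasing_seq (fun i : nat => `]-oo, i%:R]%classic : set (measurableTypeR R)).
  by move=> i j ij; rewrite subsetEset; apply: subset_itvl; rewrite bnd_simp ler_nat.
have := @ge0_nondecreasing_set_cvg_integral _ (measurableTypeR R) R
  (fun i : nat => `]-oo, i%:R]%classic) (EFin \o kap) leb nd.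
have -> : \bigcup_i `]-oo, i%:R]%classic = [set: measurableTypeR R].
  apply/seteqP; split => // x _; exists (Num.truncn `|x|).+1 => //=.
  by rewrite in_itv/= (le_trans (ler_norm x))// ltW// truncnS_gt.
have [_ _ k1 _] := kapK; rewrite k1.
move=> /(_ (fun i => measurable_itv _) (fun i => measurable_funTS mkap) (fun i x _ => ltW (kap_gt0 x))).
under eq_fun do rewrite kernel_primitive_fin.
move=> /fine_cvgP[_] /cvgrPdist_lt/(_ _ e0)[N _ HN].
exists N.+1 => //; have /= := HN N.+1 (leqnSn _).
rewrite ltr_norml => /andP[_]; rewrite ltrBlDr -ltrBlDl; exact.
Qed.

Lemma kernel_primitive_le1 y : Phi y <= 1.
Proof.
rewrite -lee_fin -kernel_primitive_fin; have [_ _ <- _] := kapK.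
by apply: ge0_subset_integral => // x _; rewrite lee_fin ltW.
Qed.

Lemma kernel_primitive_opp y : Phi (- y) = 1 - Phi y.
Proof.
have mA : measurable (`]-oo, y]%classic : set (measurableTypeR R)) by [].
apply: EFin_inj; rewrite EFinB -!kernel_primitive_fin.
have [_ _ <- _] := kapK.
rewrite -(setUv `]-oo, y]%classic) ge0_integral_setU//=; last 4 first.
- exact: measurableC.
- exact: measurable_funTS.
- by move=> x _; rewrite lee_fin ltW.
- by apply/disj_setPCl.
rewrite addeAC subee ?add0e; last by rewrite kernel_primitive_fin.
have -> : ~` `]-oo, y]%classic = `]y, +oo[%classic :> set R by rewrite setCitvl.
have := @ge0_integral_pushforward _ _ (measurableTypeR R) (measurableTypeR R) R
  (-%R) (@oppr_measurable R setT) leb `]y, +oo[%classic (EFin \o kap).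
move=> /(_ (measurable_itv _) (measurable_funTS mkap)) H.
have {}H := H (fun x _ => ltW (kap_gt0 x)).
transitivity (\int[pushforward leb (-%R : measurableTypeR R -> measurableTypeR R)]_(x in `]y, +oo[) (kap x)%:E)%E.
  rewrite H opp_preimage_itvbndy/= -integral_itv_bndo_bndc; last first.
    by apply: measurable_funTS.
  by apply: eq_integral => x _ /=; rewrite kernel_even.
apply: eq_measure_integral => A mA' _; exact: lebesgue_measureN.
Qed.

Lemma kernel_integral (c b lo x : R) : 0 < b -> lo <= x ->
  \int[leb]_(z in `[lo, x]) kap ((z - c) / b) =
  b * (Phi ((x - c) / b) - Phi ((lo - c) / b)).
Proof.
move=> b0; rewrite le_eqVlt => /predU1P[->|lox].
  by rewrite subrr mulr0 set_itv1 Rintegral_set1.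
have dF (z : R) : is_derive z 1 (fun z => b * Phi ((z - c) / b)) (kap ((z - c) / b)).
  have dg : is_derive z 1 (fun z => (z - c) / b) b^-1.
    by apply: is_derive_eq; rewrite subr0 scaler0 add0r /GRing.scale/= mulr1.
  have := @is_derive1_comp _ Phi (fun z => (z - c) / b) z _ _ (kernel_primitive_derive _) dg.
  move=> dc; have := @is_deriveZ _ _ _ _ b _ _ _ dc.
  move=> H; apply: (is_derive_eq H).
  by rewrite /GRing.scale/= mulrC divfK// gt_eqF.
have cF : continuous (fun z => b * Phi ((z - c) / b)).
  move=> z; apply: differentiable_continuous; apply/derivable1_diffP.
  by have [] := dF z.
rewrite /Rintegral (@continuous_FTC2 _ _ (fun z => b * Phi ((z - c) / b)))//=.
- by rewrite mulrBr.
- apply: continuous_subspaceT => z; apply: continuous_comp; last exact: kap_cont.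
  by apply: cvgM; [apply: cvgB; [exact: cvg_id|exact: cvg_cst]|exact: cvg_cst].
- split.
  + by move=> z _; have [] := dF z.
  + by apply: cvg_at_right_filter; exact: cF.
  + by apply: cvg_at_left_filter; exact: cF.
- by move=> z _; rewrite derive1E; exact: (derive_val (is_derive:=dF z)).
Qed.

End kernel_antiderivative.

(** * Smoothed empirical distribution functions *)

Section smoothed_cdf.
Context {R : realType}.
Variable kap : R -> R.
Hypothesis kapK : is_kernel kap.
Local Notation Phi := (kernel_primitive kap).
Variables lo hi : R.
Hypothesis lohi : lo < hi.

Definition smooth_mass (b z : R) : R := Phi ((hi - z) / b) - Phi ((lo - z) / b).

(** One summand of [kernel_cdf]: the distribution function of the kernel centred at [z] with
    bandwidth [b], conditioned on the interval from [lo] to [hi]. It is a smoothed indicator of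
    [z <= x]. *)
Definition smooth_step (b z x : R) : R :=
  (Phi ((x - z) / b) - Phi ((lo - z) / b)) / smooth_mass b z.

Lemma smooth_mass_gt0 b z : 0 < b -> 0 < smooth_mass b z.
Proof.
move=> b0; rewrite /smooth_mass subr_gt0; apply: kernel_primitive_lt => //.
by rewrite ltr_pM2r ?invr_gt0// ltrD2r.
Qed.

Lemma kernel_cdfE b n xs x : 0 < b -> lo <= x ->
  kernel_cdf kap lo hi b n xs x = n%:R^-1 * \sum_(i < n) smooth_step b (xs i) x.
Proof.
move=> b0 lox; rewrite /kernel_cdf; congr (_ * _); apply: eq_bigr => i _.
rewrite !kernel_integral// ?(ltW lohi)// /smooth_step /smooth_mass.
by rewrite -mulf_div divff ?mul1r// gt_eqF.
Qed.

Lemma smooth_step_ge0 b z x : 0 < b -> lo <= x -> 0 <= smooth_step b z x.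
Proof.
move=> b0 lox; apply: mulr_ge0; last by rewrite invr_ge0 ltW// smooth_mass_gt0.
rewrite subr_ge0.
by apply: kernel_primitive_le => //; rewrite ler_pM2r ?invr_gt0// lerD2r.
Qed.

Lemma smooth_step_le1 b z x : 0 < b -> x <= hi -> smooth_step b z x <= 1.
Proof.
move=> b0 xhi; rewrite /smooth_step ler_pdivrMr ?smooth_mass_gt0// mul1r /smooth_mass lerD2r.
by apply: kernel_primitive_le => //; rewrite ler_pM2r ?invr_gt0// lerD2r.
Qed.

(** The constants are existential and may depend on samples and bandwidths: the property serves
    invertibility and regularity of the estimated maps, not rates. *)
Definition bilip_cdf (a b : R) (F : R -> R) : Prop := [/\ F a = 0, F b = 1 &
  exists c C, [/\ 0 < c, 0 < C & forall x y, a <= x -> x <= y -> y <= b ->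
    c * (y - x) <= F y - F x <= C * (y - x)]].

Lemma smooth_step_bilip b z : 0 < b -> exists c C, [/\ 0 < c, 0 < C &
  forall x y, lo <= x -> x <= y -> y <= hi ->
    c * (y - x) <= smooth_step b z y - smooth_step b z x <= C * (y - x)].
Proof.
move=> b0; have m0 := smooth_mass_gt0 z b0.
have [[kap0 _] kapd _ _] := kapK.
(* [M] bounds the scaled argument over the whole interval, so the kernel stays between [kap M] and
   [kap 0] in the mean value theorem. *)
pose M := (`|lo - z| + `|hi - z|) / b.
have bm0 : 0 < (b * smooth_mass b z)^-1 by rewrite invr_gt0 mulr_gt0.
exists (kap M * (b * smooth_mass b z)^-1), (kap 0 * (b * smooth_mass b z)^-1).
split; [by rewrite mulr_gt0|by rewrite mulr_gt0|move=> x y lox xy yhi].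
rewrite /smooth_step -mulrBl opprB addrA subrK.
have xyb : (x - z) / b <= (y - z) / b by rewrite ler_pM2r ?invr_gt0// lerD2r.
have [c /andP[xc cy] ->] := kernel_primitive_MVT kapK xyb.
have -> : kap c * ((y - z) / b - (x - z) / b) / smooth_mass b z =
    kap c * (b * smooth_mass b z)^-1 * (y - x).
  by field; rewrite !gt_eqF.
have yx : 0 <= y - x by rewrite subr_ge0.
rewrite !(ler_wpM2r yx)// ler_pM2r// kapd ?normr0// /M.
rewrite [X in _ <= X]ger0_norm; last by rewrite divr_ge0 ?addr_ge0// ltW.
rewrite ler_norml -mulNr; apply/andP; split.
  apply: le_trans xc; rewrite ler_pM2r ?invr_gt0// opprD -lerBrDr.
  have l1 : - `|lo - z| <= lo - z by rewrite lerNl -normrN ler_norm.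
  have h1 := normr_ge0 (hi - z); lra.
apply: (le_trans cy); rewrite ler_pM2r ?invr_gt0//.
have h1 := ler_norm (hi - z); have := normr_ge0 (lo - z); lra.
Qed.

Lemma kernel_cdf_bilip b n xs : 0 < b -> (0 < n)%N ->
  bilip_cdf lo hi (kernel_cdf kap lo hi b n xs).
Proof.
move=> b0 n0; have n0R : 0 < n%:R :> R by rewrite ltr0n.
split.
- rewrite kernel_cdfE// big1 ?mulr0// => i _.
  by rewrite /smooth_step subrr mul0r.
- rewrite kernel_cdfE// ?(ltW lohi)//.
  rewrite (eq_bigr (fun=> 1)) => [|i _]; last first.
    by rewrite /smooth_step divff// gt_eqF// smooth_mass_gt0.
  by rewrite sumr_const card_ord mulVf// gt_eqF.
- have /choice[c Hc] : forall i, exists c, exists C, [/\ 0 < c, 0 < C &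
    forall x y, lo <= x -> x <= y -> y <= hi ->
      c * (y - x) <= smooth_step b (xs i) y - smooth_step b (xs i) x <= C * (y - x)].
    by move=> i; exact: smooth_step_bilip.
  have /choice[C HC] := Hc.
  have pos (f : nat -> R) : (forall i, 0 < f i) -> 0 < n%:R^-1 * \sum_(i < n) f i.
    move=> f0; rewrite mulr_gt0 ?invr_gt0//; case: n n0 {n0R} => // n _.
    by rewrite big_ord_recl ltr_pwDl// sumr_ge0// => i _; exact: ltW.
  exists (n%:R^-1 * \sum_(i < n) c i), (n%:R^-1 * \sum_(i < n) C i); split.
  + by apply: pos => i; have [] := HC i.
  + by apply: pos => i; have [] := HC i.
  + move=> x y lox xy yhi; rewrite !kernel_cdfE// ?(le_trans lox)//.
    rewrite -mulrBr -sumrB -!mulrA !ler_pM2l ?invr_gt0// !mulr_suml.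
    by apply/andP; split; apply: ler_sum => i _;
      have [_ _ /(_ x y lox xy yhi)/andP[]] := HC i.
Qed.

(** For small bandwidths the smoothed step is close to the indicator of [z <= x], uniformly away
    from [x = z]. The renormalizing mass stays bounded below even when [z] is an end of the
    interval. *)
Lemma smooth_step_sharp (delta eps : R) : 0 < delta -> 0 < eps ->
  exists2 b0, 0 < b0 & forall b z x, 0 < b <= b0 -> lo <= z <= hi -> lo <= x <= hi ->
    (x + delta <= z -> smooth_step b z x <= eps) /\
    (z <= x - delta -> 1 - eps <= smooth_step b z x).
Proof.
move=> d0 e0; pose P0 := Phi 0.
have half : P0 = 2^-1.
  have := kernel_primitive_opp kapK 0; rewrite oppr0 -/P0 => H; lra.
pose e1 := Num.min (eps / 4) (1 / 4).
have e10 : 0 < e1 by rewrite lt_min !divr_gt0.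
have e1e : e1 <= eps / 4 by rewrite ge_min lexx.
have e14 : e1 <= 1 / 4 by rewrite ge_min lexx orbT.
have [N N0 HN] := kernel_primitive_large kapK e10.
have N0R : 0 < N%:R :> R by rewrite ltr0n.
have HNn : Phi (- N%:R) < e1 by rewrite kernel_primitive_opp//; lra.
pose d := Num.min delta ((hi - lo) / 2).
have d'0 : 0 < d by rewrite lt_min d0 divr_gt0// subr_gt0.
exists (d / N%:R); first by rewrite divr_gt0.
move=> b z x /andP[b0 bN] /andP[loz zhi] /andP[lox xhi].
have bd (r : R) : d <= r -> N%:R <= r / b.
  by move=> dr; rewrite ler_pdivlMr// mulrC -ler_pdivlMr// (le_trans bN)// ler_pM2r ?invr_gt0.
have big r : d <= r -> 1 - e1 <= Phi (r / b).
  by move=> /bd rb; apply/ltW/(lt_le_trans HN); exact: kernel_primitive_le.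
have small r : r <= - d -> Phi (r / b) <= e1.
  move=> rd; apply: (le_trans _ (ltW HNn)); apply: kernel_primitive_le => //.
  by rewrite lerNr -mulNr bd// lerNr.
have ddelta : d <= delta by rewrite ge_min lexx.
have dhalf : d <= (hi - lo) / 2 by rewrite ge_min lexx orbT.
(* One end of the interval is at distance at least half its length from [z], and between [z] and
   that end the kernel has mass at least [1/2 - e1]. *)
have m4 : 1 / 4 <= smooth_mass b z.
  rewrite /smooth_mass; have [zm|zm] := leP z ((lo + hi) / 2).
    have : 1 - e1 <= Phi ((hi - z) / b) by apply: big; lra.
    have : Phi ((lo - z) / b) <= P0.
      by apply: kernel_primitive_le => //; rewrite ler_pdivrMr// mul0r subr_le0.
    by lra.
  have : Phi ((lo - z) / b) <= e1 by apply: small; lra.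
  have : P0 <= Phi ((hi - z) / b).
    by apply: kernel_primitive_le => //; rewrite ler_pdivlMr// mul0r subr_ge0.
  by lra.
have m0 : 0 < smooth_mass b z by lra.
have em : e1 <= eps * smooth_mass b z.
  by apply: (le_trans e1e); rewrite ler_wpM2l ?(ltW e0)//; lra.
split => [xz|zx].
  rewrite ler_pdivrMr//; apply: le_trans em.
  have : Phi ((x - z) / b) <= e1 by apply: small; lra.
  have := kernel_primitive_ge0 kapK ((lo - z) / b); lra.
rewrite ler_pdivlMr// mulrBl mul1r.
have : 1 - e1 <= Phi ((x - z) / b) by apply: big; lra.
have := kernel_primitive_le1 kapK ((hi - z) / b); rewrite {1}/smooth_mass; lra.
Qed.

Definition ecdf (n : nat) (xs : nat -> R) (x : R) : R :=
  n%:R^-1 * \sum_(i < n) (xs i <= x)%R%:R.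

Lemma ecdf_le n xs x y : x <= y -> ecdf n xs x <= ecdf n xs y.
Proof.
move=> xy; rewrite ler_wpM2l ?invr_ge0//; apply: ler_sum => i _.
by rewrite ler_nat; case: (leP (xs i) x) => // /le_trans/(_ xy)->.
Qed.

(** The shift by 1 starts the grid one step left of [lo]; [N.+4] nodes of step [(hi - lo) / N] end
    two steps right of [hi]. Every [x] in the interval, even [hi], thus has nodes below [x - s] and
    above [x + s], each within [2 * s] of [x]. *)
Definition grid (s : R) (j : nat) : R := lo + (j%:R - 1) * s.

(** The smoothed function lies between the empirical one at [x - s] and at [x + s], up to [eps].
    Monotonicity moves these points to grid nodes, at a Lipschitz cost of [2 * l * s]. Since [x] may
    be random, the deviation at its node is bounded by the sum over all nodes, which are fixed
    points. *)
Lemma kernel_cdf_dev (m : prob R) (l eps b s : R) (N n : nat) (xs : nat -> R) (x : R) :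
  cdf_lip l m -> (0 < n)%N -> (0 < N)%N -> 0 < b -> 0 <= eps -> s = (hi - lo) / N%:R ->
  (forall z x, lo <= z <= hi -> lo <= x <= hi ->
    (x + s <= z -> smooth_step b z x <= eps) /\
    (z <= x - s -> 1 - eps <= smooth_step b z x)) ->
  (forall i, (i < n)%N -> lo <= xs i <= hi) -> lo <= x <= hi ->
  (kernel_cdf kap lo hi b n xs x - cdfr m x) ^+ 2 <=
  2 * (eps + 2 * l * s) ^+ 2 +
  2 * \sum_(j < N.+4) (ecdf n xs (grid s j) - cdfr m (grid s j)) ^+ 2.
Proof.
move=> ml n0 N0 b0 eps0 sE sharp xsin xin; case/andP: (xin) => lox xhi.
have n0R : 0 < n%:R :> R by rewrite ltr0n.
have N0R : 0 < N%:R :> R by rewrite ltr0n.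
have s0 : 0 < s by rewrite sE divr_gt0// subr_gt0.
have l0 := cdf_lip_ge0 ml.
set KC := kernel_cdf _ _ _ _ _ _ _.
have KCE : KC = n%:R^-1 * \sum_(i < n) smooth_step b (xs i) x by exact: kernel_cdfE.
have mean_cst (c : R) : n%:R^-1 * \sum_(i < n) c = c.
  by rewrite sumr_const card_ord -[c *+ n]mulr_natl mulrA mulVf ?mul1r// gt_eqF.
have up : KC <= eps + ecdf n xs (x + s).
  rewrite KCE /ecdf -[X in X + _]mean_cst -mulrDr -big_split/= ler_pM2l ?invr_gt0//.
  apply: ler_sum => i _; have xi := xsin i (ltn_ord i).
  have [_|/ltW xsi] := leP (xs i) (x + s).
    by rewrite (le_trans (smooth_step_le1 _ b0 xhi))// lerDr.
  by rewrite addr0; apply: (sharp _ _ xi xin).1.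
have down : ecdf n xs (x - s) - eps <= KC.
  rewrite KCE /ecdf -[X in _ - X]mean_cst -mulrBr -sumrB ler_pM2l ?invr_gt0//.
  apply: ler_sum => i _; have xi := xsin i (ltn_ord i).
  have [xsi|_] := leP (xs i) (x - s); first exact: (sharp _ _ xi xin).2.
  by rewrite (le_trans _ (smooth_step_ge0 _ b0 lox))// sub0r oppr_le0.
pose j := Num.truncn ((x - lo) / s).
have xs0 : 0 <= (x - lo) / s by rewrite divr_ge0 ?subr_ge0 ?(ltW s0).
have jle : j%:R * s <= x - lo.
  by rewrite -ler_pdivlMr// truncn_le.
have jgt : x - lo < j.+1%:R * s by rewrite -ltr_pdivrMr// truncnS_gt.
have jN : (j <= N)%N.
  rewrite -(ler_nat R) -(ler_pM2r s0) (le_trans jle)// sE mulrCA divff ?gt_eqF// mulr1.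
  by rewrite lerD2r.
set D := \sum_(j < _) _.
have devD (i : nat) : (i < N.+4)%N -> (ecdf n xs (grid s i) - cdfr m (grid s i)) ^+ 2 <= D.
  move=> iN; rewrite /D (bigD1 (Ordinal iN))//= lerDl sumr_ge0// => k _.
  exact: sqr_ge0.
have D0 : 0 <= D by apply: sumr_ge0 => k _; exact: sqr_ge0.
have sqD (i : nat) : (i < N.+4)%N -> `|ecdf n xs (grid s i) - cdfr m (grid s i)| <= Num.sqrt D.
  by move=> iN; rewrite -sqrtr_sqr ler_wsqrtr// devD.
have j1 : j.+1%:R = j%:R + 1 :> R by rewrite -natr1.
have j3 : j.+3%:R = j%:R + 3 :> R by rewrite -addn3 natrD.
have g0 : grid s j <= x - s by rewrite /grid; lra.
have g0' : x - 2 * s <= grid s j by rewrite /grid; move: jgt; rewrite j1; lra.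
have g3 : x + s <= grid s j.+3 by rewrite /grid j3; move: jgt; rewrite j1; lra.
have g3' : grid s j.+3 <= x + 2 * s by rewrite /grid j3; lra.
have jN3 : (j.+3 < N.+4)%N by rewrite !ltnS.
have j0 : (j < N.+4)%N by rewrite ltnS (leq_trans jN)// -addn3 leq_addr.
have /ler_normlP[_ dup] := sqD _ jN3; have /ler_normlP[ddn _] := sqD _ j0.
have eup := ecdf_le n xs g3; have edn := ecdf_le n xs g0.
have x3 : x <= grid s j.+3 by lra.
have x0 : grid s j <= x by lra.
have lup := ml _ _ x3; have ldn := ml _ _ x0.
have lup2 : l * (grid s j.+3 - x) <= l * (2 * s) by rewrite ler_wpM2l//; lra.
have ldn2 : l * (x - grid s j) <= l * (2 * s) by rewrite ler_wpM2l//; lra.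
have bnd : `|KC - cdfr m x| <= eps + 2 * l * s + Num.sqrt D.
  by apply/ler_normlP; split; lra.
have rD := sqr_sqrtr D0.
apply: (@le_trans _ _ ((eps + 2 * l * s + Num.sqrt D) ^+ 2)).
  rewrite -[leLHS]real_normK ?num_real// ler_sqr ?nnegrE//.
  exact: le_trans (normr_ge0 _) bnd.
rewrite -{2}rD -subr_ge0 (_ : _ - _ = (eps + 2 * l * s - Num.sqrt D) ^+ 2) ?sqr_ge0//.
by ring.
Qed.

End smoothed_cdf.

(** * The estimated monotone maps *)

Section monotone_maps.
Context {R : realType}.
Variables (lo hi lo' hi' : R) (G F : R -> R).
Hypotheses (lohi : lo < hi) (lohi' : lo' < hi').
Hypotheses (GP : bilip_cdf lo hi G) (FP : bilip_cdf lo' hi' F).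
Local Notation T := (monotone_map lo hi lo' hi' G F).

Lemma bilip_cdf_le (a b : R) (f : R -> R) x y : bilip_cdf a b f ->
  a <= x <= b -> a <= y <= b -> (f x <= f y) = (x <= y).
Proof.
move=> [_ _ [c [C [c0 C0 H]]]] /andP[ax xb] /andP[ay yb].
have [xy|yx] := leP x y.
  have /andP[fxy _] := H x y ax xy yb.
  by rewrite -subr_ge0 (le_trans _ fxy)// mulr_ge0 ?subr_ge0 ?(ltW c0).
apply/negbTE; rewrite -ltNge -subr_gt0.
have /andP[+ _] := H y x ay (ltW yx) xb.
by apply: lt_le_trans; rewrite mulr_gt0// subr_gt0.
Qed.

Lemma bilip_cdf_01 (a b : R) (f : R -> R) x : bilip_cdf a b f -> a <= x <= b ->
  0 <= f x <= 1.
Proof.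
move=> fP xab; have [f0 f1 _] := fP; case/andP: (xab) => ax xb.
rewrite -f0 -f1 !(bilip_cdf_le fP)// ?ax ?xb ?lexx ?andbT//; exact: le_trans xb.
Qed.

Lemma lipschitz_continuous_fun (g : R -> R) (C : R) : 0 < C ->
  (forall x y, x <= y -> `|g y - g x| <= C * (y - x)) -> continuous g.
Proof.
move=> C0 H x; apply/cvgrPdist_lt => e e0.
apply/nbhs_ballP; exists (e / C) => /=; first by rewrite divr_gt0.
move=> y; rewrite /ball/= => xy.
have : `|g x - g y| <= C * `|x - y|.
  have [h|/ltW h] := leP x y.
    by rewrite distrC [X in C * X]distrC [X in C * X]ger0_norm ?subr_ge0// H.
  by rewrite [X in C * X]ger0_norm ?subr_ge0// H.
by move=> /le_lt_trans; apply; rewrite mulrC -ltr_pdivlMr.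
Qed.

Definition clamp (a b x : R) : R := Num.max a (Num.min b x).

Lemma clamp_id (a b x : R) : a <= x <= b -> clamp a b x = x.
Proof. by move=> /andP[ax xb]; rewrite /clamp min_r// max_r. Qed.

Lemma clamp_in (a b x : R) : a <= b -> a <= clamp a b x <= b.
Proof. by move=> ab; rewrite /clamp le_max lexx/= ge_max ab ge_min lexx. Qed.

Lemma clamp_lip (a b x y : R) : a <= b -> x <= y ->
  0 <= clamp a b y - clamp a b x <= y - x.
Proof.
move=> ab xy; rewrite /clamp.
rewrite !minElt !maxElt.
by case: (ltP b x) => ?; case: (ltP b y) => ?; repeat case: ltP => ?;
  apply/andP; split; lra.
Qed.

Lemma bilip_cdf_surj (a b : R) (f : R -> R) u : a < b -> bilip_cdf a b f -> 0 <= u <= 1 ->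
  exists2 y, a <= y <= b & f y = u.
Proof.
move=> ab fP u01; have [f0 f1 [c [C [c0 C0 H]]]] := fP.
have aleb := ltW ab.
(* [f] is controlled only on the interval; precomposition with [clamp] gives a function continuous
   everywhere, to which the intermediate value theorem applies. *)
have cf : continuous (f \o clamp a b).
  apply: (@lipschitz_continuous_fun _ C) => // x y xy /=.
  have /andP[k1 k2] := clamp_lip aleb xy.
  have /andP[ax xb] := clamp_in x aleb; have /andP[ay yb] := clamp_in y aleb.
  have kle : clamp a b x <= clamp a b y by rewrite -subr_ge0.
  have /andP[h1 h2] := H _ _ ax kle yb.
  rewrite ger0_norm; last by rewrite (le_trans _ h1)// mulr_ge0// ltW.
  by rewrite (le_trans h2)// ler_wpM2l// ltW.
have [] := @IVT _ (f \o clamp a b) a b u aleb (continuous_subspaceT cf).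
  by rewrite /= !clamp_id ?lexx ?aleb// f0 f1 min_l ?max_r.
move=> y; rewrite in_itv/= => yab <-; exists y => //.
by rewrite clamp_id.
Qed.

(** [F] is onto the unit interval, so the partial inverse never takes its default value here. The
    equation [F (T x) = G x] replaces it from now on. *)
Lemma monotone_mapP x : lo <= x <= hi -> lo' <= T x <= hi' /\ F (T x) = G x.
Proof.
move=> /andP[lox xhi]; rewrite /monotone_map ltNge lox/= xhi.
have [y yin Fy] : exists2 y, lo' <= y <= hi' & F y = G x.
  by apply: bilip_cdf_surj => //; apply: (bilip_cdf_01 GP); rewrite lox.
have imG : (F @` `[lo', hi']) (G x) by exists y => //=; rewrite in_itv.
split; last by apply: pinvK; rewrite inE.
have := @surjpinv_image_sub _ _ (cst lo') `[lo', hi']%classic (F @` `[lo', hi']) F.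
move=> /(_ (fun _ => id)) /(_ ('pinv_(cst lo') `[lo', hi']%classic F (G x))) /=.
by rewrite in_itv/=; apply; exists (G x).
Qed.

(** Expresses sublevel sets of the map by a comparison of [G] and [F], without inversion;
    measurability in the samples rests on it. *)
Lemma monotone_map_le x y : lo <= x <= hi -> lo' <= y <= hi' ->
  (T x <= y) = (G x <= F y).
Proof.
move=> xin yin; have [Tin FT] := monotone_mapP xin.
by rewrite -FT (bilip_cdf_le FP).
Qed.

Lemma monotone_map_eq x y : lo <= x <= hi -> lo' <= y <= hi' -> F y = G x -> T x = y.
Proof.
move=> xin yin Fy; have [Tin FT] := monotone_mapP xin.
apply/eqP; rewrite eq_le -(bilip_cdf_le FP Tin yin) -(bilip_cdf_le FP yin Tin).
by rewrite FT Fy lexx.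
Qed.

Lemma monotone_map_lo : T lo = lo'.
Proof.
have [G0 _ _] := GP; have [F0 _ _] := FP.
by apply: monotone_map_eq; rewrite ?lexx ?ltW// F0 G0.
Qed.

Lemma monotone_map_hi : T hi = hi'.
Proof.
have [_ G1 _] := GP; have [_ F1 _] := FP.
by apply: monotone_map_eq; rewrite ?lexx ?ltW// F1 G1.
Qed.

(** The constant values outside the interval match the values at its ends, because [G] and [F] both
    run from 0 to 1. Continuity across the ends follows. *)
Lemma monotone_map_clamp x : T x = T (clamp lo hi x).
Proof.
have [xlo|lox] := ltP x lo.
  rewrite (_ : clamp lo hi x = lo); last first.
    by rewrite /clamp min_r ?max_l// ?ltW// (lt_trans xlo).
  by rewrite monotone_map_lo /monotone_map xlo.
have [xhi|hix] := leP x hi; first by rewrite clamp_id// lox.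
rewrite (_ : clamp lo hi x = hi); last by rewrite /clamp min_l ?max_r ?ltW.
by rewrite monotone_map_hi /monotone_map ltNge lox/= leNgt hix.
Qed.

Lemma monotone_map_in x : lo' <= T x <= hi'.
Proof. by rewrite monotone_map_clamp; apply: (monotone_mapP _).1; rewrite clamp_in// ltW. Qed.

Lemma monotone_map_bilip : exists c C, [/\ 0 < c, 0 < C,
  forall x y, lo <= x -> x <= y -> y <= hi -> c * (y - x) <= T y - T x &
  forall x y, x <= y -> 0 <= T y - T x <= C * (y - x)].
Proof.
have [_ _ [c1 [C1 [c10 C10 GL]]]] := GP; have [_ _ [c2 [C2 [c20 C20 FL]]]] := FP.
have base x y : lo <= x -> x <= y -> y <= hi ->
    0 <= T y - T x /\ c2 * (T y - T x) <= C1 * (y - x) /\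
    c1 * (y - x) <= C2 * (T y - T x).
  move=> lox xy yhi.
  have xin : lo <= x <= hi by rewrite lox (le_trans xy).
  have yin : lo <= y <= hi by rewrite yhi (le_trans lox).
  have [/andP[Tx1 Tx2] FTx] := monotone_mapP xin.
  have [/andP[Ty1 Ty2] FTy] := monotone_mapP yin.
  have TT : T x <= T y.
    by rewrite monotone_map_le ?Ty1// FTy (bilip_cdf_le GP).
  have /andP[g1 g2] := GL x y lox xy yhi.
  have /andP[f1 f2] := FL _ _ Tx1 TT Ty2.
  by rewrite subr_ge0; split => //; rewrite FTx FTy in f1 f2; split; lra.
exists (c1 / C2), (C1 / c2); split; try exact: divr_gt0.
  move=> x y lox xy yhi; have [_ [_ H]] := base x y lox xy yhi.
  by rewrite mulrAC ler_pdivrMr// [leRHS]mulrC.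
move=> x y xy; rewrite !(monotone_map_clamp x) !(monotone_map_clamp y).
have /andP[k1 k2] := clamp_lip (ltW lohi) xy.
have /andP[ax xb] := clamp_in x (ltW lohi); have /andP[ay yb] := clamp_in y (ltW lohi).
have kle : clamp lo hi x <= clamp lo hi y by rewrite -subr_ge0.
have [T0 [T1 _]] := base _ _ ax kle yb.
rewrite T0/= mulrAC ler_pdivlMr// mulrC (le_trans T1)//.
by rewrite ler_wpM2l// ltW.
Qed.

Lemma monotone_map_nd : {homo T : x y / x <= y}.
Proof.
have [c [C [_ _ _ H]]] := monotone_map_bilip.
by move=> x y /H /andP[]; rewrite subr_ge0.
Qed.

Lemma monotone_map_continuous : continuous T.
Proof.
have [c [C [_ C0 _ H]]] := monotone_map_bilip.
by apply: (lipschitz_continuous_fun C0) => x y xy; have /andP[T0 T1] := H x y xy; rewrite ger0_norm.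
Qed.

Lemma monotone_map_Clin : Clin T.
Proof.
split; first exact: monotone_map_continuous.
pose B := Num.max `|lo'| `|hi'|.
apply: (@le_lt_trans _ _ B%:E); last exact: ltry.
apply: ge_ereal_sup => _ [x _ <-]; rewrite lee_fin.
have x1 : 0 < 1 + `|x| by rewrite ltr_pwDl.
have B0 : 0 <= B by rewrite le_max normr_ge0.
rewrite ler_pdivrMr// (@le_trans _ _ B)//; last by rewrite ler_peMr// lerDl.
have /andP[T1 T2] := monotone_map_in x.
rewrite ler_norml lerNl !le_max; apply/andP; split; apply/orP.
  by left; apply: (@le_trans _ _ (- lo')); [rewrite lerN2|rewrite -normrN ler_norm].
by right; rewrite (le_trans T2)// ler_norm.
Qed.

(** The level error at [T x] splits through [F (T x) = G x] into an error of [F] against the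
    distribution function of [m] and an error of [G x] against [u]; [bi_lip_quantile_dist] converts
    it into a distance. *)
Lemma monotone_map_quantile_dist L (m : prob R) x u : bi_lip L lo' hi' m -> 0 < u < 1 ->
  lo <= x <= hi ->
  `|T x - quantile m u| <= L * (`|F (T x) - cdfr m (T x)| + `|G x - u|).
Proof.
move=> mL u01 xin; have [Tin FT] := monotone_mapP xin.
apply: le_trans (bi_lip_quantile_dist mL u01 Tin) _.
have L0 : 0 <= L by case: mL => /cdf_lip_ge0.
rewrite ler_wpM2l// -{1}(subrK (F (T x)) (cdfr m (T x))) -addrA (le_trans (ler_normD _ _))//.
by rewrite distrC lerD2l FT.
Qed.

End monotone_maps.

(** * Borel dependence on the measure through its Lipschitz level *)

Section lipschitz_level.
Context {R : realType}.
Implicit Types m n : prob R.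

Lemma borel_P2C (A : set (prob R)) : borel_P2 A -> borel_P2 (P2 `\` A).
Proof. by have [_ + _] := smallest_sigma_algebra (@P2 R) W2_open; apply. Qed.

Lemma borel_P2_bigcup (A : (set (prob R))^nat) :
  (forall i, borel_P2 (A i)) -> borel_P2 (\bigcup_i A i).
Proof. by have [_ _] := smallest_sigma_algebra (@P2 R) W2_open; apply. Qed.

Lemma borel_P20 : borel_P2 (@set0 (prob R)).
Proof. by have [] := smallest_sigma_algebra (@P2 R) W2_open. Qed.

Lemma quantile_dist_markov m n (d : R) : 0 < d ->
  ((d ^+ 2)%:E * unif [set u | (d <= `|quantile m u - quantile n u|)%R] <= qdist m n)%E.
Proof.
move=> d0; have mm := measurable_quantile m; have mn := measurable_quantile n.
have mb : measurable_fun setT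
    (fun u : measurableTypeR R => d <= `|quantile m u - quantile n u|).
  apply: measurable_fun_ler => //; apply: measurableT_comp => //.
  exact: measurable_funB.
rewrite -integral_bool// -ge0_integralZl//; last 2 first.
- exact: measurable_bool_EFin.
- by rewrite lee_fin sqr_ge0.
apply: ge0_le_integral => //.
- by move=> u _; rewrite mule_ge0// lee_fin sqr_ge0.
- by apply: measurable_funeM; exact: measurable_bool_EFin.
- exact: measurable_sqrB.
move=> u _; rewrite -EFinM lee_fin; case: (leP d) => [du|_]; last by rewrite mulr0 sqr_ge0.
by rewrite mulr1 -[leRHS]real_normK ?num_real// ler_sqr ?nnegrE// ltW.
Qed.

(** The square of [d * min d 1] is at most [d^2 * d], so by Chebyshev the quantiles differ by [d] or
    more with probability at most [d]; elsewhere the interval only needs widening by [d] on both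
    sides. *)
Lemma W2_lt_cdf m n (d x y : R) : 0 < d -> x <= y ->
  (W2 m n < (d * Num.min d 1)%:E)%E ->
  cdfr m y - cdfr m x <= cdfr n (y + d) - cdfr n (x - d) + d.
Proof.
move=> d0 xy Wd; set e := d * Num.min d 1 in Wd.
have min0 : 0 < Num.min d 1 by rewrite lt_min d0 ltr01.
have e0 : 0 < e by rewrite mulr_gt0.
have qe : (qdist m n <= (e ^+ 2)%:E)%E.
  rewrite -W2_sqr; have := W2_ge0 m n; case: (W2 m n) Wd => [r| |]//.
  rewrite lte_fin => re; rewrite lee_fin => r0; rewrite -EFin_expe lee_fin.
  by rewrite ler_sqr ?nnegrE// ltW.
have e2 : e ^+ 2 <= d ^+ 2 * d.
  rewrite /e exprMn ler_wpM2l ?sqr_ge0// expr2.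
  have m1 : Num.min d 1 <= 1 by rewrite ge_min lexx orbT.
  have md : Num.min d 1 <= d by rewrite ge_min lexx.
  by rewrite (le_trans _ md)// ler_piMr// ltW.
have mb : measurable [set u : measurableTypeR R | d <= `|quantile m u - quantile n u|].
  apply: measurable_set_bool; apply: measurable_fun_ler => //; apply: measurableT_comp => //.
  by apply: measurable_funB; exact: measurable_quantile.
have Pd : (unif [set u | (d <= `|quantile m u - quantile n u|)%R] <= d%:E)%E.
  rewrite -(@lee_pmul2l _ (d ^+ 2)%:E) ?lte_fin ?exprn_gt0//.
  apply: (le_trans (quantile_dist_markov m n d0)); apply: (le_trans qe).
  by rewrite -EFinM lee_fin.
have mq (p : prob R) a b : measurable (quantile p @^-1` `]a, b]%classic : set (measurableTypeR R)).
  by rewrite -[X in measurable X]setTI; exact: measurable_quantile.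
have xyd : x - d <= y + d by lra.
rewrite -lee_fin (EFinD _ d) -!prob_itvoc// (quantile_prob m)// (quantile_prob n)//.
apply: (@le_trans _ _ (unif ((quantile n @^-1` `](x - d)%R, (y + d)%R]%classic) `|`
   [set u | (d <= `|quantile m u - quantile n u|)%R]))%E).
  apply: le_measure; rewrite ?inE//; first exact: measurableU.
  move=> u /=; rewrite !in_itv/= => /andP[xq qy].
  have [H|/ltr_normlP[h1 h2]] := leP d `|quantile m u - quantile n u|; [by right|left].
  by apply/andP; split; lra.
apply: (le_trans (measureU2 _ _ _)) => //.
by rewrite leeD2l.
Qed.

(** A strict violation at one pair of points persists for nearby measures, by [W2_lt_cdf]. Hence the
    Lipschitz measures form a relatively closed set. *)
Lemma cdf_lip_open (l : R) : W2_open [set m : prob R | P2 m /\ ~ cdf_lip l m].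
Proof.
split=> [m []//|m [m2 mNl]].
have [l0|l0] := ltP l 0.
  exists 1 => // n n2 _; split => // nl.
  by have := cdf_lip_ge0 nl; rewrite leNgt l0.
move/existsNP: mNl => [x /existsNP[y /not_implyP[xy /negP]]]; rewrite -ltNge => gap.
(* Widening and exceptional mass cost [(2 * l + 1) * d], strictly less than the gap
   [(2 * l + 2) * d]. *)
pose d := (cdfr m y - cdfr m x - l * (y - x)) / (2 * l + 2).
have l2 : 0 < 2 * l + 2 by rewrite ltr_wpDl// mulr_ge0.
have d0 : 0 < d by rewrite divr_gt0// subr_gt0.
exists (d * Num.min d 1); first by rewrite mulr_gt0// lt_min d0 ltr01.
move=> n n2 Wd; split => // nl.
have H1 := W2_lt_cdf d0 xy Wd.
have H2 := nl (x - d) (y + d) (_ : x - d <= y + d).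
have xyd : x - d <= y + d by lra.
have {}H2 := H2 xyd.
have dE : d * (2 * l + 2) = cdfr m y - cdfr m x - l * (y - x).
  by rewrite /d divfK// gt_eqF.
have : l * (y + d - (x - d)) = l * (y - x) + 2 * l * d by ring.
have : d * (2 * l + 2) = 2 * l * d + 2 * d by ring.
lra.
Qed.

Lemma borel_cdf_lip (l : R) : borel_P2 [set m : prob R | P2 m /\ cdf_lip l m].
Proof.
have -> : [set m : prob R | P2 m /\ cdf_lip l m] =
    P2 `\` [set m : prob R | P2 m /\ ~ cdf_lip l m].
  apply/seteqP; split => m /= [m2 H]; split => //; first by case.
  by apply: contrapT => ml; exact: H.
by apply: borel_P2C; apply: sub_gen_smallest; exact: cdf_lip_open.
Qed.

(* 0 stands for a cdf that is not Lipschitz. *)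
Definition lip_level m : nat :=
  if pselect (exists n : nat, `[< cdf_lip n%:R m >]) is left H then ex_minn H else 0%N.

Lemma cdf_lip_mono (l l' : R) m : l <= l' -> cdf_lip l m -> cdf_lip l' m.
Proof. by move=> ll H x y xy; apply: (le_trans (H x y xy)); rewrite ler_wpM2r// subr_ge0. Qed.

Lemma cdf_lip_gt0 (l : R) m : cdf_lip l m -> 0 < l.
Proof.
move=> ml; have l0 := cdf_lip_ge0 ml; rewrite lt_neqAle l0 andbT; apply/negP => /eqP lE.
have p1 : 0 < 1 / 3 :> R by lra.
have p2 : 2 / 3 < 1 :> R by lra.
have [x Hx] := cdfr_small m p1; have [y Hy] := cdfr_large m p2.
have [xy|/ltW/(cdfr_nd m) yx] := leP x y; last lra.
by have := ml x y xy; rewrite -lE mul0r; lra.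
Qed.

Lemma lip_levelP (l : nat) m : cdf_lip l%:R m ->
  cdf_lip (lip_level m)%:R m /\ (0 < lip_level m <= l)%N.
Proof.
move=> ml; rewrite /lip_level; case: pselect => [H|H]; last by case: H; exists l; exact/asboolP.
case: ex_minnP => n /asboolP mn nmin; split => //.
by rewrite -(ltr0n R) (cdf_lip_gt0 mn)/= nmin//; exact/asboolP.
Qed.

Lemma lip_level_le (n : nat) m : (0 < n)%N ->
  (0 < lip_level m <= n)%N <-> cdf_lip n%:R m.
Proof.
move=> n0; split=> [/andP[l0 ln]|/lip_levelP[]//].
move: l0 ln; rewrite /lip_level; case: pselect => // H.
case: ex_minnP => k /asboolP mk _ _ kn; apply: cdf_lip_mono mk.
by rewrite ler_nat.
Qed.

Lemma borel_lip_level (n : nat) : borel_P2 [set m : prob R | P2 m /\ lip_level m = n].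
Proof.
pose L k := [set m : prob R | P2 m /\ cdf_lip k%:R m].
have bL k : borel_P2 (L k) by exact: borel_cdf_lip.
pose U := P2 `\` (L n `&` (P2 `\` L n.-1)).
(* The sigma-algebra lives on [P2], so intersections come from De Morgan with complements taken
   inside [P2]. *)
have bI (A B : set (prob R)) : borel_P2 A -> borel_P2 B -> A `<=` P2 -> borel_P2 (A `&` B).
  move=> bA bB AP; have -> : A `&` B = P2 `\` \bigcup_i (if i is 0%N then P2 `\` A else P2 `\` B).
    apply/seteqP; split => m [mA].
      by move=> mB; split; [exact: AP|move=> [[|i] _ []]].
    move=> H; split.
      by apply: contrapT => mNA; apply: H; exists 0%N.
    by apply: contrapT => mNB; apply: H; exists 1%N.
  by apply: borel_P2C; apply: borel_P2_bigcup => -[|i]; exact: borel_P2C.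
have LP k : L k `<=` P2 by move=> m [].
case: n {U} => [|n].
  have -> : [set m : prob R | P2 m /\ lip_level m = 0%N] = P2 `\` \bigcup_i L i.
    apply/seteqP; split => m [m2 H]; split => //.
      by move=> [i _ [_ /lip_levelP[_]]]; rewrite H.
    apply/eqP; apply: contra_notT H; rewrite -lt0n => l0; exists (lip_level m) => //.
    by split => //; apply/lip_level_le => //; rewrite l0 leqnn.
  by apply: borel_P2C; exact: borel_P2_bigcup.
have -> : [set m : prob R | P2 m /\ lip_level m = n.+1] = L n.+1 `&` (P2 `\` L n).
  apply/seteqP; split => m /=.
    move=> [m2 H]; split; first by split => //; apply/lip_level_le => //; rewrite H/= leqnn.
    by split => // -[_ /lip_levelP[_]]; rewrite H ltnn.
  move=> [[m2 /lip_levelP[_ /andP[l0 ln]]] [_ H]]; split => //.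
  apply/eqP; rewrite eqn_leq ln/= ltnNge; apply/negP => ln'; apply: H; split => //.
  by apply/lip_level_le; rewrite ?l0// (leq_trans l0).
by apply: bI => //; exact: borel_P2C.
Qed.

(** A preimage is a countable union of level sets of [lip_level], so [g] may be arbitrary. This is
    why every prescribed parameter is a function of the level. *)
Lemma borel_rule_level d (T : measurableType d) (g : nat -> T) :
  borel_rule (g \o lip_level : prob R -> T).
Proof.
move=> B mB; rewrite (_ : _ `&` _ = \bigcup_n
  [set m : prob R | (P2 m /\ lip_level m = n) /\ B (g n)]).
  apply: borel_P2_bigcup => n; have [Bn|Bn] := pselect (B (g n)).
    rewrite (_ : [set _ | _] = [set m | P2 m /\ lip_level m = n]); first exact: borel_lip_level.
    by apply/seteqP; split => m //= [].
  by rewrite (_ : [set _ | _] = set0); [exact: borel_P20|apply/seteqP; split => // m []].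
apply/seteqP; split => m /=.
  by move=> [m2 Bm]; exists (lip_level m).
by move=> [n _ [[m2 <-]]].
Qed.

End lipschitz_level.

(** * Measurability of the estimators *)

Section adapted_estimators.
Context {R : realType} d (T : measurableType d).

Lemma measurable_fun_nat_index d' (T' : measurableType d') (M : T -> nat) (f : nat -> T -> T') :
  measurable_fun setT M -> (forall m, measurable_fun setT (f m)) ->
  measurable_fun setT (fun o => f (M o) o).
Proof.
move=> mM mf _ B mB; rewrite setTI.
rewrite (_ : _ @^-1` _ = \bigcup_m (M @^-1` [set m] `&` f m @^-1` B)).
  apply: bigcup_measurable => m _; apply: measurableI.
    by rewrite -[X in measurable X]setTI; exact: mM.
  by rewrite -[X in measurable X]setTI; exact: mf.
apply/seteqP; split => o /=; first by exists (M o).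
by move=> [m _ [/= ->]].
Qed.

Lemma measurable_kernel_cdf (kap : R -> R) (lo hi : R) (b : T -> R) (M : T -> nat)
    (X : nat -> T -> R) (x : T -> R) :
  is_kernel kap -> lo < hi -> (forall o, 0 < b o) -> (forall o, lo <= x o) ->
  measurable_fun setT b -> measurable_fun setT M ->
  (forall i, measurable_fun setT (X i)) -> measurable_fun setT x ->
  measurable_fun setT (fun o => kernel_cdf kap lo hi (b o) (M o) (X^~ o) (x o)).
Proof.
move=> kapK lohi b0 lox mb mM mX mx.
have mP : measurable_fun [set: measurableTypeR R] (kernel_primitive kap).
  by apply: continuous_measurable_fun; exact: kernel_primitive_continuous.
have mV (f : T -> R) : (forall o, 0 < f o) -> measurable_fun setT f ->
    measurable_fun setT (fun o => (f o)^-1).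
  move=> f0 mf; rewrite (_ : (fun o => (f o)^-1) = (@powR R ^~ (- 1)) \o f); last first.
    by apply/funext => o /=; rewrite powR_inv1// ltW.
  by apply: measurableT_comp mf; exact: measurable_powR.
have mPhi (y z : T -> R) : measurable_fun setT y -> measurable_fun setT z ->
    measurable_fun setT (fun o => kernel_primitive kap ((y o - z o) / b o)).
  move=> my mz; apply: (measurableT_comp mP); apply: measurable_funM.
    exact: measurable_funB.
  exact: mV.
rewrite (_ : (fun o => _) = (fun o => (M o)%:R^-1 *
    \sum_(i < M o) smooth_step kap lo hi (b o) (X i o) (x o))); last first.
  by apply/funext => o; rewrite kernel_cdfE.
apply: (measurable_fun_nat_index (f := fun m o => m%:R^-1 *
    \sum_(i < m) smooth_step kap lo hi (b o) (X i o) (x o)) mM) => m.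
apply: measurable_funM => //.
apply: (@measurable_sum _ T R setT _ _ (fun (i : 'I_m) o => smooth_step kap lo hi (b o) (X i o) (x o))) => i.
apply: measurable_funM; first by apply: measurable_funB; exact: mPhi.
by apply: mV; [move=> o; exact: smooth_mass_gt0|apply: measurable_funB; exact: mPhi].
Qed.

(** By [monotone_map_le] the sublevel set at [y] compares [G] at the moving point with [F] at the
    fixed [y]; for [y] outside the range the set is empty or everything. *)
Lemma measurable_monotone_map (lo hi lo' hi' : R) (G F : T -> R -> R) (x : T -> R) :
  lo < hi -> lo' < hi' ->
  (forall o, bilip_cdf lo hi (G o)) -> (forall o, bilip_cdf lo' hi' (F o)) ->
  measurable_fun setT (fun o => G o (clamp lo hi (x o))) ->
  (forall y, lo' <= y <= hi' -> measurable_fun setT (F ^~ y)) ->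
  measurable_fun setT (fun o => monotone_map lo hi lo' hi' (G o) (F o) (x o)).
Proof.
move=> lohi lohi' GP FP mG mF; apply: measurable_fun_leP => // y; rewrite setTI.
have [ylo|loy] := ltP y lo'.
  rewrite (_ : [set _ | _] = set0)//; apply/seteqP; split => // o /=.
  have /andP[h _] := monotone_map_in lohi lohi' (GP o) (FP o) (x o).
  by move=> /(le_trans h); rewrite leNgt ylo.
have [yhi|hiy] := leP y hi'; last first.
  rewrite (_ : [set _ | _] = setT)//; apply/seteqP; split => // o _ /=.
  have /andP[_ h] := monotone_map_in lohi lohi' (GP o) (FP o) (x o).
  exact: le_trans h (ltW hiy).
have yin : lo' <= y <= hi' by rewrite loy yhi.
rewrite (_ : [set _ | _] = [set o | G o (clamp lo hi (x o)) <= F o y]).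
  by apply: measurable_set_bool; apply: measurable_fun_ler => //; exact: mF.
apply/seteqP; split => o /=;
  by rewrite (monotone_map_clamp lohi lohi' (GP o) (FP o)) (monotone_map_le lohi' (GP o) (FP o))//
    clamp_in// ltW.
Qed.

End adapted_estimators.

(** * Borel measurability of maps into the functions of linear growth *)

Section borel_in_Clin.
Context {R : realType} d (T : measurableType d).
Variables (D : set T) (h : T -> R -> R) (lo hi : R).
Hypotheses (mD : measurable D) (lohi : lo < hi).
Hypothesis h_Clin : forall z, D z -> Clin (h z).
Hypothesis h_clamp : forall z x, D z -> h z x = h z (clamp lo hi x).
Hypothesis h_lip : forall z, D z -> exists C, 0 < C /\
  forall x y, x <= y -> 0 <= h z y - h z x <= C * (y - x).
Hypothesis mh : forall x, measurable_fun D (h^~ x).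

Let node (N j : nat) : R := lo + j%:R * ((hi - lo) / N%:R).

(** A code is a grid size [N] with integer labels: each node value is pinned to within [1/N] of
    label over [N]. Nodes run up to index [N + 1], one beyond [hi], so that [hi] also has a right
    neighbour. The codes are countable, unlike the balls of the space. *)
Let cell (c : nat * seq int) : set T :=
  \bigcap_j (D `&` [set z | (j < c.1.+2)%N ==>
    (`|h z (node c.1 j) - (nth 0 c.2 j)%:~R / c.1%:R| <= c.1%:R^-1)]).

Let mcell c : measurable (cell c).
Proof.
apply: bigcapT_measurable => j; case: ltnP => _ /=; last first.
  by rewrite (_ : [set z | true] = setT) ?setIT//; apply/seteqP; split.
have mf : measurable_fun D (fun z =>
    `|h z (node c.1 j) - (nth 0 c.2 j)%:~R / c.1%:R| <= c.1%:R^-1).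
  apply: measurable_fun_ler => //; apply: measurableT_comp => //.
  exact: measurable_funB.
by have := mf mD [set true]; exact.
Qed.

(* Monotone functions with a common modulus of continuity are uniformly close
   as soon as they are close on a fine grid; hence countably many grid
   conditions describe a norm-open set. *)
Let cell_close N v z z' (C : R) : (0 < N)%N ->
  (forall x y, x <= y -> 0 <= h z y - h z x <= C * (y - x)) ->
  cell (N, v) z -> cell (N, v) z' ->
  forall x, `|h z' x - h z x| <= (C * (hi - lo) + 2) / N%:R.
Proof.
move=> N0 Ch cz cz' x; have N0R : 0 < N%:R :> R by rewrite ltr0n.
have [Dz _] := cz 0%N I; have [Dz' _] := cz' 0%N I.
(* The constant of [z'] is not controlled by [C]; [h z'] is squeezed between its node values by
   monotonicity, and only [h z] contributes its modulus. *)
have [C' [C'0 Ch']] := h_lip Dz'.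
rewrite (h_clamp _ Dz) (h_clamp _ Dz').
have /andP[] := clamp_in x (ltW lohi); set y := clamp lo hi x => loy yhi.
pose s := (hi - lo) / N%:R.
have s0 : 0 < s by rewrite divr_gt0// subr_gt0.
pose j := Num.truncn ((y - lo) / s).
have ys0 : 0 <= (y - lo) / s by rewrite divr_ge0 ?subr_ge0 ?(ltW s0).
have jle : j%:R * s <= y - lo by rewrite -ler_pdivlMr// truncn_le.
have jgt : y - lo < j.+1%:R * s by rewrite -ltr_pdivrMr// truncnS_gt.
have jN : (j <= N)%N.
  rewrite -(ler_nat R) -(ler_pM2r s0) (le_trans jle)// /s mulrCA divff ?gt_eqF// mulr1.
  by rewrite lerD2r.
have nj : node N j <= y by rewrite /node -/s; lra.
have nj1 : y <= node N j.+1 by rewrite /node -/s; lra.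
have nn : node N j.+1 - node N j = s by rewrite /node -/s -natr1; ring.
have near_node i : (i < N.+2)%N -> `|h z' (node N i) - h z (node N i)| <= 2 / N%:R.
  move=> iN; have [_ /=] := cz i I; have [_ /=] := cz' i I; rewrite iN/=.
  move=> h1 h2; rewrite (_ : _ - _ = (h z' (node N i) - (nth 0 v i)%:~R / N%:R) -
    (h z (node N i) - (nth 0 v i)%:~R / N%:R)); last by ring.
  by rewrite (le_trans (ler_normB _ _))//; lra.
have /ler_normlP[a1 a2] := near_node j (leqW jN : (j < N.+2)%N).
have /ler_normlP[b1 b2] := near_node j.+1 (jN : (j.+1 < N.+2)%N).
have /andP[c1 c2] := Ch _ _ nj; have /andP[c3 c4] := Ch _ _ nj1.
have /andP[e1 _] := Ch' _ _ nj; have /andP[e3 _] := Ch' _ _ nj1.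
have -> : (C * (hi - lo) + 2) / N%:R = C * s + 2 / N%:R.
  by rewrite /s; field; rewrite gt_eqF.
have Cs : C * (y - node N j) + C * (node N j.+1 - y) = C * s by rewrite -nn; ring.
by apply/ler_normlP; split; lra.
Qed.

Let clin_open_measurable (U : set (R -> R)) : clin_open U -> measurable (D `&` h @^-1` U).
Proof.
move=> [UC oU].
(* The preimage of an open set is the union of the cells that it contains. *)
pose good c := cell c `<=` h @^-1` U.
rewrite (_ : _ `&` _ = \bigcup_i (if (unpickle i : option (nat * seq int)) is Some c then
   [set z | cell c z /\ good c] else set0)).
  apply: bigcupT_measurable => i; case: unpickle => // c.
  have [gc|gc] := pselect (good c).
    by rewrite (_ : [set _ | _] = cell c)//; apply/seteqP; split => z //= [].
  by rewrite (_ : [set _ | _] = set0)//; apply/seteqP; split => z //= [].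
apply/seteqP; split => z /=; last first.
  by move=> [i _]; case: unpickle => // c [cz gc]; split; [have [] := cz 0%N I|exact: gc].
move=> [Dz Uz]; have [e e0 He] := oU _ Uz; have [C [C0 HC]] := h_lip Dz.
pose A := C * (hi - lo) + 2.
have A0 : 0 < A by rewrite ltr_wpDl// mulr_ge0 ?(ltW C0)// subr_ge0 ltW.
pose N := (Num.truncn (A / e)).+1.
have N0R : 0 < N%:R :> R by rewrite ltr0n.
have Ne : A / N%:R < e.
  by rewrite ltr_pdivrMr// mulrC -ltr_pdivrMr// truncnS_gt.
(* Rounding [N * h] down at each node gives labels whose error is below [1/N]; [N] is so large that
   the whole cell stays within [e]. *)
pose v := mkseq (fun j => Num.floor (N%:R * h z (node N j))) N.+2.
have cz : cell (N, v) z.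
  move=> j _; split => //=; apply/implyP => jN; rewrite nth_mkseq//.
  have f1 : (Num.floor (N%:R * h z (node N j)))%:~R <= N%:R * h z (node N j).
    exact: Num.Theory.floor_le_tmp.
  have f2 : N%:R * h z (node N j) < (Num.floor (N%:R * h z (node N j)))%:~R + 1.
    by rewrite -intrD1; exact: Num.Theory.floorD1_gt.
  set F := (Num.floor _)%:~R in f1 f2 *.
  rewrite (_ : _ - _ = (N%:R * h z (node N j) - F) / N%:R); last first.
    by field; rewrite gt_eqF.
  rewrite normrM [X in _ * X]ger0_norm ?invr_ge0 ?(ltW N0R)// ler_piMl ?invr_ge0 ?(ltW N0R)//.
  by rewrite ger0_norm; lra.
exists (pickle (N, v)); [exact: I|rewrite pickleK; split => //].
move=> z' cz'; apply: He; first by apply: h_Clin; have [] := cz' 0%N I.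
have close := cell_close (ltn0Sn _) HC cz cz'.
apply: (@le_lt_trans _ _ (A / N%:R)%:E); last by rewrite lte_fin.
apply: ge_ereal_sup => _ [x _ <-]; rewrite lee_fin.
have x1 : 0 < 1 + `|x| by rewrite ltr_pwDl.
rewrite ler_pdivrMr// (le_trans (close x))// ler_peMr ?lerDl//.
by rewrite divr_ge0 ?(ltW A0).
Qed.

Lemma borel_Clin_preimage (U : set (R -> R)) : borel_Clin U -> measurable (D `&` h @^-1` U).
Proof.
move: U; apply: smallest_sub; last by move=> U; exact: clin_open_measurable.
split.
- by rewrite preimage_set0 setI0.
- move=> A mA; rewrite (_ : D `&` _ = D `\` (D `&` h @^-1` A)); first exact: measurableD.
  apply/seteqP; split => z /=; first by move=> [Dz [Cz nA]]; split => // -[].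
  by move=> [Dz H]; split => //; split; [exact: h_Clin|move=> Az; exact: H].
- move=> A mA; rewrite preimage_bigcup setI_bigcupr.
  by apply: bigcupT_measurable => i; exact: mA.
Qed.

End borel_in_Clin.

(** * The Borel map behind the estimator *)

Section estimator_map.
Context {R : realType}.
Variables (lo hi lo' hi' : R) (kap kap' : R -> R).
Hypotheses (kapK : is_kernel kap) (kapK' : is_kernel kap') (lohi : lo < hi) (lohi' : lo' < hi').
Variables m n : nat.
Hypotheses (m0 : (0 < m)%N) (n0 : (0 < n)%N).

Local Notation input := ((m + n).-tuple (measurableTypeR R) *
  (measurableTypeR R * measurableTypeR R))%type.

Definition estimator_map (z : input) : R -> R :=
  monotone_map lo hi lo' hi'
    (kernel_cdf kap lo hi z.2.1 m (fun i => nth 0 z.1 i))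
    (kernel_cdf kap' lo' hi' z.2.2 n (fun j => nth 0 z.1 (m + j))).

Let D : set input := [set z | 0 < z.2.1 /\ 0 < z.2.2].

Let GP z : D z -> bilip_cdf lo hi (kernel_cdf kap lo hi z.2.1 m (fun i => nth 0 z.1 i)).
Proof. by move=> [b0 _]; exact: kernel_cdf_bilip. Qed.

Let FP z : D z -> bilip_cdf lo' hi' (kernel_cdf kap' lo' hi' z.2.2 n (fun j => nth 0 z.1 (m + j))).
Proof. by move=> [_ b0]; exact: kernel_cdf_bilip. Qed.

Lemma estimator_map_Clin z : D z -> Clin (estimator_map z).
Proof. by move=> Dz; apply: monotone_map_Clin => //; [exact: GP|exact: FP]. Qed.

Lemma estimator_map_borel U : borel_Clin U -> measurable (D `&` estimator_map @^-1` U).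
Proof.
have mb1 : measurable_fun setT (fun z : input => z.2.1) by do 2 apply: measurableT_comp => //.
have mb2 : measurable_fun setT (fun z : input => z.2.2) by do 2 apply: measurableT_comp => //.
have mD : measurable D.
  rewrite (_ : D = [set z | (0 < z.2.1) && (0 < z.2.2)]).
    by apply: measurable_set_bool; apply: measurable_and; exact: measurable_fun_ltr.
  by apply/seteqP; split => z /andP.
apply: (borel_Clin_preimage mD lohi) => //.
- exact: estimator_map_Clin.
- by move=> z x Dz; apply: monotone_map_clamp => //; [exact: GP|exact: FP].
- move=> z Dz; have [_ [C [_ C0 _ H]]] := monotone_map_bilip lohi lohi' (GP Dz) (FP Dz).
  by exists C.
move=> x.
(* Bandwidths are replaced by 1 where they are not positive, so that measurability holds on the
   whole space and is then restricted to [D]. *)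
pose b1 (z : input) := if 0 < z.2.1 then z.2.1 else 1.
pose b2 (z : input) := if 0 < z.2.2 then z.2.2 else 1.
have b10 z : 0 < b1 z by rewrite /b1; case: ifPn.
have b20 z : 0 < b2 z by rewrite /b2; case: ifPn.
have mb1' : measurable_fun setT b1 by apply: measurable_fun_ifT => //; exact: measurable_fun_ltr.
have mb2' : measurable_fun setT b2 by apply: measurable_fun_ifT => //; exact: measurable_fun_ltr.
have mnth i : measurable_fun setT (fun z : input => (nth 0 z.1 i : measurableTypeR R)).
  have [im|im] := ltnP i (m + n); last first.
    rewrite (_ : (fun _ => _) = cst 0)//; apply/funext => z.
    by rewrite nth_default// size_tuple.
  rewrite (_ : (fun _ => _) = (fun z : input => tnth z.1 (Ordinal im))).
    exact: (measurableT_comp (measurable_tnth (Ordinal im)) measurable_fst).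
  by apply/funext => z; rewrite (tnth_nth 0).
have H : measurable_fun setT (fun z : input => monotone_map lo hi lo' hi'
    (kernel_cdf kap lo hi (b1 z) m (fun i => nth 0 z.1 i))
    (kernel_cdf kap' lo' hi' (b2 z) n (fun j => nth 0 z.1 (m + j))) x).
  apply: (measurable_monotone_map (x := fun=> x)) => //.
  - by move=> z; exact: kernel_cdf_bilip.
  - by move=> z; exact: kernel_cdf_bilip.
  - apply: (measurable_kernel_cdf (b := b1) (M := fun=> m) (X := fun i z => nth 0 z.1 i)
      (x := fun=> clamp lo hi x)) => //.
    by move=> z; have /andP[] := clamp_in x (ltW lohi).
  - move=> y /andP[loy _].
    apply: (measurable_kernel_cdf (b := b2) (M := fun=> n) (X := fun j z => nth 0 z.1 (m + j))
      (x := fun=> y)) => // j.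
    exact: mnth.
apply: (eq_measurable_fun _ _ (measurable_funTS H)) => z; rewrite inE => -[z1 z2].
by rewrite /estimator_map /b1 /b2 z1 z2.
Qed.

End estimator_map.

(** * The filtration of the scheme *)

Section filtration.
Context {R : realType} {K : nat} d (Omega : measurableType d) (s : run R K d Omega).
Hypothesis s_adapted : forall t k, adapted s t (numX s t k) /\ adapted s t (numY s t k).

Local Notation filt_type t := (g_sigma_algebraType (filt s t)).

Lemma filt_sigma_algebra t : sigma_algebra setT (filt s t).
Proof.
case: t => [|t]; last exact: smallest_sigma_algebra.
split => /=; first by left.
  by move=> A [->|->]; [right; rewrite setD0|left; rewrite setDT].
move=> F HF; have [[i Fi]|H] := pselect (exists i, F i = setT).
  by right; apply/seteqP; split => // o _; exists i => //; rewrite Fi.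
left; apply/seteqP; split => // o [i _]; case: (HF i) => [->//|Fi _].
by case: H; exists i.
Qed.

Lemma filtE t : <<s filt s t>> = filt s t.
Proof. exact: sigma_algebra_id (filt_sigma_algebra t). Qed.

Lemma measurable_filtE t (A : set (filt_type t)) : measurable A = filt s t A.
Proof. by rewrite -[in RHS]filtE. Qed.

Lemma filt_mono t : filt s t `<=` filt s t.+1.
Proof. by move=> A At; apply: sub_gen_smallest; left. Qed.

Lemma filt_measurable t : filt s t `<=` measurable.
Proof.
elim: t => [A [->|->]//|t IH]; apply: smallest_sub; first exact: sigma_algebra_measurable.
move=> A [/IH//|[k [i [B [mB]]]]] /=.
have mI (N : Omega -> nat) (X : {mfun Omega >-> measurableTypeR R}) : adapted s t N ->
    measurable [set o | (i < N o)%N /\ B (X o)].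
  move=> aN; rewrite (_ : [set _ | _] = N @^-1` [set n | (i < n)%N] `&` X @^-1` B); last first.
    by apply/seteqP; split.
  by apply: measurableI; [exact: IH (aN _ _)|rewrite -[X in measurable X]setTI; exact: measurable_funPT].
by have [aX aY] := s_adapted t k; move=> [->|->]; exact: mI.
Qed.

Lemma adapted_measurable_fun t dT (T : measurableType dT) (f : Omega -> T) :
  adapted s t f -> measurable_fun [set: filt_type t] (f : filt_type t -> T).
Proof. by move=> H _ B mB; rewrite setTI measurable_filtE; exact: H. Qed.

Lemma measurable_filt_mono t dT (T : measurableType dT) (f : Omega -> T) :
  measurable_fun [set: filt_type t] (f : filt_type t -> T) ->
  measurable_fun [set: filt_type t.+1] (f : filt_type t.+1 -> T).
Proof.
move=> H _ B mB; rewrite setTI measurable_filtE; apply: filt_mono; rewrite -measurable_filtE.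
by have := H measurableT B mB; rewrite setTI.
Qed.

Lemma measurable_filt t dT (T : measurableType dT) (f : Omega -> T) :
  measurable_fun [set: filt_type t] (f : filt_type t -> T) -> measurable_fun [set: Omega] f.
Proof.
move=> H _ B mB; rewrite setTI; apply: (@filt_measurable t); rewrite -measurable_filtE.
by have := H measurableT B mB; rewrite setTI.
Qed.

(** Only the drawn samples are revealed by the filtration; the others are replaced by 0, which makes
    every index measurable at the next time. *)
Definition sample_if (N : Omega -> nat) (X : nat -> {mfun Omega >-> measurableTypeR R})
    (i : nat) (o : Omega) : R := if (i < N o)%N then X i o else 0.

Let measurable_sample_if t (N : Omega -> nat) (X : nat -> {mfun Omega >-> measurableTypeR R}) i :
  adapted s t N ->
  (forall B : set (measurableTypeR R), measurable B ->
    filt s t.+1 [set o | (i < N o)%N /\ B (X i o)]) ->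
  measurable_fun [set: filt_type t.+1] (sample_if N X i : filt_type t.+1 -> measurableTypeR R).
Proof.
move=> aN drawnX _ B mB; rewrite setTI.
have mN (A : set nat) : measurable (N @^-1` A : set (filt_type t.+1)).
  by rewrite measurable_filtE; apply: filt_mono; exact: aN.
rewrite (_ : _ @^-1` _ = [set o | (i < N o)%N /\ B (X i o)] `|`
    N @^-1` [set n | (n <= i)%N /\ B 0]).
  by apply: measurableU => //; rewrite measurable_filtE; exact: drawnX.
apply/seteqP; split => o /=; rewrite /sample_if; case: ltnP => //.
- by move=> ? ?; left.
- by move=> ? ?; right.
- by move=> ? [[]|[]].
- by move=> ? [[]|[]].
Qed.

Lemma measurable_sampleX t k i : measurable_fun [set: filt_type t.+1]
  (sample_if (numX s t k) (smpX s t.+1 k) i : filt_type t.+1 -> measurableTypeR R).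
Proof.
apply: measurable_sample_if; first by have [] := s_adapted t k.
by move=> B mB; apply: sub_gen_smallest; right; exists k, i, B; split => //; left.
Qed.

Lemma measurable_sampleY t k i : measurable_fun [set: filt_type t.+1]
  (sample_if (numY s t k) (smpY s t.+1 k) i : filt_type t.+1 -> measurableTypeR R).
Proof.
apply: measurable_sample_if; first by have [] := s_adapted t k.
by move=> B mB; apply: sub_gen_smallest; right; exists k, i, B; split => //; right.
Qed.

End filtration.

Lemma kernel_cdf_eq (R : realType) (kap : R -> R) lo hi b n (xs ys : nat -> R) :
  (forall i, (i < n)%N -> xs i = ys i) ->
  kernel_cdf kap lo hi b n xs = kernel_cdf kap lo hi b n ys.
Proof.
move=> H; apply/funext => x; rewrite /kernel_cdf; congr (_ * _).
by apply: eq_bigr => i _; rewrite H.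
Qed.

(** A continuous nondecreasing map preserves monotonicity and left continuity, so its composite with
    a quantile is again a quantile function, namely that of the image. *)
Lemma quantile_push (R : realType) (m n : prob R) (S : measurableTypeR R -> measurableTypeR R) :
  continuous (S : R -> R) -> {homo (S : R -> R) : x y / x <= y} ->
  meas_eq n (pushforward m S) -> forall u, 0 < u < 1 -> quantile n u = S (quantile m u).
Proof.
move=> cS Snd nE u u01.
have mS : measurable_fun [set: measurableTypeR R] S by exact: continuous_measurable_fun.
have mq : measurable_fun setT
    (S \o quantile m : measurableTypeR R -> measurableTypeR R).
  by apply: measurableT_comp mS _; exact: measurable_quantile.
rewrite -[RHS](quantile_law mq)//; last by apply: quantile_like_comp => //; exact: quantile_likeP.
congr (_ u); apply: quantile_meas_eq => A mA; rewrite nE//.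
have mSA : measurable (S @^-1` A) by rewrite -[X in measurable X]setTI; exact: mS.
by rewrite /pushforward (quantile_prob m mSA).
Qed.

Lemma measurable_quantile_snd (R : realType) dT (T : measurableType dT) (m : prob R) :
  measurable_fun [set: (T * measurableTypeR R)%type]
    (fun z : T * measurableTypeR R => quantile m z.2).
Proof. exact: (measurableT_comp (measurable_quantile m) measurable_snd). Qed.

(** * Conditional variance of empirical distribution functions *)

Section sampling.
Context {R : realType} d (Omega : measurableType d) (P : probability Omega R).

(** Reduces a bound on an event to its slices along a discrete variable; it serves both to freeze
    [H] and to freeze the Lipschitz level. *)
Lemma integral_le_pieces (N : Omega -> nat) (A : set Omega) (f : Omega -> \bar R) (c : R) :
  measurable A -> (forall n, measurable (N @^-1` [set n])) -> 0 <= c ->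
  measurable_fun setT f -> (forall o, 0 <= f o)%E ->
  (forall n, \int[P]_(o in A `&` N @^-1` [set n]) f o <= c%:E * P (A `&` N @^-1` [set n]))%E ->
  (\int[P]_(o in A) f o <= c%:E * P A)%E.
Proof.
move=> mA mN c0 mf f0 H.
pose F n := A `&` N @^-1` [set n].
have mF n : measurable (F n) by exact: measurableI.
have tF : trivIset setT F.
  by apply/trivIsetP => i j _ _ ij; apply/seteqP; split => // o [[_ /= Ni] [_ /= Nj]];
    rewrite -Ni -Nj eqxx in ij.
have AE : A = \bigcup_n F n.
  by apply/seteqP; split => [ o Ao| o]; [exists (N o)|move=> [n _ []]].
rewrite AE ge0_integral_bigcup//; last exact: measurable_funTS.
rewrite measure_bigcup// -nneseriesZl//.
rewrite [leRHS](eq_eseriesl (Q := xpredT)); last first.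
  by move=> k; rewrite mem_set.
by apply: lee_nneseries => [n _ _|n _]; [exact: integral_ge0|exact: H].
Qed.

Section deviation.
Variables (n : nat) (X : nat -> Omega -> R) (H : Omega -> R) (x : R).
Hypotheses (n_gt0 : (0 < n)%N) (mX : forall i, measurable_fun setT (X i)).
Hypotheses (mH : measurable_fun setT H) (H01 : forall o, 0 <= H o <= 1).

(** Expansion of the square around a constant [c] close to [H] on [D]: the diagonal terms give the
    first moment of [H], the off-diagonal ones the second. *)
Let dev_pos (D : set Omega) (c : R) : measurable D -> 0 <= c ->
  (forall o, D o -> `|H o - c| <= n%:R^-1) ->
  (forall i, (i < n)%N -> P (D `&` [set o | (X i o <= x)%R]) = \int[P]_(o in D) (H o)%:E)%E ->
  (forall i j, (i < n)%N -> (j < n)%N -> i != j ->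
     P (D `&` [set o | (X i o <= x)%R /\ (X j o <= x)%R]) = \int[P]_(o in D) (H o ^+ 2)%:E)%E ->
  (\int[P]_(o in D) ((ecdf n (X ^~ o) x - c) ^+ 2)%:E <= (2 / n%:R)%:E * P D)%E.
Proof.
move=> mD c0 Hc one two.
have n0R : 0 < n%:R :> R by rewrite ltr0n.
have mHD (k : nat) : measurable_fun D (fun o => (H o ^+ k)%:E).
  by apply: measurable_funTS; apply/measurable_EFinP; exact: measurable_funX.
have H0 o : 0 <= H o by have /andP[] := H01 o.
have pfin : P D = (fine (P D))%:E by rewrite fineK// fin_num_measure.
have hfin k : (\int[P]_(o in D) (H o ^+ k)%:E = (fine (\int[P]_(o in D) (H o ^+ k)%:E))%:E)%E.
  rewrite fineK// ge0_fin_numE; last by apply: integral_ge0 => o _; rewrite lee_fin exprn_ge0.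
  apply: (@le_lt_trans _ _ (\int[P]_(o in D) (cst 1%E o : \bar R))%E).
    apply: ge0_le_integral => //; first by move=> o _; rewrite lee_fin exprn_ge0.
    by move=> o _; rewrite lee_fin exprn_ile1//; have /andP[] := H01 o.
  by rewrite integral_cst// mul1e -ge0_fin_numE// fin_num_measure.
set p := fine (P D) in pfin.
have icst (r : R) : (\int[P]_(o in D) r%:E = (r * p)%:E)%E.
  by rewrite integral_cst//; transitivity (r%:E * P D)%E => //; rewrite pfin.
have hfin1 : (\int[P]_(o in D) (H o)%:E = (fine (\int[P]_(o in D) (H o ^+ 1)%:E))%:E)%E := hfin 1%N.
set h1 := fine _ in hfin1.
have hfin2 := hfin 2%N; set h2 := fine _ in hfin2.
pose b i o : R := (X i o <= x)%R%:R.
have b0 i o : 0 <= b i o by rewrite /b ler0n.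
have mb i : measurable_fun setT (b i).
  by apply/measurable_EFinP; apply: (measurable_bool_EFin (R := R)); exact: measurable_fun_ler.
have ib (i j : 'I_n) : (\int[P]_(o in D) (b i o * b j o)%:E =
    (h2 + (i == j)%:R * (h1 - h2))%:E)%E.
  have bb o : (b i o * b j o)%:E = (\1_[set o | (X i o <= x) && (X j o <= x)] o : R)%:E.
    rewrite indicE /b -natrM mulnb; congr ((nat_of_bool _)%:R%:E).
    by apply/idP/idP; rewrite inE.
  have mS : measurable [set o | (X i o <= x) && (X j o <= x)].
    by apply: measurable_set_bool; apply: measurable_and; exact: measurable_fun_ler.
  under eq_integral do rewrite bb.
  rewrite integral_indic//; have [ij|ij] := eqVneq i j.
    rewrite mul1r addrC subrK -hfin1 -(one i)// setIC ij; congr (P (_ `&` _)).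
    by apply/seteqP; split => o /=; [case/andP|move=> ->].
  rewrite mul0r addr0 -hfin2 -(two i j)// setIC; congr (P (_ `&` _)).
  by apply/seteqP; split => o /= /andP.
pose S o := \sum_(i < n) b i o.
have mS : measurable_fun setT S.
  exact: (@measurable_sum _ Omega R setT _ _ (fun (i : 'I_n) => b i)).
have S0 o : 0 <= S o by apply: sumr_ge0.
have iS : (\int[P]_(o in D) (S o)%:E = (n%:R * h1)%:E)%E.
  under eq_integral do rewrite /S -sumEFin.
  rewrite ge0_integral_sum//; last 2 first.
  - by move=> i; apply: measurable_funTS; exact/measurable_EFinP.
  - by move=> i o _; rewrite lee_fin.
  transitivity (\sum_(i < n) h1%:E)%E.
    apply: eq_bigr => i _; transitivity (\int[P]_(o in D) (b i o * b i o)%:E)%E.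
      by apply: eq_integral => o _; rewrite /b -natrM mulnb andbb.
    by rewrite ib eqxx mul1r addrC subrK.
  by rewrite sumEFin sumr_const card_ord -[RHS]/(_%:E) mulr_natl.
have iS2 : (\int[P]_(o in D) (S o ^+ 2)%:E = (n%:R * h1 + (n%:R ^+ 2 - n%:R) * h2)%:E)%E.
  transitivity (\int[P]_(o in D) (\sum_(i < n) \sum_(j < n) (b i o * b j o)%:E))%E.
    apply: eq_integral => o _; rewrite expr2 /S mulr_suml -sumEFin.
    by apply: eq_bigr => i _; rewrite mulr_sumr -sumEFin.
  rewrite ge0_integral_sum//; last 2 first.
  - move=> i; apply: emeasurable_sum => j; apply: measurable_funTS; apply/measurable_EFinP.
    exact: measurable_funM.
  - by move=> i o _; apply: sume_ge0 => j _; rewrite lee_fin mulr_ge0.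
  transitivity (\sum_(i < n) (n%:R * h2 + (h1 - h2))%:E)%E.
    apply: eq_bigr => i _; rewrite ge0_integral_sum//; last 2 first.
    - by move=> j; apply: measurable_funTS; apply/measurable_EFinP; exact: measurable_funM.
    - by move=> j o _; rewrite lee_fin mulr_ge0.
    under eq_bigr do rewrite ib.
    rewrite sumEFin big_split/= sumr_const card_ord -mulr_suml.
    rewrite (bigD1 i)//= eqxx big1 ?addr0 ?mul1r ?mulr_natl// => j /negbTE ji.
    by rewrite eq_sym ji.
  by rewrite sumEFin sumr_const card_ord -[_ *+ n]mulr_natl; congr EFin; ring.
set Q := (\int[P]_(o in D) _)%E.
(* The cross term is moved to the side of [Q], so that all integrands stay nonnegative. *)
have key : (Q + (2 * c * h1)%:E = (n%:R^-1 * h1 + (1 - n%:R^-1) * h2 + c ^+ 2 * p)%:E)%E.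
  transitivity (\int[P]_(o in D) (((n%:R^-1 * S o - c) ^+ 2)%:E +
      (2 * c * n%:R^-1 * S o)%:E))%E.
    rewrite ge0_integralD//; last 4 first.
    - by move=> o _; rewrite lee_fin sqr_ge0.
    - apply: measurable_funTS; apply/measurable_EFinP; apply: measurable_funX.
      by apply: measurable_funB => //; exact: measurable_funM.
    - by move=> o _; rewrite lee_fin !mulr_ge0// invr_ge0.
    - by apply: measurable_funTS; apply/measurable_EFinP; exact: measurable_funM.
    congr (_ + _)%E; under [RHS]eq_integral do rewrite EFinM.
    rewrite ge0_integralZl//; last 3 first.
    - by apply: measurable_funTS; exact/measurable_EFinP.
    - by move=> o _; rewrite lee_fin.
    - by rewrite lee_fin !mulr_ge0// invr_ge0.
    by rewrite iS -EFinM; congr EFin; field; rewrite gt_eqF.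
  transitivity (\int[P]_(o in D) ((n%:R ^- 2 * S o ^+ 2)%:E + (c ^+ 2)%:E))%E.
    apply: eq_integral => o _; rewrite -!EFinD; congr EFin.
    by field; rewrite gt_eqF.
  rewrite ge0_integralD//; last 3 first.
  - by move=> o _; rewrite lee_fin mulr_ge0 ?sqr_ge0// invr_ge0 sqr_ge0.
  - by apply: measurable_funTS; apply/measurable_EFinP; apply: measurable_funM => //; exact: measurable_funX.
  - by move=> o _; rewrite lee_fin sqr_ge0.
  under eq_integral do rewrite EFinM.
  rewrite ge0_integralZl//; last 2 first.
  - by apply: measurable_funTS; apply/measurable_EFinP; exact: measurable_funX.
  - by move=> o _; rewrite lee_fin sqr_ge0.
  rewrite iS2 icst -!EFinM -EFinD; congr EFin; field.
  by rewrite gt_eqF.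
(* Pointwise this says that [(H - H^2) / n + (H - c)^2] is at most [2 / n]. *)
have bound : n%:R^-1 * h1 + (1 - n%:R^-1) * h2 + c ^+ 2 * p <= 2 * c * h1 + 2 / n%:R * p.
  have lin (a a' e : R) : 0 <= a -> 0 <= a' -> 0 <= e ->
      (\int[P]_(o in D) (a * H o + a' * H o ^+ 2 + e)%:E = (a * h1 + a' * h2 + e * p)%:E)%E.
    move=> a0 a'0 e0; have mZ (k : nat) (r : R) : measurable_fun D (fun o => (r * H o ^+ k)%:E).
      apply: measurable_funTS; apply/measurable_EFinP; apply: measurable_funM => //.
      exact: measurable_funX.
    have intZ (k : nat) (r : R) : 0 <= r ->
        (\int[P]_(o in D) (r * H o ^+ k)%:E = r%:E * \int[P]_(o in D) (H o ^+ k)%:E)%E.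
      move=> r0; under eq_integral do rewrite EFinM.
      by rewrite ge0_integralZl// => o _; rewrite lee_fin exprn_ge0.
    under eq_integral do rewrite EFinD EFinD.
    have m1 := mZ 1%N a.
    have a1 o : D o -> (0 <= (a * H o)%:E)%E by move=> _; rewrite lee_fin mulr_ge0.
    have a2 o : D o -> (0 <= (a' * H o ^+ 2)%:E)%E by move=> _; rewrite lee_fin mulr_ge0 ?sqr_ge0.
    have m2 := mZ 2%N a'.
    rewrite (ge0_integralD P mD (fun o Do => adde_ge0 (a1 o Do) (a2 o Do))
      (emeasurable_funD m1 m2)) ?(ge0_integralD P mD a1 m1 a2 m2)//.
    rewrite (intZ 1%N a a0) (intZ 2%N a' a'0) (hfin 1%N) hfin2 icst.
    by rewrite -!EFinM -!EFinD.
  have n1 : n%:R^-1 <= 1 :> R by rewrite invf_le1// ler1n.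
  have ni0 : 0 <= n%:R^-1 :> R by rewrite invr_ge0 ltW.
  rewrite (_ : 2 * c * h1 + _ = 2 * c * h1 + 0 * h2 + 2 / n%:R * p); last by ring.
  rewrite -lee_fin -!lin ?mulr_ge0 ?sqr_ge0 ?subr_ge0//.
  have mlin (a a' e : R) : measurable_fun D (fun o => (a * H o + a' * H o ^+ 2 + e)%:E).
    apply: measurable_funTS; apply/measurable_EFinP; apply: measurable_funD => //.
    by apply: measurable_funD; apply: measurable_funM => //; exact: measurable_funX.
  apply: ge0_le_integral => //.
    by move=> o _; rewrite lee_fin !addr_ge0 ?mulr_ge0 ?sqr_ge0 ?subr_ge0.
  move=> o Do; rewrite lee_fin.
  have hc : (H o - c) ^+ 2 <= n%:R^-1 ^+ 2.
    by rewrite -[leLHS]real_normK ?num_real// ler_sqr ?nnegrE// Hc.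
  have : n%:R^-1 ^+ 2 <= n%:R^-1 :> R by rewrite expr2 ler_piMr.
  have /andP[_ H1] := H01 o.
  have : n%:R^-1 * (H o - H o ^+ 2) <= n%:R^-1.
    by rewrite ler_piMr// lerBlDr (le_trans H1)// lerDl sqr_ge0.
  move: hc; set y := n%:R^-1; set h := H o; clearbody y h => hc hy hh; nra.
rewrite -(@leeD2rE _ (2 * c * h1)%:E)// key pfin -EFinM -EFinD lee_fin.
by rewrite [leRHS]addrC.
Qed.

(* Conditional independence is only available on events, so [H] is frozen to
   within [n%:R^-1] on the slices where [n%:R * H] has a given integer part. *)
Lemma sampling_variance (E : set Omega) : measurable E ->
  (forall (q i : nat), (i < n)%N ->
     let D := E `&` (fun o => Num.truncn (n%:R * H o)) @^-1` [set q] in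
     P (D `&` [set o | (X i o <= x)%R]) = \int[P]_(o in D) (H o)%:E)%E ->
  (forall (q i j : nat), (i < n)%N -> (j < n)%N -> i != j ->
     let D := E `&` (fun o => Num.truncn (n%:R * H o)) @^-1` [set q] in
     P (D `&` [set o | (X i o <= x)%R /\ (X j o <= x)%R]) = \int[P]_(o in D) (H o ^+ 2)%:E)%E ->
  (\int[P]_(o in E) ((ecdf n (X ^~ o) x - H o) ^+ 2)%:E <= (6 / n%:R)%:E * P E)%E.
Proof.
move=> mE one two.
have n0R : 0 < n%:R :> R by rewrite ltr0n.
have ni0 : 0 <= n%:R^-1 :> R by rewrite invr_ge0 ltW.
have mT q : measurable ((fun o => Num.truncn (n%:R * H o)) @^-1` [set q]).
  rewrite (_ : _ @^-1` _ = [set o | (q%:R <= n%:R * H o) && (n%:R * H o < q.+1%:R)]).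
    apply: measurable_set_bool; apply: measurable_and.
      by apply: measurable_fun_ler => //; exact: measurable_funM.
    by apply: measurable_fun_ltr => //; exact: measurable_funM.
  apply/seteqP; split => o /=;
    have H0 : 0 <= n%:R * H o by rewrite mulr_ge0 ?(ltW n0R)//; have /andP[] := H01 o.
    by move=> <-; exact: truncn_itv.
  by move=> Hq; apply/eqP; rewrite truncn_eq.
have mec : measurable_fun setT (fun o => ecdf n (X ^~ o) x).
  apply: measurable_funM => //.
  apply: (@measurable_sum _ Omega R setT _ _ (fun (i : 'I_n) o => (X i o <= x)%R%:R)) => i.
  by apply/measurable_EFinP; apply: (measurable_bool_EFin (R := R)); exact: measurable_fun_ler.
apply: (integral_le_pieces (N := fun o => Num.truncn (n%:R * H o))) => //.
- by apply/measurable_EFinP; apply: measurable_funX; exact: measurable_funB.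
- by move=> o; rewrite lee_fin sqr_ge0.
move=> q; set D := _ `&` _; pose c : R := q%:R / n%:R.
have mD : measurable D by exact: measurableI.
have c0 : 0 <= c by rewrite divr_ge0// ltW.
have Hc o : D o -> `|H o - c| <= n%:R^-1.
  move=> [_ /= Tq]; have H0 : 0 <= n%:R * H o by rewrite mulr_ge0 ?(ltW n0R)//; have /andP[] := H01 o.
  have h1 : q%:R <= n%:R * H o by rewrite -Tq truncn_le.
  have h2 : n%:R * H o < q.+1%:R by rewrite -Tq truncnS_gt.
  rewrite (_ : H o - c = (n%:R * H o - q%:R) / n%:R); last by rewrite /c; field; rewrite gt_eqF.
  rewrite ger0_norm; last by rewrite divr_ge0 ?subr_ge0// ltW.
  by rewrite ler_piMl// lerBlDr addrC natr1 ltW.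
have B := dev_pos mD c0 Hc (one q) (two q).
(* Going back from [c] to [H] doubles the bound [2 / n] and adds another [2 / n], whence the
   constant 6. *)
apply: (@le_trans _ _ (\int[P]_(o in D) (2%:E * ((ecdf n (X ^~ o) x - c) ^+ 2)%:E +
   (2 / n%:R)%:E))%E).
  apply: ge0_le_integral => //.
  - by move=> o _; rewrite lee_fin sqr_ge0.
  - apply: measurable_funTS; apply/measurable_EFinP; apply: measurable_funX.
    exact: measurable_funB.
  - apply: measurable_funTS; apply/measurable_EFinP; apply: measurable_funD => //.
    apply: measurable_funM => //; apply: measurable_funX; exact: measurable_funB.
  move=> o Do; rewrite -EFinM -EFinD lee_fin.
  have hc : (H o - c) ^+ 2 <= n%:R^-1 ^+ 2.
    by rewrite -[leLHS]real_normK ?num_real// ler_sqr ?nnegrE// Hc.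
  have n1 : n%:R^-1 <= 1 :> R by rewrite invf_le1// ler1n.
  have : n%:R^-1 ^+ 2 <= n%:R^-1 :> R by rewrite expr2 ler_piMr.
  have : 0 <= (ecdf n (X ^~ o) x - c + (H o - c)) ^+ 2 by exact: sqr_ge0.
  move: hc; set a := ecdf _ _ _; set y := n%:R^-1; set h := H o; nra.
rewrite ge0_integralD//; last 2 first.
- by move=> o _; rewrite -EFinM lee_fin mulr_ge0// sqr_ge0.
- apply: measurable_funTS; apply/measurable_EFinP; apply: measurable_funM => //.
  apply: measurable_funX; exact: measurable_funB.
rewrite ge0_integralZl//; last 2 first.
- by apply: measurable_funTS; apply/measurable_EFinP; apply: measurable_funX; exact: measurable_funB.
- by move=> o _; rewrite lee_fin sqr_ge0.
rewrite integral_cst//.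
apply: (@le_trans _ _ (2%:E * ((2 / n%:R)%:E * P D) + (2 / n%:R)%:E * P D)%E).
  by rewrite leeD2r// lee_wpmul2l.
have -> : P D = (fine (P D))%:E by rewrite fineK// fin_num_measure.
by rewrite -!EFinM -EFinD lee_fin le_eqVlt; apply/orP; left; apply/eqP; ring.
Qed.

End deviation.
End sampling.

Section conditional_sampling.
Context {R : realType} d (Omega : measurableType d) (P : probability Omega R).
Variables (G : set (set Omega)) (m : nat) (X : nat -> {mfun Omega >-> measurableTypeR R}).
Variables (mu : Omega -> prob R) (E : set Omega).
Hypotheses (G_measurable : G `<=` measurable) (GE : G E) (m_gt0 : (0 < m)%N).
Hypothesis mu_cdf : forall x, measurable_fun setT (fun o => cdfr (mu o) x).
Hypothesis G_bin : forall q x,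
  G (E `&` (fun o => Num.truncn (m%:R * cdfr (mu o) x)) @^-1` [set q]).
Hypothesis X_indep : forall (D : set Omega) (A : nat -> set (measurableTypeR R)),
  G D -> D `<=` E -> (forall i, measurable (A i)) ->
  P (D `&` [set o | forall i, (i < m)%N -> A i (X i o)]) =
  (\int[P]_(o in D) (\prod_(i < m) fine (mu o (A i)))%:E)%E.

Lemma ecdf_variance x :
  (\int[P]_(o in E) ((ecdf m (fun i => X i o) x - cdfr (mu o) x) ^+ 2)%:E <=
   (6 / m%:R)%:E * P E)%E.
Proof.
have fT o : fine (mu o setT) = 1 by rewrite probability_setT.
(* Only the samples selected by [p] are constrained; one or two selected indices extract the
   marginal and pair probabilities from the product formula. *)
pose A (p : pred nat) (i : nat) : set (measurableTypeR R) :=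
  if p i then `]-oo, x]%classic else setT.
have mA p i : measurable (A p i) by rewrite /A; case: ifP.
apply: (sampling_variance (X := fun i o => X i o) (H := fun o => cdfr (mu o) x)) => //.
- by move=> i; exact: (@measurable_funPT _ _ _ _ (X i)).
- by move=> o; rewrite cdfr_ge0 cdfr_le1.
- exact: G_measurable.
- move=> q i im D; have GD : G D by exact: G_bin.
  have DE : D `<=` E by move=> o [].
  rewrite (_ : _ `&` _ = D `&` [set o | forall i', (i' < m)%N -> A (pred1 i) i' (X i' o)]).
    rewrite X_indep//; apply: eq_integral => o _; congr EFin.
    rewrite (bigD1 (Ordinal im))//= {1}/A/= eqxx big1 ?mulr1// => j.
    by rewrite -val_eqE/= /A => /negbTE/= ->; rewrite fT.
  apply/seteqP; split => o [Do /= H]; split => //.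
    by move=> i' _; rewrite /A/=; case: eqP => // ->; rewrite /= in_itv.
  by have := H i im; rewrite /A/= eqxx /= in_itv.
move=> q i j im jm ij D; have GD : G D by exact: G_bin.
have DE : D `<=` E by move=> o [].
rewrite (_ : _ `&` _ = D `&` [set o | forall i', (i' < m)%N -> A (pred2 i j) i' (X i' o)]).
  rewrite X_indep//; apply: eq_integral => o _; congr EFin.
  rewrite (bigD1 (Ordinal im))//= (bigD1 (Ordinal jm))/=; last by rewrite -val_eqE/= eq_sym.
  rewrite {1 2}/A/= !eqxx orbT/= big1 ?mulr1// => k /andP[].
  by rewrite -!val_eqE/= /A/= => /negbTE -> /negbTE ->; rewrite fT.
apply/seteqP; split => o [Do /= H]; split => //.
  move=> i' _; rewrite /A/=; case: ifP => //.
  by case/orP => /eqP ->; rewrite /= in_itv; case: H.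
have := H i im; have := H j jm; rewrite /A/= !eqxx orbT /= !in_itv/= => ? ?; split => //.
Qed.

(** Taking every factor equal to [I] in the product formula gives the full mass of [E]. *)
Lemma sample_in (I : set (measurableTypeR R)) : measurable I -> (forall o, mu o I = 1%E) ->
  {ae P, forall o, E o -> forall i, (i < m)%N -> I (X i o)}.
Proof.
move=> mI muI; have mE := G_measurable GE.
pose S := [set o | forall i, (i < m)%N -> I (X i o)].
have mS : measurable S.
  rewrite (_ : S = \bigcap_(i in [set i | (i < m)%N]) (X i @^-1` I)); last by apply/seteqP; split.
  apply: bigcap_measurable => [|i _]; first by exists 0%N.
  by rewrite -[X in measurable X]setTI; exact: measurable_funPT.
have PES : P (E `&` S) = P E.
  rewrite (X_indep GE (@subset_refl _ E) (fun=> mI)) -[RHS]mul1e -integral_cst//.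
  apply: eq_integral => o _; congr EFin; apply: big1 => i _; by rewrite muI.
exists (E `\` S); split; first exact: measurableD.
  have PE : (P E < +oo)%E by rewrite -ge0_fin_numE// fin_num_measure.
  transitivity (P E - P (E `&` S))%E; first exact: measureD.
  by rewrite PES subee// fin_num_measure.
by move=> o /not_implyP[Eo nS]; split.
Qed.

End conditional_sampling.

(** * Conditional expectation and almost sure bounds *)

Section conditional_expectation.
Context {R : realType} d (Omega : measurableType d) (P : probability Omega R).
Variables (G : set (set Omega)) (Z : Omega -> \bar R) (c : R).
Hypotheses (GS : sigma_algebra setT G) (G_measurable : G `<=` measurable).
Hypotheses (mZ : measurable_fun setT Z) (Z_ge0 : forall o, (0 <= Z o)%E) (c_ge0 : 0 <= c).
Hypothesis ZG : forall A, G A -> (\int[P]_(o in A) Z o <= c%:E * P A)%E.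

Let T := g_sigma_algebraType G.

Let mG (A : set T) : measurable A = G A.
Proof. by rewrite -[in RHS](sigma_algebra_id GS). Qed.

Let mid : measurable_fun [set: Omega] (id : Omega -> T).
Proof. by move=> _ B mB; rewrite setTI; apply: G_measurable; rewrite -mG. Qed.

Let iZ : P.-integrable setT Z.
Proof.
apply/integrableP; split => //.
under eq_integral do rewrite gee0_abs//.
have GT : G setT by rewrite -mG.
by apply: le_lt_trans (ZG GT) _; rewrite probability_setT mule1 ltry.
Qed.

(** The conditional expectation is a Radon-Nikodym derivative on the coarser sigma-algebra; a bound
    on the integrals over all events of [G] then becomes an almost sure bound. *)
Lemma condexp_le_exists : condexp_le P G Z c.
Proof.
pose idf : {mfun Omega >-> T} := mfun_Sub (mem_set mid).
(* The image of [P] under the identity is its restriction to [G]. *)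
pose mu : probability T R := distribution P idf.
have [nu nuE] : exists nu : {charge set T -> \bar R},
    forall A, nu A = (\int[P]_(o in (A : set Omega)) Z o)%E.
  unshelve refine (ex_intro _ (pushforward (induced_charge iZ) idf : {charge set T -> \bar R}) _) => //.
have numu : nu `<< mu.
  apply/null_content_dominatesP => A mA A0; rewrite nuE.
  apply/eqP; rewrite eq_le integral_ge0// andbT.
  apply: le_trans (ZG _) _; first by rewrite -mG.
  by rewrite [P _]A0 mule0.
pose Y : T -> \bar R := Radon_Nikodym nu mu.
have iY : mu.-integrable setT Y by exact: Radon_Nikodym_integrable.
have mY : measurable_fun [set: T] Y := measurable_int _ iY.
have mYO : measurable_fun [set: Omega] (Y : Omega -> \bar R) by exact: measurableT_comp mY mid.
have iYO : P.-integrable setT (Y : Omega -> \bar R).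
  apply/integrableP; split => //; move/integrableP : iY => [_].
  by rewrite ge0_integral_pushforward//; exact: measurableT_comp.
have intY A : G A -> (\int[P]_(o in A) Y o = \int[P]_(o in A) Z o)%E.
  move=> GA; have mA : measurable (A : set T) by rewrite mG.
  rewrite -nuE (Radon_Nikodym_integral numu mA) (integral_pushforward (phi := idf))//.
  by apply: integrableS iYO => //; exact: G_measurable.
exists Y; first split => //.
- by move=> B mB; rewrite -mG -[X in measurable X]setTI; exact: mY.
(* Events where the bound is exceeded by at least [1/(n+1)]; each belongs to [G] and must be
   null. *)
pose S n : set Omega := [set o | ((c + n.+1%:R^-1)%:E <= Y o)%E].
have GSn n : G (S n).
  by rewrite -mG -[X in measurable X]setTI; exact: emeasurable_fun_c_infty.
have S0 n : P (S n) = 0%E.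
  have mS : measurable (S n) by exact: G_measurable.
  have cn : 0 < n.+1%:R^-1 :> R by rewrite invr_gt0.
  have h1 : ((c + n.+1%:R^-1)%:E * P (S n) <= \int[P]_(o in S n) Y o)%E.
    rewrite -integral_cst//; apply: ge0_le_integral => //.
    - by move=> o _; rewrite lee_fin addr_ge0// ltW.
    - exact: measurable_funTS.
  rewrite (intY (S n) (GSn n)) in h1; have := le_trans h1 (ZG (GSn n)).
  have -> : P (S n) = (fine (P (S n)))%:E by rewrite fineK// fin_num_measure.
  rewrite -!EFinM lee_fin mulrDl gerDl pmulr_rle0// => p0.
  by congr EFin; apply/eqP; rewrite eq_le p0 fine_ge0.
have aeS : {ae P, forall o, forall n, ~ S n o}.
  apply/ae_foralln => n; exists (S n); split; [exact: G_measurable|exact: S0|].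
  by move=> o /contrapT.
apply: ae_imp aeS _ => o HS; rewrite leNgt; apply/negP => cY.
have Yfin : (Y o = (fine (Y o))%:E)%E by rewrite fineK// Radon_Nikodym_fin_num.
rewrite Yfin lte_fin in cY; set r := fine (Y o) in Yfin cY.
have rc : 0 < r - c by rewrite subr_gt0.
apply: (HS (Num.truncn (r - c)^-1)); rewrite /S/= Yfin lee_fin -lerBrDl ltW//.
by rewrite invf_plt ?posrE// truncnS_gt.
Qed.

End conditional_expectation.

(** * Grid sizes and sample sizes *)

Section sample_sizes.
Context {R : realType}.
Variables (L W r : R).
Hypotheses (L1 : 1 <= L) (W0 : 0 <= W) (r0 : 0 < r) (r1 : r <= 1).

(** [x] is a Lipschitz constant and [W] bounds the interval length: the grid is so fine that its
    error is at most [r / (8 * L)], the tolerance also granted to the smoothing. *)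
Definition grid_size (x : R) : nat := (Num.truncn (2 * x * W / (r / (8 * L)))).+1.
(** The factor 96 is [4 * 2 * 12]: the statistical error term [2 * L^2 * 12 * (number of nodes) / M]
    is to be at most a quarter of [r^2]. *)
Definition sample_size (x : R) : nat :=
  (Num.truncn (96 * L ^+ 2 * (grid_size x).+4%:R / r ^+ 2)).+1.

Let L0 : 0 < L. Proof. exact: lt_le_trans L1. Qed.
Let e0 : 0 < r / (8 * L). Proof. by rewrite divr_gt0// mulr_gt0. Qed.

Lemma grid_sizeP x V : 0 <= x -> V <= W -> 2 * x * (V / (grid_size x)%:R) <= r / (8 * L).
Proof.
move=> x0 VW; have N0 : 0 < (grid_size x)%:R :> R by rewrite ltr0n.
rewrite mulrA ler_pdivrMr//; apply: (@le_trans _ _ (2 * x * W)).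
  by rewrite ler_wpM2l// mulr_ge0.
rewrite [leRHS]mulrC -ler_pdivrMr// ltW//; exact: truncnS_gt.
Qed.

Lemma sample_sizeP x : 2 * L ^+ 2 * (12 * (grid_size x).+4%:R / (sample_size x)%:R) <= r ^+ 2 / 4.
Proof.
have M0 : 0 < (sample_size x)%:R :> R by rewrite ltr0n.
have : 96 * L ^+ 2 * (grid_size x).+4%:R / r ^+ 2 <= (sample_size x)%:R.
  by rewrite ltW//; exact: truncnS_gt.
rewrite ler_pdivrMr ?exprn_gt0// => H.
rewrite [leLHS]mulrA ler_pdivrMr//.
move: (grid_size x).+4%:R (sample_size x)%:R H => g M H; lra.
Qed.

(** The number of nodes is of order [1/r] and is divided by [r^2], which gives [r^-3]; this is
    weakened to [r^-4] because [r <= 1]. *)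
Lemma sample_size_le x : 0 <= x ->
  (sample_size x)%:R <= (96 * L ^+ 2 * (16 * x * W * L + 5) + 1) * r ^- 4.
Proof.
move=> x0; have ri1 : 1 <= r^-1 by rewrite -[1]invr1 lef_pV2 ?posrE.
have ri0 : 0 < r^-1 by rewrite invr_gt0.
have trunc_le (y : R) : 0 <= y -> (Num.truncn y).+1%:R <= y + 1.
  by move=> y0; rewrite -natr1 lerD2r truncn_le.
have gle : (grid_size x).+4%:R <= (16 * x * W * L + 5) * r^-1.
  have : (grid_size x)%:R <= 2 * x * W / (r / (8 * L)) + 1.
    by apply: trunc_le; rewrite divr_ge0 ?(ltW e0)// !mulr_ge0.
  rewrite (_ : 2 * x * W / (r / (8 * L)) = 16 * x * W * L * r^-1); last by field; rewrite !gt_eqF.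
  rewrite -addn4 natrD mulrDl; lra.
have A0 : 0 <= 96 * L ^+ 2 by rewrite mulr_ge0 ?sqr_ge0.
have B0 : 0 <= 16 * x * W * L + 5 by rewrite addr_ge0// !mulr_ge0 ?(ltW L0).
have h1 : (sample_size x)%:R <= 96 * L ^+ 2 * (grid_size x).+4%:R / r ^+ 2 + 1.
  by apply: trunc_le; rewrite divr_ge0 ?sqr_ge0// mulr_ge0.
apply: (le_trans h1); rewrite [leRHS]mulrDl mul1r -!exprVn.
apply: lerD; last by rewrite exprn_ege1.
rewrite -(mulrA (96 * L ^+ 2)) -(mulrA (96 * L ^+ 2)); apply: ler_wpM2l => //.
apply: (@le_trans _ _ ((16 * x * W * L + 5) * r^-1 * r^-1 ^+ 2)).
  by rewrite ler_wpM2r ?sqr_ge0.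
rewrite -mulrA -exprS ler_wpM2l//.
by rewrite ler_weXn2l.
Qed.

End sample_sizes.

Lemma powR_half_sqr (R : realType) (beta : R) t : 0 < beta < 1 ->
  let r := beta `^ (t%:R / 2) in [/\ 0 < r, r <= 1 & r ^+ 2 = beta ^+ t].
Proof.
move=> /andP[b0 b1] r; have r0 : 0 < r by exact: powR_gt0.
have r2 : r ^+ 2 = beta ^+ t.
  by rewrite -powR_mulrn ?powR_ge0// /r -powRrM divfK// powR_mulrn// ltW//.
have : r ^+ 2 <= 1 by rewrite r2 exprn_ile1// ltW.
by rewrite expr_le1// ?ltW.
Qed.

Lemma bi_lip_mono (R : realType) (L L' lo hi : R) (m : prob R) : L <= L' ->
  bi_lip L lo hi m -> bi_lip L' lo hi m.
Proof.
move=> LL [m1 m2 m3 m4]; split => //; first exact: cdf_lip_mono m1.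
move=> x y lox xy yhi; apply: le_trans (m2 x y lox xy yhi) _.
by rewrite ler_wpM2r// subr_ge0 cdfr_nd.
Qed.

(** Rationals just to the right of [x] and [y] suffice: right continuity controls the loss at [x],
    monotonicity settles [y]. The Lipschitz property of a random measure thus becomes a countable
    intersection of events. *)
Lemma cdf_lip_rat (R : realType) (l : R) (m : prob R) : 0 <= l ->
  (forall p q : rat, p <= q -> cdfr m (ratr q) - cdfr m (ratr p) <= l * (ratr q - ratr p)) ->
  cdf_lip l m.
Proof.
move=> l0 H x y; rewrite le_eqVlt => /predU1P[->|xy]; first by rewrite !subrr mulr0.
apply/ler_addgt0Pr => e e0.
have l1 : 0 < l + 1 by rewrite ltr_wpDl.
pose e' := e / 2; have e'0 : 0 < e' by rewrite divr_gt0.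
have eE : e = e' + e' by rewrite /e'; field.
pose dl := e' / (l + 1); have dl0 : 0 < dl by rewrite divr_gt0.
have ld : l * dl <= e'.
  by rewrite /dl mulrCA ler_piMr ?(ltW e'0)// ler_pdivrMr// mul1r lerDl.
have [x' xx' x'e] : exists2 x', x < x' & cdfr m x' < cdfr m x + e'.
  by apply: cdfr_rclt; rewrite ltrDl.
have [p] : exists p : rat, ratr p \in `]x, (Num.min x' y)[.
  by apply: rat_in_itvoo; rewrite lt_min xx' xy.
rewrite in_itv/= => /andP[xp]; rewrite lt_min => /andP[px' py].
have [q] : exists q : rat, ratr q \in `]y, (y + dl)[.
  by apply: rat_in_itvoo; rewrite ltrDl.
rewrite in_itv/= => /andP[yq qy].
have pq : p <= q by rewrite -(ler_rat R); lra.
have := H p q pq; have := cdfr_nd m (ltW px'); have := cdfr_nd m (ltW yq).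
have : l * (ratr q - ratr p) <= l * (y + dl - x) by rewrite ler_wpM2l//; lra.
have : l * (y + dl - x) = l * (y - x) + l * dl by ring.
lra.
Qed.

(** * Regularity and measurability along the scheme *)

Section scheme_structure.
Context {R : realType} {K : nat} d (Omega : measurableType d) (s : run R K d Omega).
Variables (w lo hi : 'I_K -> R) (kappa0 : R -> R) (kappa : 'I_K -> R -> R).
Variables (P : probability Omega R) (nu : 'I_K -> prob R) (mu0 : prob R) (L0 : R).
Hypothesis lo_lt_hi : forall k, lo k < hi k.
Hypotheses (kappa0_kernel : is_kernel kappa0) (kappa_kernel : forall k, is_kernel (kappa k)).
Hypotheses (w_gt0 : forall k, 0 < w k) (w_sum1 : \sum_(k < K) w k = 1).
Hypotheses (L0_gt0 : 0 < L0) (mu0_lip : bi_lip L0 (wavg w lo) (wavg w hi) mu0).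
Hypothesis s_scheme : is_scheme s w lo hi kappa0 kappa P nu mu0.

Local Notation filt_type t := (g_sigma_algebraType (filt s t)).
Local Notation wlo := (wavg w lo).
Local Notation whi := (wavg w hi).
Local Notation That := (That s w lo hi kappa0 kappa).
Local Notation muhat := (muhat s).

Let K_gt0 : (0 < K)%N.
Proof.
rewrite lt0n; apply/eqP => K0.
have : \sum_(k < K) w k = 0 by apply: big1 => -[i iK]; exfalso; move: iK; rewrite K0.
by rewrite w_sum1 => /eqP; rewrite oner_eq0.
Qed.

Lemma wavg_lt : wlo < whi.
Proof.
rewrite -subr_gt0 /wavg -sumrB (bigD1 (Ordinal K_gt0))//= ltr_pwDl//.
  by rewrite -mulrBr mulr_gt0// subr_gt0.
by apply: sumr_ge0 => k _; rewrite -mulrBr mulr_ge0 ?(ltW (w_gt0 k))// subr_ge0 ltW.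
Qed.

Lemma scheme_adapted t k : adapted s t (numX s t k) /\ adapted s t (numY s t k).
Proof. by have [_ _ _ _ /(_ t k) []] := s_scheme. Qed.

Let pos t k o : [/\ (0 < numX s t k o)%N, (0 < numY s t k o)%N, 0 < bwX s t k o & 0 < bwY s t k o].
Proof. by have [_ _ _ /(_ t k o)] := s_scheme. Qed.

Lemma Ghat_bilip t k o : bilip_cdf wlo whi (Ghat s w lo hi kappa0 t k o).
Proof. by have [? _ ? _] := pos t.-1 k o; apply: kernel_cdf_bilip => //; exact: wavg_lt. Qed.

Lemma Fhat_bilip t k o : bilip_cdf (lo k) (hi k) (Fhat s lo hi kappa t k o).
Proof. by have [_ ? _ ?] := pos t.-1 k o; exact: kernel_cdf_bilip. Qed.

Lemma That_in t k o x : lo k <= That t k o x <= hi k.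
Proof. exact: (monotone_map_in wavg_lt (lo_lt_hi k) (Ghat_bilip t k o) (Fhat_bilip t k o)). Qed.

(** Joint measurability in outcome and point, needed because the map is evaluated at the random
    quantile of the current measure. *)
Lemma measurable_That t k : measurable_fun setT
  (fun z : (filt_type t.+1 * measurableTypeR R)%type => (That t.+1 k z.1 z.2 : measurableTypeR R)).
Proof.
have [aM aN ab ah] : [/\ adapted s t (numX s t k), adapted s t (numY s t k),
    adapted s t (bwX s t k : _ -> measurableTypeR R) & adapted s t (bwY s t k : _ -> measurableTypeR R)].
  by have [_ _ _ _ /(_ t k)] := s_scheme.
pose G (z : filt_type t.+1 * measurableTypeR R) := kernel_cdf kappa0 wlo whi (bwX s t k z.1)
  (numX s t k z.1) (fun i => sample_if (numX s t k) (smpX s t.+1 k) i z.1).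
pose F (z : filt_type t.+1 * measurableTypeR R) := kernel_cdf (kappa k) (lo k) (hi k) (bwY s t k z.1)
  (numY s t k z.1) (fun i => sample_if (numY s t k) (smpY s t.+1 k) i z.1).
rewrite (_ : (fun _ => _) = (fun z => monotone_map wlo whi (lo k) (hi k) (G z) (F z) z.2)); last first.
  apply/funext => z; rewrite /That; congr (monotone_map _ _ _ _ _ _ _).
    by apply: kernel_cdf_eq => i iM; rewrite /sample_if iM.
  by apply: kernel_cdf_eq => i iM; rewrite /sample_if iM.
have mfst dT (T : measurableType dT) (f : Omega -> T) : adapted s t f ->
    measurable_fun setT (fun z : (filt_type t.+1 * measurableTypeR R)%type => f z.1).
  move=> af; apply: (measurableT_comp (f := f : filt_type t.+1 -> T)) => //.
  by apply: measurable_filt_mono; exact: adapted_measurable_fun.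
apply: (measurable_monotone_map (G := G) (F := F) (x := snd)) => //.
- exact: wavg_lt.
- by move=> z; have [? _ ? _] := pos t k z.1; apply: kernel_cdf_bilip => //; exact: wavg_lt.
- by move=> z; have [_ ? _ ?] := pos t k z.1; exact: kernel_cdf_bilip.
- apply: (@measurable_kernel_cdf _ _ (filt_type t.+1 * measurableTypeR R)%type kappa0 wlo whi
    (fun z => bwX s t k z.1) (fun z => numX s t k z.1)
    (fun i z => sample_if (numX s t k) (smpX s t.+1 k) i z.1)
    (fun z => clamp wlo whi z.2)) => //.
  + exact: wavg_lt.
  + by move=> z; have [] := pos t k z.1.
  + by move=> z; have /andP[] := clamp_in z.2 (ltW wavg_lt).
  + exact: mfst.
  + exact: mfst.
  + move=> i; apply: measurableT_comp measurable_fst.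
    exact: (measurable_sampleX scheme_adapted).
  + by apply: measurable_maxr => //; exact: measurable_minr.
- move=> y /andP[loy _].
  apply: (@measurable_kernel_cdf _ _ (filt_type t.+1 * measurableTypeR R)%type (kappa k) (lo k) (hi k)
    (fun z => bwY s t k z.1) (fun z => numY s t k z.1)
    (fun i z => sample_if (numY s t k) (smpY s t.+1 k) i z.1) (fun=> y)) => //.
  + by move=> z; have [] := pos t k z.1.
  + exact: mfst.
  + exact: mfst.
  + move=> i; apply: measurableT_comp measurable_fst.
    exact: (measurable_sampleY scheme_adapted).
Qed.

Definition mean_map t o (x : R) : R := \sum_(k < K) w k * That t k o x.

Lemma mean_map_continuous t o : continuous (mean_map t o).
Proof.
move=> x; rewrite /mean_map; apply: cvg_big => [|k _]; first exact: add_continuous.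
apply: cvgM; first exact: cvg_cst.
exact: (monotone_map_continuous wavg_lt (lo_lt_hi k) (Ghat_bilip t k o) (Fhat_bilip t k o)).
Qed.

Lemma mean_map_nd t o : {homo mean_map t o : x y / x <= y}.
Proof.
move=> x y xy; apply: ler_sum => k _; rewrite ler_wpM2l ?(ltW (w_gt0 k))//.
exact: (monotone_map_nd wavg_lt (lo_lt_hi k) (Ghat_bilip t k o) (Fhat_bilip t k o)).
Qed.

Lemma mean_map_in t o x : wlo <= mean_map t o x <= whi.
Proof.
by apply/andP; split; apply: ler_sum => k _; have /andP[? ?] := That_in t k o x;
  rewrite ler_wpM2l ?(ltW (w_gt0 k)).
Qed.

Lemma mean_map_expansive t o : exists2 c, 0 < c &
  forall x y, wlo <= x -> x <= y -> y <= whi -> c * (y - x) <= mean_map t o y - mean_map t o x.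
Proof.
have H k := monotone_map_bilip wavg_lt (lo_lt_hi k) (Ghat_bilip t k o) (Fhat_bilip t k o).
have /choice[c Hc] : forall k, exists c, 0 < c /\ forall x y, wlo <= x -> x <= y -> y <= whi ->
    c * (y - x) <= That t k o y - That t k o x.
  by move=> k; have [c [C [c0 _ Hc _]]] := H k; exists c; split.
exists (\sum_(k < K) w k * c k).
  rewrite (bigD1 (Ordinal K_gt0))//= ltr_pwDl// ?mulr_gt0 ?(Hc _).1//.
  by apply: sumr_ge0 => k _; rewrite mulr_ge0 ?(ltW (w_gt0 k))// ltW// (Hc _).1.
move=> x y lox xy yhi; rewrite /mean_map -sumrB mulr_suml; apply: ler_sum => k _.
by rewrite -mulrBr -mulrA ler_wpM2l ?(ltW (w_gt0 k))// (Hc k).2.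
Qed.

Lemma quantile_muhatS t o u : 0 < u < 1 ->
  quantile (muhat t.+1 o) u = mean_map t.+1 o (quantile (muhat t o) u).
Proof.
move=> u01; apply: (quantile_push (S := mean_map t.+1 o)) => //.
- exact: mean_map_continuous.
- exact: mean_map_nd.
- by have [_ + _ _ _] := s_scheme; exact.
Qed.

Lemma quantile_muhat_in t o u : 0 < u < 1 -> wlo <= quantile (muhat t o) u <= whi.
Proof.
move=> u01; case: t => [|t]; last by rewrite quantile_muhatS// mean_map_in.
have [-> _ _ _ _] := s_scheme; exact: bi_lip_quantile mu0_lip u01.
Qed.

Lemma muhat_P2 t o : P2 (muhat t o).
Proof. by apply: bounded_quantile_P2 => u; exact: quantile_muhat_in. Qed.

(** The constants multiply along the iterations. They depend on the outcome without a uniform bound,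
    which is why parameters are tied to [lip_level]. *)
Lemma muhat_expansive t o : exists2 c, 0 < c & expansive c (muhat t o).
Proof.
elim: t => [|t [c c0 Hc]].
  exists L0^-1; first by rewrite invr_gt0.
  have [-> _ _ _ _] := s_scheme; apply: cdf_lip_expansive => //.
  by have [] := mu0_lip.
have [c' c'0 Hc'] := mean_map_expansive t.+1 o.
exists (c' * c); first by rewrite mulr_gt0.
move=> u v u0 uv v1.
have u01 : 0 < u < 1 by rewrite u0 (le_lt_trans uv).
have v01 : 0 < v < 1 by rewrite v1 (lt_le_trans u0).
rewrite !quantile_muhatS//.
have /andP[l1 _] := quantile_muhat_in t o u01; have /andP[_ l2] := quantile_muhat_in t o v01.
apply: le_trans (Hc' _ _ l1 (quantile_nd _ u0 uv v1) l2).
by rewrite -mulrA ler_pM2l// Hc.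
Qed.

Lemma muhat_lip t o : exists2 l, 0 < l & cdf_lip l (muhat t o).
Proof.
have [c c0 /(expansive_cdf_lip c0) Hc] := muhat_expansive t o.
by exists c^-1; rewrite ?invr_gt0.
Qed.

Lemma muhat_atomless t o : atomless (muhat t o).
Proof. by have [l _ /cdf_lip_atomless] := muhat_lip t o. Qed.

Lemma muhat_level t o : cdf_lip (lip_level (muhat t o))%:R (muhat t o) /\ (0 < lip_level (muhat t o))%N.
Proof.
have [l l0 ml] := muhat_lip t o.
have : cdf_lip (Num.truncn l).+1%:R (muhat t o).
  by apply: cdf_lip_mono ml; exact: ltW (truncnS_gt _).
by move=> /lip_levelP[? /andP[]].
Qed.

(** A measurable handle on the random measure, as a joint function of outcome and level. The
    explicit test lets the recursion in [t] hold for every pair, not only for levels inside the unit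
    interval. *)
Definition muhat_quantile t (z : filt_type t * measurableTypeR R) : measurableTypeR R :=
  if 0 < z.2 < 1 then quantile (muhat t z.1) z.2 else 0.

Let widen t (f : filt_type t * measurableTypeR R -> measurableTypeR R) : measurable_fun setT f ->
  measurable_fun [set: (filt_type t.+1 * measurableTypeR R)%type]
    (f : (filt_type t.+1 * measurableTypeR R)%type -> _).
Proof.
move=> mf; rewrite (_ : f = f \o
  (fun z : filt_type t.+1 * measurableTypeR R => (z.1, z.2) : filt_type t * measurableTypeR R)); last first.
  by apply/funext => -[].
apply: measurableT_comp mf _; apply: measurable_fun_pair => //.
move=> _ B mB; rewrite setTI.
rewrite (_ : fst @^-1` B = (B : set (filt_type t.+1)) `*` setT); last first.
  by apply/seteqP; split => // z [].
apply: measurableX => //; rewrite measurable_filtE; apply: filt_mono.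
by rewrite -measurable_filtE.
Qed.

Let That_at_quantile t k : measurable_fun setT (@muhat_quantile t) ->
  measurable_fun setT (fun z : filt_type t.+1 * measurableTypeR R =>
    That t.+1 k z.1 (@muhat_quantile t z) : measurableTypeR R).
Proof.
move=> mq; have H : measurable_fun setT (fun z : filt_type t.+1 * measurableTypeR R =>
    (z.1, @muhat_quantile t z) : (filt_type t.+1 * measurableTypeR R)%type).
  by apply: measurable_fun_pair => //; exact: (@widen t (@muhat_quantile t) mq).
exact: (measurableT_comp (@measurable_That t k) H).
Qed.

Lemma measurable_muhat_quantile t : measurable_fun setT (@muhat_quantile t).
Proof.
have m01 dT (T : measurableType dT) : measurable_fun setT
    (fun z : (T * measurableTypeR R)%type => (0 < z.2) && (z.2 < 1)).
  by apply: measurable_and; apply: measurable_fun_ltr.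
elim: t => [|t IH].
  have [H0 _ _ _ _] := s_scheme.
  rewrite (_ : @muhat_quantile 0 = (fun z => if (0 < z.2) && (z.2 < 1) then quantile mu0 z.2 else 0)).
    apply: measurable_fun_ifT => //.
      exact: (m01 _ (filt_type 0)).
    exact: (@measurable_quantile_snd _ _ (filt_type 0)).
  by apply/funext => z; rewrite /muhat_quantile H0.
rewrite (_ : @muhat_quantile t.+1 = (fun z => if (0 < z.2) && (z.2 < 1) then
    mean_map t.+1 z.1 (@muhat_quantile t z) else 0)); last first.
  by apply/funext => z; rewrite /muhat_quantile; case: ifPn => // z01; rewrite quantile_muhatS.
apply: measurable_fun_ifT => //; first exact: (m01 _ (filt_type t.+1)).
apply: (@measurable_sum _ (filt_type t.+1 * measurableTypeR R)%type R setT _ _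
  (fun (k : 'I_K) z => w k * That t.+1 k z.1 (@muhat_quantile t z))) => k.
apply: measurable_funM => //.
exact: (@That_at_quantile t k IH).
Qed.

Let section_mq t (o : Omega) :
  measurable_fun setT (fun u : measurableTypeR R => @muhat_quantile t (o, u)).
Proof.
apply: (@measurable_fun_pair2 _ _ _ (filt_type t) (measurableTypeR R) (measurableTypeR R)).
exact: measurable_muhat_quantile.
Qed.

Lemma measurable_That_section t k o :
  measurable_fun setT (That t k o : measurableTypeR R -> measurableTypeR R).
Proof.
apply: continuous_measurable_fun.
exact: (monotone_map_continuous wavg_lt (lo_lt_hi k) (Ghat_bilip t k o) (Fhat_bilip t k o)).
Qed.

Lemma measurable_unif_integral t (g : filt_type t * measurableTypeR R -> R) :
  measurable_fun setT g -> (forall z, 0 <= g z) ->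
  measurable_fun [set: filt_type t] (fun o => \int[unif]_u (g (o, u))%:E)%E.
Proof.
move=> mg g0; apply: (@measurable_fun_fubini_tonelli_F _ _ _ _ _ unif (fun z => (g z)%:E)).
  exact/measurable_EFinP.
by move=> z; rewrite lee_fin.
Qed.

(** The squared L2 error of the estimated map, written without [ot_map], so that measurability in
    the outcome does not depend on the chosen representative. *)
Definition loss t k o : \bar R := (\int[unif]_u
  ((That t k o (quantile (muhat t.-1 o) u) - quantile (nu k) u) ^+ 2)%:E)%E.

Lemma Lnorm2_loss t k o : P2 (nu k) ->
  ('N[muhat t.-1 o]_2%:E[(fun x =>
     (That t k o x - ot_map (muhat t.-1 o) (nu k) x)%:E)] ^+ 2 = loss t k o)%E.
Proof.
move=> n2; rewrite Lnorm2_ot_map//; [exact: muhat_atomless|exact: muhat_P2|].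
apply: continuous_measurable_fun.
exact: (monotone_map_continuous wavg_lt (lo_lt_hi k) (Ghat_bilip t k o) (Fhat_bilip t k o)).
Qed.

Lemma measurable_loss t k : measurable_fun [set: filt_type t.+1] (loss t.+1 k : filt_type t.+1 -> _).
Proof.
pose g (z : filt_type t.+1 * measurableTypeR R) : R :=
  (That t.+1 k z.1 (@muhat_quantile t z) - quantile (nu k) z.2) ^+ 2.
rewrite (_ : loss t.+1 k = (fun o => \int[unif]_u (g (o, u))%:E)%E).
  apply: measurable_unif_integral; last by move=> z; exact: sqr_ge0.
  apply/measurable_EFinP; apply: measurable_sqrB; last exact: (@measurable_quantile_snd _ _ (filt_type _)).
  exact: (@That_at_quantile t k (@measurable_muhat_quantile t)).
apply/funext => o; apply: ge0_integral_unif_eq.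
- apply: measurable_sqrB; last exact: measurable_quantile.
  apply: measurableT_comp; last exact: measurable_quantile.
  exact: measurable_That_section.
- apply: measurable_sqrB; last exact: measurable_quantile.
  exact: (measurableT_comp (@measurable_That_section t.+1 k o) (section_mq t o)).
- by move=> u u01; rewrite /g/= /muhat_quantile/= u01.
Qed.

Lemma measurable_qdist_muhat t n :
  measurable_fun [set: filt_type t] (fun o : filt_type t => qdist (muhat t o) n).
Proof.
pose g (z : filt_type t * measurableTypeR R) : R :=
  (@muhat_quantile t z - quantile n z.2) ^+ 2.
rewrite (_ : (fun _ => _) = (fun o => \int[unif]_u (g (o, u))%:E)%E).
  apply: measurable_unif_integral; last by move=> z; exact: sqr_ge0.
  apply/measurable_EFinP; apply: measurable_sqrB; last exact: (@measurable_quantile_snd _ _ (filt_type _)).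
  exact: measurable_muhat_quantile.
apply/funext => o; apply: ge0_integral_unif_eq.
- by apply: measurable_sqrB; exact: measurable_quantile.
- apply: measurable_sqrB; last exact: measurable_quantile.
  exact: section_mq.
- by move=> u u01; rewrite /g/= /muhat_quantile/= u01.
Qed.

Lemma measurable_cdfr_muhat t x :
  measurable_fun [set: filt_type t] (fun o : filt_type t => cdfr (muhat t o) x : measurableTypeR R).
Proof.
pose g (z : filt_type t * measurableTypeR R) : R := (@muhat_quantile t z <= x)%R%:R.
apply/measurable_EFinP.
rewrite (_ : _ \o _ = (fun o => \int[unif]_u (g (o, u))%:E)%E).
  apply: measurable_unif_integral; last by move=> z; rewrite /g ler0n.
  apply/measurable_EFinP; apply: (measurable_bool_EFin (R := R)).
  by apply: measurable_fun_ler => //; exact: measurable_muhat_quantile.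
apply/funext => o /=; rewrite cdfrE (quantile_prob (muhat t o))//.
transitivity (\int[unif]_u (((quantile (muhat t o) u <= x)%R)%:R)%:E)%E.
  rewrite integral_bool; last by apply: measurable_fun_ler => //; exact: measurable_quantile.
  by congr (unif _); apply/seteqP; split => u /=; rewrite in_itv.
apply: ge0_integral_unif_eq.
- apply: measurable_bool_EFin; apply: measurable_fun_ler => //; exact: measurable_quantile.
- apply: measurable_bool_EFin; apply: measurable_fun_ler => //.
  exact: section_mq.
- by move=> u u01; rewrite /g/= /muhat_quantile/= u01.
Qed.

(** The Lipschitz bounds are tested on pairs of rationals, where the distribution function is
    measurable at time [t]. The level 0 never occurs along the scheme. *)
Lemma filt_muhat_level t n : filt s t [set o | lip_level (muhat t o) = n].
Proof.
rewrite -measurable_filtE.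
have mL (l : nat) : measurable [set o : filt_type t | cdf_lip l%:R (muhat t o)].
  pose A (p : rat * rat) := [set o : filt_type t | (p.1 <= p.2) ==>
    (cdfr (muhat t o) (ratr p.2) - cdfr (muhat t o) (ratr p.1) <= l%:R * (ratr p.2 - ratr p.1))].
  have mA p : measurable (A p).
    apply: measurable_set_bool; rewrite /A; case: (p.1 <= p.2) => //=.
    apply: measurable_fun_ler => //.
    by apply: measurable_funB; exact: measurable_cdfr_muhat.
  rewrite (_ : [set _ | _] = \bigcap_i (if (unpickle i : option (rat * rat)) is Some p then A p else setT)).
    by apply: bigcapT_measurable => i; case: unpickle.
  apply/seteqP; split => o /= H.
    by move=> i _; case: unpickle => // -[p q]; apply/implyP => /= pq; apply: H; rewrite ler_rat.
  apply: cdf_lip_rat => // p q pq; have := H (pickle (p, q)) I; rewrite pickleK.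
  by move=> /implyP; apply.
case: n => [|n].
  rewrite (_ : [set _ | _] = set0)//; apply/seteqP; split => // o /=.
  by have [_] := muhat_level t o; case: lip_level.
rewrite (_ : [set _ | _] = [set o | cdf_lip n.+1%:R (muhat t o)] `\` [set o | cdf_lip n%:R (muhat t o)]).
  exact: measurableD.
apply/seteqP; split => o /=.
  move=> H; have [Hl _] := muhat_level t o; rewrite H in Hl; split => // /lip_levelP[_].
  by rewrite H ltnn andbF.
move=> [/lip_levelP[Hl /andP[l0 ln]] H]; apply/eqP; rewrite eqn_leq ln/= ltnNge; apply/negP => ln'.
by apply: H; apply: cdf_lip_mono Hl; rewrite ler_nat.
Qed.

(** * Expected loss on an event with fixed sample sizes *)

Section loss_bound.
Variables (t : nat) (k : 'I_K) (E : set Omega) (m n N N' : nat) (l L e : R).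
Hypotheses (filtE : filt s t E) (m_gt0 : (0 < m)%N) (n_gt0 : (0 < n)%N).
Hypotheses (N_gt0 : (0 < N)%N) (N'_gt0 : (0 < N')%N).
Hypothesis E_num : forall o, E o -> numX s t k o = m /\ numY s t k o = n.
Hypothesis E_lip : forall o, E o -> cdf_lip l (muhat t o).
Hypothesis nu_lip : bi_lip L (lo k) (hi k) (nu k).
Local Notation sX := ((whi - wlo) / N%:R).
Local Notation sY := ((hi k - lo k) / N'%:R).
Hypothesis sharpX : forall o z x, E o -> wlo <= z <= whi -> wlo <= x <= whi ->
  (x + sX <= z -> smooth_step kappa0 wlo whi (bwX s t k o) z x <= e) /\
  (z <= x - sX -> 1 - e <= smooth_step kappa0 wlo whi (bwX s t k o) z x).
Hypothesis sharpY : forall o z x, E o -> lo k <= z <= hi k -> lo k <= x <= hi k ->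
  (x + sY <= z -> smooth_step (kappa k) (lo k) (hi k) (bwY s t k o) z x <= e) /\
  (z <= x - sY -> 1 - e <= smooth_step (kappa k) (lo k) (hi k) (bwY s t k o) z x).
Hypotheses (e_ge0 : 0 <= e) (l_ge0 : 0 <= l) (lsX : 2 * l * sX <= e) (LsY : 2 * L * sY <= e).

Let mE : measurable E.
Proof. exact: (filt_measurable scheme_adapted filtE). Qed.

Let filt_sub : filt s t `<=` measurable.
Proof. by move=> A; exact: (filt_measurable scheme_adapted). Qed.

Let cond (D : set Omega) (A B : nat -> set (measurableTypeR R)) : filt s t D -> D `<=` E ->
  (forall i, measurable (A i)) -> (forall j, measurable (B j)) ->
  P (D `&` [set o | (forall i, (i < m)%N -> A i (smpX s t.+1 k i o)) /\
                    (forall j, (j < n)%N -> B j (smpY s t.+1 k j o))]) =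
  (\int[P]_(o in D) ((\prod_(i < m) fine (muhat t o (A i))) *
                     (\prod_(j < n) fine (nu k (B j))))%:E)%E.
Proof.
move=> FD DE mA mB; have [_ _ /(_ t.+1 k (ltn0Sn _) m n D A B FD mA mB) + _ _] := s_scheme.
rewrite (_ : D `&` [set o | numX s t k o = m /\ numY s t k o = n] = D)//.
by apply/seteqP; split => o; [case|move=> Do; split => //; exact: E_num (DE _ Do)].
Qed.

Let condX (D : set Omega) (A : nat -> set (measurableTypeR R)) : filt s t D -> D `<=` E ->
  (forall i, measurable (A i)) ->
  P (D `&` [set o | forall i, (i < m)%N -> A i (smpX s t.+1 k i o)]) =
  (\int[P]_(o in D) (\prod_(i < m) fine (muhat t o (A i)))%:E)%E.
Proof.
move=> FD DE mA; have := cond FD DE mA (fun=> measurableT).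
rewrite (_ : [set o | _ /\ _] = [set o | forall i, (i < m)%N -> A i (smpX s t.+1 k i o)]); last first.
  by apply/seteqP; split => o /=; [case|].
move=> ->; apply: eq_integral => o _; congr EFin.
by rewrite [X in _ * X]big1 ?mulr1// => i _; rewrite probability_setT.
Qed.

Let condY (D : set Omega) (B : nat -> set (measurableTypeR R)) : filt s t D -> D `<=` E ->
  (forall i, measurable (B i)) ->
  P (D `&` [set o | forall j, (j < n)%N -> B j (smpY s t.+1 k j o)]) =
  (\int[P]_(o in D) (\prod_(j < n) fine (nu k (B j)))%:E)%E.
Proof.
move=> FD DE mB; have := cond FD DE (fun=> measurableT) mB.
rewrite (_ : [set o | _ /\ _] = [set o | forall j, (j < n)%N -> B j (smpY s t.+1 k j o)]); last first.
  by apply/seteqP; split => o /=; [case|].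
move=> ->; apply: eq_integral => o _; congr EFin.
by rewrite [X in X * _]big1 ?mul1r// => i _; rewrite probability_setT.
Qed.

Let filtI (S : set Omega) : measurable (S : set (filt_type t)) -> filt s t (E `&` S).
Proof.
move=> mS; rewrite -measurable_filtE; apply: measurableI => //.
by rewrite measurable_filtE.
Qed.

Let devX (o : Omega) (x : R) : R := (ecdf m (fun i => smpX s t.+1 k i o) x - cdfr (muhat t o) x) ^+ 2.
Let devY (o : Omega) (x : R) : R := (ecdf n (fun j => smpY s t.+1 k j o) x - cdfr (nu k) x) ^+ 2.

Let int_devX x : (\int[P]_(o in E) (devX o x)%:E <= (6 / m%:R)%:E * P E)%E.
Proof.
apply: (@ecdf_variance _ _ _ P (filt s t) m (smpX s t.+1 k) (muhat t)) => //.
- by move=> y; apply: (measurable_filt scheme_adapted); exact: measurable_cdfr_muhat.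
- move=> q y; apply: filtI; rewrite (_ : _ @^-1` _ = [set o : filt_type t |
      (q%:R <= m%:R * cdfr (muhat t o) y) && (m%:R * cdfr (muhat t o) y < q.+1%:R)]).
    apply: measurable_set_bool; apply: measurable_and.
      apply: measurable_fun_ler => //; apply: measurable_funM => //.
      exact: measurable_cdfr_muhat.
    apply: measurable_fun_ltr => //; apply: measurable_funM => //.
    exact: measurable_cdfr_muhat.
  have H0 o : 0 <= m%:R * cdfr (muhat t o) y by rewrite mulr_ge0// cdfr_ge0.
  apply/seteqP; split => o /=; first by move=> <-; exact: truncn_itv.
  by move=> Hq; apply/eqP; rewrite truncn_eq.
Qed.

Let int_devY x : (\int[P]_(o in E) (devY o x)%:E <= (6 / n%:R)%:E * P E)%E.
Proof.
apply: (@ecdf_variance _ _ _ P (filt s t) n (smpY s t.+1 k) (fun=> nu k)) => //.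
- move=> q y; apply: filtI.
  have [H|H] := pselect (Num.truncn (n%:R * cdfr (nu k) y) = q).
    by rewrite (_ : _ @^-1` _ = setT)//; apply/seteqP; split.
  by rewrite (_ : _ @^-1` _ = set0)//; apply/seteqP; split.
Qed.

Let inX : {ae P, forall o, E o -> forall i, (i < m)%N -> wlo <= smpX s t.+1 k i o <= whi}.
Proof.
have H : {ae P, forall o, E o -> forall i, (i < m)%N -> `[wlo, whi]%classic (smpX s t.+1 k i o)}.
  apply: (@sample_in _ _ _ P (filt s t) m (smpX s t.+1 k) (muhat t) E) => // o.
 rewrite (quantile_prob (muhat t o))// -(@probability_setT _ _ _ unif).
  apply: measure_ae_eq => //.
    by rewrite -[X in measurable X]setTI; exact: measurable_quantile.
  apply: unif_ae => u u01; split => // _ /=; rewrite in_itv; exact: quantile_muhat_in.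
by apply: ae_imp H _ => o H Eo i im; have := H Eo i im; rewrite /= in_itv.
Qed.

Let inY : {ae P, forall o, E o -> forall j, (j < n)%N -> lo k <= smpY s t.+1 k j o <= hi k}.
Proof.
have H : {ae P, forall o, E o -> forall j, (j < n)%N -> `[lo k, hi k]%classic (smpY s t.+1 k j o)}.
  apply: (@sample_in _ _ _ P (filt s t) n (smpY s t.+1 k) (fun=> nu k) E) => // o.
 rewrite (quantile_prob (nu k))// -(@probability_setT _ _ _ unif).
  apply: measure_ae_eq => //.
    by rewrite -[X in measurable X]setTI; exact: measurable_quantile.
  apply: unif_ae => u u01; split => // _ /=; rewrite in_itv; exact: bi_lip_quantile nu_lip u01.
by apply: ae_imp H _ => o H Eo i im; have := H Eo i im; rewrite /= in_itv.
Qed.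

Let DX (o : Omega) : R := \sum_(j < N.+4) devX o (grid wlo sX j).
Let DY (o : Omega) : R := \sum_(j < N'.+4) devY o (grid (lo k) sY j).

Let loss_pointwise o : E o ->
  (forall i, (i < m)%N -> wlo <= smpX s t.+1 k i o <= whi) ->
  (forall j, (j < n)%N -> lo k <= smpY s t.+1 k j o <= hi k) ->
  (loss t.+1 k o <= (2 * L ^+ 2 * (16 * e ^+ 2 + 2 * DX o + 2 * DY o))%:E)%E.
Proof.
move=> Eo HX HY; have [nm nn] := E_num Eo; have [_ _ b0 h0] := pos t k o.
have Lge0 : 0 <= L by case: nu_lip => /cdf_lip_ge0.
rewrite -unif_integral_cst; apply: ge0_integral_unif_le.
- apply: measurable_sqrB; last exact: measurable_quantile.
  exact: (measurableT_comp (@measurable_That_section t.+1 k o) (measurable_quantile _)).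
- exact: measurable_cst.
- by move=> u; rewrite lee_fin sqr_ge0.
- move=> u; rewrite lee_fin; apply: mulr_ge0; first by rewrite mulr_ge0 ?sqr_ge0.
  by rewrite !addr_ge0 ?mulr_ge0 ?sqr_ge0 ?sumr_ge0// => j _; exact: sqr_ge0.
move=> u u01; rewrite lee_fin; set x := quantile (muhat t o) u.
have xin : wlo <= x <= whi by exact: quantile_muhat_in.
have := monotone_map_quantile_dist (lo_lt_hi k) (Ghat_bilip t.+1 k o) (Fhat_bilip t.+1 k o)
  nu_lip u01 xin.
set T := That t.+1 k o x.
have Tin : lo k <= T <= hi k by exact: That_in.
(* Writing [u] as the distribution function of the current measure at [x] turns the second error
   into a deviation of [Ghat]. *)
rewrite -/T -{2}(cdfr_quantile (muhat_atomless t o) u01) -/x => dist.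
(* The grid error is at most [e], so the deterministic part is at most [2 * (2 * e)^2]. *)
have dG : (Ghat s w lo hi kappa0 t.+1 k o x - cdfr (muhat t o) x) ^+ 2 <= 8 * e ^+ 2 + 2 * DX o.
  rewrite /Ghat/= nm; apply: le_trans (kernel_cdf_dev kappa0_kernel wavg_lt (E_lip Eo) m_gt0 N_gt0
    b0 e_ge0 erefl _ HX xin) _; first by move=> z y; exact: sharpX.
  rewrite lerD2r; have : 0 <= e + 2 * l * sX.
    by rewrite addr_ge0// !mulr_ge0// ?invr_ge0// subr_ge0 ltW// wavg_lt.
  move: lsX; set a := 2 * l * sX => ae a0; nra.
have dF : (Fhat s lo hi kappa t.+1 k o T - cdfr (nu k) T) ^+ 2 <= 8 * e ^+ 2 + 2 * DY o.
  have nuL : cdf_lip L (nu k) by case: nu_lip.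
  rewrite /Fhat/= nn; apply: le_trans (kernel_cdf_dev (kappa_kernel k) (lo_lt_hi k) nuL n_gt0 N'_gt0
    h0 e_ge0 erefl _ HY Tin) _; first by move=> z y; exact: sharpY.
  rewrite lerD2r; have : 0 <= e + 2 * L * sY.
    by rewrite addr_ge0// !mulr_ge0// ?invr_ge0// subr_ge0 ltW// lo_lt_hi.
  move: LsY; set a := 2 * L * sY => ae a0; nra.
move: dist dG dF; set q := quantile _ _; set G := Ghat _ _ _ _ _ _ _ _ _; set H := cdfr _ x.
set F := Fhat _ _ _ _ _ _ _ _; set F' := cdfr _ T => dist dG dF.
apply: (@le_trans _ _ ((L * (`|F - F'| + `|G - H|)) ^+ 2)).
  by rewrite -[leLHS]real_normK ?num_real// ler_sqr// nnegrE// (le_trans _ dist).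
rewrite exprMn (_ : 2 * L ^+ 2 * _ = L ^+ 2 * (2 * (16 * e ^+ 2 + 2 * DX o + 2 * DY o))); last by ring.
apply: ler_wpM2l; first exact: sqr_ge0.
move: dG dF; rewrite -(real_normK (num_real (G - H))) -(real_normK (num_real (F - F'))).
set g := `|_ - _|; set f := `|F - _| => dG dF.
have : 0 <= (g - f) ^+ 2 by exact: sqr_ge0.
clearbody g f; move: (DX o) (DY o) dG dF => dx dy dG dF h; nra.
Qed.

(** The factor [2 * L^2] comes from squaring the sum of the two level errors, and 16 from two
    deterministic parts of [8 * e^2]. Each 12 is the 2 of [kernel_cdf_dev] times the 6 of
    [ecdf_variance], summed over the grid nodes. *)
Lemma loss_bound : (\int[P]_(o in E) loss t.+1 k o <=
  (2 * L ^+ 2 * (16 * e ^+ 2 + 12 * N.+4%:R / m%:R + 12 * N'.+4%:R / n%:R))%:E * P E)%E.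
Proof.
have n0R (p : nat) : (0 < p)%N -> 0 < p%:R :> R by rewrite ltr0n.
have Lge0 : 0 <= L by case: nu_lip => /cdf_lip_ge0.
have mec p (X : nat -> {mfun Omega >-> measurableTypeR R}) x :
    measurable_fun [set: Omega] (fun o => ecdf p (fun i => X i o) x).
  apply: measurable_funM => //.
  apply: (@measurable_sum _ Omega R setT _ _ (fun (i : 'I_p) o => (X i o <= x)%R%:R)) => i.
  apply/measurable_EFinP; apply: (measurable_bool_EFin (R := R)); apply: measurable_fun_ler => //.
  exact: (@measurable_funPT _ _ _ _ (X i)).
have mdX x : measurable_fun setT (devX ^~ x).
  apply: measurable_funX; apply: measurable_funB; first exact: mec.
  by apply: (measurable_filt scheme_adapted (t := t)); exact: measurable_cdfr_muhat.
have mdY x : measurable_fun setT (devY ^~ x).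
  by apply: measurable_funX; apply: measurable_funB => //; exact: mec.
have dX0 o x : 0 <= devX o x by exact: sqr_ge0.
have dY0 o x : 0 <= devY o x by exact: sqr_ge0.
have mDX : measurable_fun setT DX.
  by apply: (@measurable_sum _ Omega R setT _ _ (fun (j : 'I_N.+4) o => devX o (grid wlo sX j))) => j.
have mDY : measurable_fun setT DY.
  by apply: (@measurable_sum _ Omega R setT _ _ (fun (j : 'I_N'.+4) o => devY o (grid (lo k) sY j))) => j.
have DX0 o : 0 <= DX o by exact: sumr_ge0.
have DY0 o : 0 <= DY o by exact: sumr_ge0.
have PE : P E = (fine (P E))%:E by rewrite fineK// fin_num_measure.
set p := fine (P E) in PE.
have iDX : (\int[P]_(o in E) (DX o)%:E <= (N.+4%:R * 6 / m%:R * p)%:E)%E.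
  under eq_integral do rewrite -sumEFin.
  rewrite ge0_integral_sum//; last 2 first.
  - by move=> j; apply: measurable_funTS; exact/measurable_EFinP.
  - by move=> j o _; rewrite lee_fin.
  apply: (@le_trans _ _ (\sum_(j < N.+4) (6 / m%:R * p)%:E)%E).
    by apply: lee_sum => j _; apply: le_trans (int_devX _) _; rewrite PE -EFinM.
  by rewrite sumEFin sumr_const card_ord lee_fin -[_ *+ _]mulr_natl !mulrA.
have iDY : (\int[P]_(o in E) (DY o)%:E <= (N'.+4%:R * 6 / n%:R * p)%:E)%E.
  under eq_integral do rewrite -sumEFin.
  rewrite ge0_integral_sum//; last 2 first.
  - by move=> j; apply: measurable_funTS; exact/measurable_EFinP.
  - by move=> j o _; rewrite lee_fin.
  apply: (@le_trans _ _ (\sum_(j < N'.+4) (6 / n%:R * p)%:E)%E).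
    by apply: lee_sum => j _; apply: le_trans (int_devY _) _; rewrite PE -EFinM.
  by rewrite sumEFin sumr_const card_ord lee_fin -[_ *+ _]mulr_natl !mulrA.
have mB : measurable_fun setT (fun o => 2 * L ^+ 2 * (16 * e ^+ 2 + 2 * DX o + 2 * DY o)).
  by apply: measurable_funM => //; apply: measurable_funD; [apply: measurable_funD|];
    rewrite //; exact: measurable_funM.
have B0 o : 0 <= 2 * L ^+ 2 * (16 * e ^+ 2 + 2 * DX o + 2 * DY o).
  by rewrite !mulr_ge0 ?sqr_ge0// !addr_ge0 ?mulr_ge0 ?sqr_ge0.
apply: (@le_trans _ _ (\int[P]_(o in E) (2 * L ^+ 2 * (16 * e ^+ 2 + 2 * DX o + 2 * DY o))%:E)%E).
  apply: ae_ge0_le_integral => //.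
  - by move=> o _; apply: integral_ge0 => u _; rewrite lee_fin sqr_ge0.
  - by apply: measurable_funTS; apply: (measurable_filt scheme_adapted (t := t.+1)); exact: measurable_loss.
  - by move=> o _; rewrite lee_fin.
  - by apply: measurable_funTS; exact/measurable_EFinP.
  by move: inX inY; apply: filterS2 => o hX hY Eo; exact: loss_pointwise Eo (hX Eo) (hY Eo).
under eq_integral do rewrite EFinM EFinD EFinD (EFinM 2 (DX _)) (EFinM 2 (DY _)).
have a1 o : E o -> (0 <= (16 * e ^+ 2)%:E)%E by move=> _; rewrite lee_fin mulr_ge0 ?sqr_ge0.
have a2 o : E o -> (0 <= 2%:E * (DX o)%:E)%E by move=> _; rewrite -EFinM lee_fin mulr_ge0.
have a3 o : E o -> (0 <= 2%:E * (DY o)%:E)%E by move=> _; rewrite -EFinM lee_fin mulr_ge0.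
have mE1 : measurable_fun E (fun=> (16 * e ^+ 2)%:E) by [].
have mEX : measurable_fun E (fun o => (DX o)%:E) by apply: measurable_funTS; exact/measurable_EFinP.
have mEY : measurable_fun E (fun o => (DY o)%:E) by apply: measurable_funTS; exact/measurable_EFinP.
have mE2 : measurable_fun E (fun o => 2%:E * (DX o)%:E)%E by exact: measurable_funeM.
have mE3 : measurable_fun E (fun o => 2%:E * (DY o)%:E)%E by exact: measurable_funeM.
have mE12 := emeasurable_funD mE1 mE2.
have a12 o (Eo : E o) := adde_ge0 (a1 o Eo) (a2 o Eo).
rewrite ge0_integralZl//; last 3 first.
- exact: (emeasurable_funD mE12 mE3).
- by move=> o Eo; exact: adde_ge0 (a12 o Eo) (a3 o Eo).
- by rewrite lee_fin mulr_ge0 ?sqr_ge0.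
rewrite (ge0_integralD P mE a12 mE12 a3 mE3) (ge0_integralD P mE a1 mE1 a2 mE2).
rewrite ge0_integralZl//; last by move=> o _; rewrite lee_fin.
rewrite ge0_integralZl//; last by move=> o _; rewrite lee_fin.
have -> : (\int[P]_(o in E) (16 * e ^+ 2)%:E = (16 * e ^+ 2 * p)%:E)%E.
  by rewrite integral_cst//; transitivity ((16 * e ^+ 2)%:E * P E)%E => //; rewrite PE.
apply: (@le_trans _ _ ((2 * L ^+ 2)%:E * ((16 * e ^+ 2 * p)%:E +
   2%:E * (N.+4%:R * 6 / m%:R * p)%:E + 2%:E * (N'.+4%:R * 6 / n%:R * p)%:E))%E).
  apply: lee_wpmul2l; first by rewrite lee_fin mulr_ge0 ?sqr_ge0.
  by apply: leeD; [apply: leeD2l|]; apply: lee_wpmul2l.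
apply: (@le_trans _ _ ((2 * L ^+ 2) * (16 * e ^+ 2 * p +
   2 * (N.+4%:R * 6 / m%:R * p) + 2 * (N'.+4%:R * 6 / n%:R * p)))%:E); first exact: lexx.
by rewrite PE -EFinM lee_fin le_eqVlt; apply/orP; left; apply/eqP; ring.
Qed.

End loss_bound.

Lemma That_Clin t k o : Clin (That t k o).
Proof. exact: (monotone_map_Clin wavg_lt (lo_lt_hi k) (Ghat_bilip t k o) (Fhat_bilip t k o)). Qed.

Lemma That_borel_dependency t k : borel_dependency s w lo hi kappa0 kappa P t k.
Proof.
move=> m n m0 n0.
exists (@estimator_map _ wlo whi (lo k) (hi k) kappa0 (kappa k) m n) => D; split.
- by move=> z Dz; exact: (estimator_map_Clin kappa0_kernel (kappa_kernel k) wavg_lt (lo_lt_hi k) m0 n0 Dz).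
- by move=> U; exact: (estimator_map_borel kappa0_kernel (kappa_kernel k) wavg_lt (lo_lt_hi k) m0 n0).
exists set0; split => // o /= H; apply: H => nm nn.
rewrite /Defs.That /estimator_map/=; congr (monotone_map _ _ _ _ _ _).
  rewrite /Ghat nm; apply: kernel_cdf_eq => i im.
  rewrite nth_cat size_map size_enum_ord im (nth_map (Ordinal im)) ?size_enum_ord//.
  by rewrite nth_enum_ord.
rewrite /Fhat nn; apply: kernel_cdf_eq => j jn.
rewrite nth_cat size_map size_enum_ord ltnNge leq_addr/= addKn (nth_map (Ordinal jn)) ?size_enum_ord//.
by rewrite nth_enum_ord.
Qed.

(** * Parameters prescribed by the Lipschitz level *)

Section prescribed_sizes.
Variables (t : nat) (k : 'I_K) (L W r h : R) (b : nat -> R).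
Hypotheses (L1 : 1 <= L) (nu_lip : bi_lip L (lo k) (hi k) (nu k)) (r0 : 0 < r).
Hypotheses (W_wide : whi - wlo <= W) (W_wide_k : hi k - lo k <= W).
Hypothesis rule : forall o, let l := lip_level (muhat t o) in
  [/\ numX s t k o = sample_size L W r l%:R, numY s t k o = sample_size L W r L,
      bwX s t k o = b l & bwY s t k o = h].
Hypothesis sharp_b : forall l z x, wlo <= z <= whi -> wlo <= x <= whi ->
  (x + (whi - wlo) / (grid_size L W r l%:R)%:R <= z ->
     smooth_step kappa0 wlo whi (b l) z x <= r / (8 * L)) /\
  (z <= x - (whi - wlo) / (grid_size L W r l%:R)%:R ->
     1 - r / (8 * L) <= smooth_step kappa0 wlo whi (b l) z x).
Hypothesis sharp_h : forall z x, lo k <= z <= hi k -> lo k <= x <= hi k ->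
  (x + (hi k - lo k) / (grid_size L W r L)%:R <= z ->
     smooth_step (kappa k) (lo k) (hi k) h z x <= r / (8 * L)) /\
  (z <= x - (hi k - lo k) / (grid_size L W r L)%:R ->
     1 - r / (8 * L) <= smooth_step (kappa k) (lo k) (hi k) h z x).

(** On a slice of constant level the sample sizes and bandwidths are constants, so [loss_bound]
    applies; the resulting bound is the same on every slice. *)
Lemma loss_prescribed (A : set Omega) : filt s t A ->
  (\int[P]_(o in A) loss t.+1 k o <= (r ^+ 2)%:E * P A)%E.
Proof.
move=> FA; have Lp : 0 < L by exact: lt_le_trans L1.
have W0 : 0 <= W by apply: le_trans W_wide; rewrite subr_ge0 ltW// wavg_lt.
have mA : measurable A by exact: (filt_measurable scheme_adapted FA).
apply: (integral_le_pieces (N := fun o => lip_level (muhat t o))) => //.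
- by move=> n; apply: (filt_measurable scheme_adapted (t := t)); exact: filt_muhat_level.
- exact: sqr_ge0.
- by apply: (measurable_filt scheme_adapted (t := t.+1)); exact: measurable_loss.
- by move=> o; apply: integral_ge0 => u _; rewrite lee_fin sqr_ge0.
move=> l; set E := _ `&` _.
have FE : filt s t E.
  rewrite -measurable_filtE; apply: measurableI; rewrite measurable_filtE//.
  exact: filt_muhat_level.
have e0 : 0 <= r / (8 * L) by rewrite divr_ge0 ?ltW// mulr_gt0.
apply: le_trans (@loss_bound t k E (sample_size L W r l%:R) (sample_size L W r L)
  (grid_size L W r l%:R) (grid_size L W r L) l%:R L (r / (8 * L)) FE _ _ _ _ _ _ nu_lip
  _ _ e0 _ _ _) _ => //.
- by move=> o [_ /= lo_]; have [-> -> _ _] := rule o; rewrite lo_.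
- by move=> o [_ /= <-]; have [] := muhat_level t o.
- move=> o z x [_ /= lo_]; have [_ _ -> _] := rule o; rewrite lo_; exact: sharp_b.
- move=> o z x _; have [_ _ _ ->] := rule o; exact: sharp_h.
- exact: grid_sizeP.
- by apply: grid_sizeP => //; exact: ltW.
rewrite lee_wpmul2r// lee_fin mulrDr mulrDr.
have h1 := sample_sizeP L W r0 l%:R; have h2 := sample_sizeP L W r0 L.
(* The budget: half of [r^2] for smoothing and grid errors, a quarter for each of the two
   samples. *)
have h3 : 2 * L ^+ 2 * (16 * (r / (8 * L)) ^+ 2) = r ^+ 2 / 2 by field; rewrite gt_eqF.
lra.
Qed.

Lemma condexp_prescribed : P2 (nu k) -> condexp_le P (filt s t)
  (fun o => ('N[muhat t o]_2%:E[(fun x =>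
     (That t.+1 k o x - ot_map (muhat t o) (nu k) x)%:E)] ^+ 2)%E) (r ^+ 2).
Proof.
move=> n2; rewrite (_ : (fun o => _) = loss t.+1 k); last first.
  by apply/funext => o; rewrite -(@Lnorm2_loss t.+1 k o n2).
apply: condexp_le_exists.
- exact: filt_sigma_algebra.
- by move=> A; exact: (filt_measurable scheme_adapted).
- by apply: (measurable_filt scheme_adapted (t := t.+1)); exact: measurable_loss.
- by move=> o; apply: integral_ge0 => u _; rewrite lee_fin sqr_ge0.
- exact: sqr_ge0.
- exact: loss_prescribed.
Qed.

End prescribed_sizes.

(** [muhat] at the new time is exactly the image measure, so the distance is 0. *)
Lemma condexp_push t (c : R) : 0 <= c ->
  condexp_le P (filt s t) (fun o => (W2 (That_push s w lo hi kappa0 kappa t.+1 o) (muhat t.+1 o) ^+ 2)%E) c.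
Proof.
move=> c0; have [_ push _ _ _] := s_scheme.
rewrite (_ : (fun o => _) = cst 0%E); last first.
  apply/funext => o; rewrite (@W2_meas_eq _ _ (muhat t.+1 o) _ (muhat t.+1 o))//.
    by rewrite W2_sqr qdist_refl.
  by move=> A mA; rewrite (push t.+1 o (ltn0Sn _) A mA).
exists (cst 0%E).
  split => //.
  - exact: integrable0.
  - exact: integrable0.
  - move=> B _; rewrite preimage_cst; case: ifP => _; rewrite -measurable_filtE.
      exact: (measurableT : measurable (setT : set (filt_type t))).
    exact: (measurable0 : measurable (set0 : set (filt_type t))).
by exists set0; split => // o /= H; apply: H; rewrite lee_fin.
Qed.

(** * The barycenter functional and convergence *)

Section value.
Hypothesis nu_P2 : forall k, P2 (nu k).
Local Notation mubar := (bary w nu).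

Lemma measurable_qdist_mubar t : measurable_fun [set: Omega] (fun o => qdist (muhat t o) mubar).
Proof. by apply: (measurable_filt scheme_adapted (t := t)); exact: measurable_qdist_muhat. Qed.

Lemma expected_Vbar t :
  (\int[P]_o Vbar w nu (muhat t o) - Vbar w nu mubar = \int[P]_o qdist (muhat t o) mubar)%E.
Proof.
have Vfin := Vbar_bary_fin w_gt0 w_sum1 nu_P2.
have V0 : (0 <= Vbar w nu mubar)%E.
  by apply: sume_ge0 => k _; apply: mule_ge0; [rewrite lee_fin ltW|rewrite W2_sqr; exact: qdist_ge0].
under eq_integral do rewrite (Vbar_bary nu w_gt0 w_sum1).
rewrite ge0_integralD//; last 2 first.
- by move=> o _; exact: qdist_ge0.
- exact: measurable_qdist_mubar.
have -> : (\int[P]_o Vbar w nu mubar = Vbar w nu mubar)%E.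
  by rewrite integral_cst//; transitivity (Vbar w nu mubar * P setT)%E => //; rewrite probability_setT mule1.
by rewrite addeK.
Qed.

Lemma W2_Gmap_muhat t o :
  (W2 (muhat t o) (Gmap w nu (muhat t o)) ^+ 2 = qdist (muhat t o) mubar)%E.
Proof.
rewrite -W2_sqr; congr (_ ^+ 2)%E; apply: W2_meas_eq => //.
by apply: Gmap_bary => //; [exact: muhat_atomless|exact: muhat_P2].
Qed.

(** The new quantile is the weighted mean of the estimated maps along the current quantile, so
    convexity of the square compares it with [mean_quantile]. The distance of the current measure to
    the barycenter does not enter. *)
Lemma qdist_mubar_le t o :
  (qdist (muhat t.+1 o) mubar <= \sum_(k < K) (w k)%:E * loss t.+1 k o)%E.
Proof.
pose dk k u : R := (That t.+1 k o (quantile (muhat t o) u) - quantile (nu k) u) ^+ 2.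
have mdk k : measurable_fun [set: measurableTypeR R] (fun u => (dk k u)%:E).
  apply: measurable_sqrB; last exact: measurable_quantile.
  exact: (measurableT_comp (@measurable_That_section t.+1 k o) (measurable_quantile _)).
have mwdk k : measurable_fun [set: measurableTypeR R] (fun u => (w k)%:E * (dk k u)%:E)%E.
  exact: measurable_funeM.
have E : (\sum_(k < K) (w k)%:E * loss t.+1 k o =
    \int[unif]_u (\sum_(k < K) (w k)%:E * (dk k u)%:E))%E.
  rewrite ge0_integral_sum//; last by move=> k u _; rewrite -EFinM lee_fin mulr_ge0 ?sqr_ge0// ltW.
  apply: eq_bigr => k _; rewrite ge0_integralZl//.
    by move=> u _; rewrite lee_fin sqr_ge0.
  by rewrite lee_fin ltW.
rewrite E; apply: ge0_integral_unif_le.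
- by apply: measurable_sqrB; exact: measurable_quantile.
- exact: emeasurable_sum.
- by move=> u; rewrite lee_fin sqr_ge0.
- by move=> u; apply: sume_ge0 => k _; rewrite -EFinM lee_fin mulr_ge0 ?sqr_ge0// ltW.
move=> u u01; rewrite quantile_muhatS// quantile_bary//.
under eq_bigr do rewrite -EFinM; rewrite sumEFin lee_fin /mean_map /mean_quantile -sumrB.
under eq_bigr do rewrite -mulrBr.
exact: sqr_weighted_le.
Qed.

Section convergence.
Variables (C : prob R -> R) (beta : R).
Hypotheses (beta01 : 0 < beta < 1).
Hypothesis choice : forall t, (0 < t)%N ->
  good_choice s w lo hi kappa0 kappa P nu C beta t.

Lemma expected_qdist_le t : (\int[P]_o qdist (muhat t.+1 o) mubar <= (beta ^+ t.+1)%:E)%E.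
Proof.
have ml k : measurable_fun [set: Omega] (loss t.+1 k).
  by apply: (measurable_filt scheme_adapted (t := t.+1)); exact: measurable_loss.
have l0 k o : (0 <= loss t.+1 k o)%E by apply: integral_ge0 => u _; rewrite lee_fin sqr_ge0.
have lossE k : (\int[P]_o loss t.+1 k o <= (beta ^+ t.+1)%:E)%E.
  have [_ /(_ k) [Y [iZ iY _ YE] Yle] _] := choice (ltn0Sn t).
  have FT : filt s t setT.
    by rewrite -measurable_filtE; exact: (measurableT : measurable (setT : set (filt_type t))).
  rewrite (eq_integral _ _ (fun o _ => esym (@Lnorm2_loss t.+1 k o (nu_P2 k)))) -(YE _ FT).
  apply: (@le_trans _ _ (\int[P]_o (beta ^+ t.+1)%:E)%E).
    (* The conditional expectation [Y] carries no sign a priori; its integral is at most that of its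
       positive part, which inherits the almost sure bound. *)
    rewrite integralE; apply: (@le_trans _ _ (\int[P]_o (Y^\+)%E o)%E).
      by rewrite geeDl// oppe_le0; exact: integral_ge0.
    apply: ae_ge0_le_integral => //.
    - by apply: measurable_funepos; exact: measurable_int iY.
    - by move=> o _; rewrite lee_fin exprn_ge0//; case/andP: beta01 => /ltW.
    apply: ae_imp Yle _ => o Yo _; rewrite funeposE ge_max Yo lee_fin exprn_ge0//.
    by case/andP: beta01 => /ltW.
  by rewrite integral_cst//; rewrite [X in (_ * X)%E]probability_setT mule1.
apply: (@le_trans _ _ (\int[P]_o (\sum_(k < K) (w k)%:E * loss t.+1 k o))%E).
  apply: ge0_le_integral => //.
  - by move=> o _; exact: qdist_ge0.
  - exact: measurable_qdist_mubar.
  - by apply: emeasurable_sum => k; exact: measurable_funeM.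
  - by move=> o _; exact: qdist_mubar_le.
rewrite ge0_integral_sum//; last 2 first.
- by move=> k; exact: measurable_funeM.
- by move=> k o _; rewrite mule_ge0// lee_fin ltW.
apply: (@le_trans _ _ (\sum_(k < K) (w k * beta ^+ t.+1)%:E)%E).
  have wk k : (0 <= (w k)%:E)%E by rewrite lee_fin ltW.
  by apply: lee_sum => k _; rewrite ge0_integralZl// EFinM lee_wpmul2l.
by rewrite sumEFin -mulr_suml w_sum1 mul1r.
Qed.

(** The expected squared distances are bounded by a geometric series, so their sum over time is
    almost surely finite and its terms tend to 0. *)
Lemma ae_cvg_mubar : {ae P, forall o, (fun t => W2 (muhat t o) mubar) @ \oo --> 0%E}.
Proof.
have mq t := measurable_qdist_mubar t.
have mS : measurable_fun setT (fun o => \sum_(t <oo) qdist (muhat t.+1 o) mubar)%E.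
  apply: (@ge0_emeasurable_sum _ _ _ setT (fun t o => qdist (muhat t.+1 o) mubar) xpredT) => //.
  by move=> t o _ _; exact: qdist_ge0.
have S0 o : (0 <= \sum_(t <oo) qdist (muhat t.+1 o) mubar)%E.
  by apply: nneseries_ge0 => t _ _; exact: qdist_ge0.
case/andP: (beta01) => b0 b1.
have geo n : \sum_(0 <= i < n) beta ^+ i.+1 <= (1 - beta)^-1.
  rewrite -[leRHS]mul1r ler_pdivlMr ?subr_gt0//.
  suff -> : (\sum_(0 <= i < n) beta ^+ i.+1) * (1 - beta) = beta - beta ^+ n.+1.
    by rewrite (le_trans _ (ltW b1))// gerBl exprn_ge0// ltW.
  elim: n => [|n IH]; first by rewrite big_nil mul0r expr1 subrr.
  by rewrite big_nat_recr//= mulrDl IH !exprS; ring.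
have fin : (\int[P]_o (\sum_(t <oo) qdist (muhat t.+1 o) mubar) < +oo)%E.
  rewrite integral_nneseries//; last by move=> t o _; exact: qdist_ge0.
  apply: (@le_lt_trans _ _ ((1 - beta)^-1)%:E); last exact: ltry.
  have i0 t : (0 <= \int[P]_o qdist (muhat t.+1 o) mubar)%E.
    by apply: integral_ge0 => o _; exact: qdist_ge0.
  apply: lime_le; first by apply: is_cvg_nneseries => t _ _; exact: i0.
  apply: nearW => n; apply: (@le_trans _ _ (\sum_(0 <= i < n) (beta ^+ i.+1)%:E)%E).
    by apply: lee_sum => i _; exact: expected_qdist_le.
  by rewrite sumEFin lee_fin.
have ae_fin : {ae P, forall o, (\sum_(t <oo) qdist (muhat t.+1 o) mubar < +oo)%E}.
  have : P.-integrable setT (fun o => \sum_(t <oo) qdist (muhat t.+1 o) mubar)%E.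
    by apply/integrableP; split => //; under eq_integral do rewrite gee0_abs//.
  move=> /integrable_ae - /(_ measurableT) H; apply: ae_imp H _ => o /(_ I).
  by rewrite ge0_fin_numE.
apply: ae_imp ae_fin _ => o So; rewrite -cvg_shiftS.
have q0 : (fun t => qdist (muhat t.+1 o) mubar) @ \oo --> 0%E.
  have f0 k : xpredT k -> (0 <= qdist (muhat k.+1 o) mubar)%E by move=> _; exact: qdist_ge0.
  have := nneseries_tail_cvg So f0; apply: squeeze_cvge; last exact: cvg_cst.
  apply: nearW => t; rewrite qdist_ge0/=.
  rewrite (@nneseries_split _ (fun k => qdist (muhat k.+1 o) mubar) t 1)//; last by move=> k _; exact: qdist_ge0.
  rewrite addn1 big_nat1 leeDl//.
  by apply: nneseries_ge0 => k _ _; exact: qdist_ge0.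
have W2E t : W2 (muhat t.+1 o) mubar = (Num.sqrt (fine (qdist (muhat t.+1 o) mubar)))%:E.
  have qfin := qdist_fin (muhat_P2 t.+1 o) (P2_bary w_gt0 w_sum1 nu_P2).
  have := W2_sqr (muhat t.+1 o) mubar; have := W2_ge0 (muhat t.+1 o) mubar.
  move: qfin; case: (W2 _ _) => [x| |]//.
    by move=> qfin; rewrite lee_fin => x0 <-; rewrite -EFin_expe/= sqrtr_sqr ger0_norm.
  by move=> qfin _ H; rewrite -H expe2 mulyy in qfin.
rewrite (_ : [sequence _]_ _ = (fun t => (Num.sqrt (fine (qdist (muhat t.+1 o) mubar)))%:E)); last first.
  by apply/funext.
apply: cvg_EFin; first by apply: nearW.
rewrite -[X in _ --> X](@sqrtr0 R).
apply: (@cvg_comp _ _ _ (fun t => fine (qdist (muhat t.+1 o) mubar)) Num.sqrt _ (nbhs (0 : R))).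
  exact: fine_cvg q0.
exact: sqrt_continuous.
Qed.

End convergence.
End value.

End scheme_structure.

Theorem proposition3p8 (R : realType) (K : nat) (lo hi : 'I_K -> R)
    (nu : 'I_K -> prob R) (kappa0 : R -> R) (kappa : 'I_K -> R -> R)
    (lo_lt_hi : forall k, lo k < hi k)
    (nu_reg : forall k, regular_on (lo k) (hi k) (nu k))
    (kappa0_kernel : is_kernel kappa0)
    (kappa_kernel : forall k, is_kernel (kappa k)) :
  exists C : prob R -> R,
  forall (w : 'I_K -> R) (mu0 : prob R),
  (forall k, 0 < w k < 1) -> \sum_(k < K) w k = 1 ->
  regular_on (wavg w lo) (wavg w hi) mu0 ->
  exists mubar : prob R,
  (is_barycenter w nu mubar /\
   forall mu, is_barycenter w nu mu -> meas_eq mu mubar) /\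
  [/\
    (exists k, bounded_density (nu k)) /\
    (forall d (Omega : measurableType d) (P : probability Omega R)
        (s : run R K d Omega),
      is_scheme s w lo hi kappa0 kappa P nu mu0 ->
      forall t k, (0 < t)%N ->
        (forall o, Clin (That s w lo hi kappa0 kappa t k o)) /\
        borel_dependency s w lo hi kappa0 kappa P t k),
    forall (beta : R) (t : nat), 0 < beta < 1 -> (0 < t)%N ->
      exists (Mr Nr : 'I_K -> prob R -> nat)
             (br hr : 'I_K -> prob R -> measurableTypeR R),
        [/\ forall k, [/\ borel_rule (Mr k), borel_rule (Nr k),
                          borel_rule (br k) & borel_rule (hr k)],
            forall k mu, [/\ (0 < Mr k mu)%N, (0 < Nr k mu)%N,
                             0 < br k mu & 0 < hr k mu] /\
              growth_le (C mu) beta t (Mr k mu) (Nr k mu) (br k mu) (hr k mu) &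
            forall d (Omega : measurableType d) (P : probability Omega R)
                (s : run R K d Omega),
              is_scheme s w lo hi kappa0 kappa P nu mu0 ->
              (forall k o,
                [/\ numX s t.-1 k o = Mr k (muhat s t.-1 o),
                    numY s t.-1 k o = Nr k (muhat s t.-1 o),
                    bwX s t.-1 k o = br k (muhat s t.-1 o) &
                    bwY s t.-1 k o = hr k (muhat s t.-1 o)]) ->
              good_choice s w lo hi kappa0 kappa P nu C beta t],
    exists mu : prob R, is_fixpoint w nu mu /\
      forall mu' : prob R, is_fixpoint w nu mu' -> meas_eq mu' mu,
    forall d (Omega : measurableType d) (P : probability Omega R)
        (s : run R K d Omega),
      is_scheme s w lo hi kappa0 kappa P nu mu0 ->
      forall t,
        (\int[P]_o Vbar w nu (muhat s t o) - Vbar w nu mubar <=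
         \int[P]_o W2 (muhat s t o) (Gmap w nu (muhat s t o)) ^+ 2)%E /\
        (\int[P]_o Vbar w nu (muhat s t o) - Vbar w nu mubar >=
         \int[P]_o W2 (muhat s t o) mubar ^+ 2)%E &
    forall d (Omega : measurableType d) (P : probability Omega R)
        (s : run R K d Omega) (C' : prob R -> R) (beta : R),
      is_scheme s w lo hi kappa0 kappa P nu mu0 -> 0 < beta < 1 ->
      (forall t, (0 < t)%N ->
        good_choice s w lo hi kappa0 kappa P nu C' beta t) ->
      [/\ {ae P, forall o, (fun t => W2 (muhat s t o) mubar) @ \oo --> 0%E},
          forall t, (0 < t)%N ->
            (\int[P]_o Vbar w nu (muhat s t o) - Vbar w nu mubar <=
             (4 * beta ^+ t)%:E)%E &
          forall t, (0 < t)%N ->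
            (\int[P]_o W2 (muhat s t o) mubar ^+ 2 <= (4 * beta ^+ t)%:E)%E]].
Proof.
have /choice[Lk HLk] : forall k, exists L, 1 <= L /\ bi_lip L (lo k) (hi k) (nu k).
  by move=> k; have [L] := regular_bi_lip (lo_lt_hi k) (nu_reg k); exists L.
(* One constant for all [nu k]; the summand 1 provides [1 <= L]. *)
pose L := 1 + \sum_k Lk k.
have Lk0 k : 0 <= Lk k by apply: le_trans (HLk k).1.
have L1 : 1 <= L by rewrite lerDl sumr_ge0.
have Lp : 0 < L by exact: lt_le_trans L1.
have nuL k : bi_lip L (lo k) (hi k) (nu k).
  apply: bi_lip_mono (HLk k).2; rewrite /L (bigD1 k)//= addrCA lerDl addr_ge0// sumr_ge0//.
(* A bound on every interval length. As the weights are at most 1 it also covers the support of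
   [mu0], while it does not depend on the weights, which come after [C]. *)
pose W := \sum_k (hi k - lo k).
have wk0 k : 0 <= hi k - lo k by rewrite subr_ge0 ltW.
have W0 : 0 <= W by exact: sumr_ge0.
have Wk k : hi k - lo k <= W by rewrite /W (bigD1 k)//= lerDl sumr_ge0.
have nuP2 k : P2 (nu k) by have [[]] := nu_reg k.
(* [sample_size_le] is used with [x] equal to the level and to [L]; both bounds are covered once the
   level plus 1 is factored out. *)
pose c0 := 96 * L ^+ 2 * (16 * W * L ^+ 2 + 5) + 1.
have WL2 : 0 <= 16 * W * L ^+ 2 by rewrite mulr_ge0 ?sqr_ge0// mulr_ge0.
have c01 : 1 <= c0.
  by rewrite lerDr mulr_ge0 ?addr_ge0// mulr_ge0 ?sqr_ge0.
pose C (mu : prob R) := c0 * ((lip_level mu)%:R + 1).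
exists C => w mu0 w01 wsum mu0_reg.
have w0 k : 0 < w k by have /andP[] := w01 k.
have w1 k : w k <= 1 by have /andP[_ /ltW] := w01 k.
have wlh : wavg w lo < wavg w hi by exact: wavg_lt.
have [L0 L01 mu0L] := regular_bi_lip wlh mu0_reg.
have L0p : 0 < L0 by exact: lt_le_trans L01.
have Ww : wavg w hi - wavg w lo <= W.
  rewrite /wavg -sumrB; apply: ler_sum => k _.
  by rewrite -mulrBr ler_piMl.
have [k0 _] : exists k0 : 'I_K, True.
  case: (posnP K) => [K0|K0]; last by exists (Ordinal K0).
  have : \sum_(k < K) w k = 0 by apply: big1 => -[i iK]; exfalso; move: iK; rewrite K0.
  by rewrite wsum => /eqP; rewrite oner_eq0.
have baryP2 := P2_bary w0 wsum nuP2.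
(* Averaging expansive quantiles keeps them expansive; hence the barycenter is absolutely continuous
   and qualifies as a fixed point of [G]. *)
have bary_lip : exists2 l, 0 < l & cdf_lip l (bary w nu).
  have c1 : 0 < \sum_(k < K) w k * L^-1.
    by rewrite -mulr_suml wsum mul1r invr_gt0.
  exists (\sum_(k < K) w k * L^-1)^-1; first by rewrite invr_gt0.
  apply: expansive_cdf_lip => //; apply: (@bary_expansive _ _ w (fun=> L^-1)) => // k.
  by apply: cdf_lip_expansive => //; have [] := nuL k.
have [lb _ baryL] := bary_lip.
exists (bary w nu); split.
  by split; [exact: bary_is_barycenter|move=> mu; exact: barycenter_uniq].
split.
- split; first by exists k0; exact: regular_bounded_density (nu_reg k0).
  move=> d Omega P s sch t k t0; split.
    exact: (That_Clin lo_lt_hi kappa0_kernel kappa_kernel w0 wsum sch).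
  exact: That_borel_dependency.
- move=> beta [//|t] beta01 _; have [r0 r1 r2] := powR_half_sqr t.+1 beta01.
  set r := beta `^ (t.+1%:R / 2) in r0 r1 r2.
  have e0 : 0 < r / (8 * L) by rewrite divr_gt0// mulr_gt0.
  have /choice[bX HbX] : forall l : nat, exists b0, 0 < b0 /\ forall b z x, 0 < b <= b0 ->
      wavg w lo <= z <= wavg w hi -> wavg w lo <= x <= wavg w hi ->
      (x + (wavg w hi - wavg w lo) / (grid_size L W r l%:R)%:R <= z ->
        smooth_step kappa0 (wavg w lo) (wavg w hi) b z x <= r / (8 * L)) /\
      (z <= x - (wavg w hi - wavg w lo) / (grid_size L W r l%:R)%:R ->
        1 - r / (8 * L) <= smooth_step kappa0 (wavg w lo) (wavg w hi) b z x).
    move=> l; have dl : 0 < (wavg w hi - wavg w lo) / (grid_size L W r l%:R)%:R.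
      by rewrite divr_gt0 ?subr_gt0// ltr0n.
    by have [b0 b00 Hb0] := smooth_step_sharp kappa0_kernel wlh dl e0; exists b0.
  have /choice[bY HbY] : forall k, exists b0, 0 < b0 /\ forall b z x, 0 < b <= b0 ->
      lo k <= z <= hi k -> lo k <= x <= hi k ->
      (x + (hi k - lo k) / (grid_size L W r L)%:R <= z ->
        smooth_step (kappa k) (lo k) (hi k) b z x <= r / (8 * L)) /\
      (z <= x - (hi k - lo k) / (grid_size L W r L)%:R ->
        1 - r / (8 * L) <= smooth_step (kappa k) (lo k) (hi k) b z x).
    move=> k; have dl : 0 < (hi k - lo k) / (grid_size L W r L)%:R.
      by rewrite divr_gt0 ?subr_gt0// ltr0n.
    by have [b0 b00 Hb0] := smooth_step_sharp (kappa_kernel k) (lo_lt_hi k) dl e0; exists b0.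
  (* The minimum with [r] gives the growth bound, the minimum with the threshold the sharpness of
     the smoothed step. *)
  pose b l : measurableTypeR R := Num.min r (bX l).
  pose h k : measurableTypeR R := Num.min r (bY k).
  have b0 l : 0 < b l by rewrite /b lt_min r0 (HbX l).1.
  have h0 k : 0 < h k by rewrite /h lt_min r0 (HbY k).1.
  have size_le (x : R) l : 0 <= x -> 16 * x * W * L <= 16 * W * L ^+ 2 * (l%:R + 1) ->
      (sample_size L W r x)%:R <= c0 * (l%:R + 1) * beta ^- (2 * t.+1).
    move=> x0 xl; apply: le_trans (sample_size_le L1 W0 r0 r1 x0) _.
    have -> : beta ^- (2 * t.+1) = r ^- 4 by rewrite mulnC exprM -r2 -exprM.
    rewrite ler_wpM2r ?invr_ge0 ?exprn_ge0 ?(ltW r0)//.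
    have l0 : 0 <= l%:R :> R by [].
    apply: (@le_trans _ _ (96 * L ^+ 2 * ((16 * W * L ^+ 2 + 5) * (l%:R + 1)) + (l%:R + 1))).
      apply: lerD; last by rewrite lerDr.
      apply: ler_wpM2l; first by rewrite mulr_ge0 ?sqr_ge0.
      by rewrite [leRHS]mulrDl; apply: lerD => //; rewrite ler_peMr// lerDr.
    by rewrite /c0 le_eqVlt; apply/orP; left; apply/eqP; ring.
  have L2 : L <= L ^+ 2 by rewrite expr2 ler_peMr// ltW.
  have growth k mu : growth_le (C mu) beta t.+1 (sample_size L W r (lip_level mu)%:R)
      (sample_size L W r L) (b (lip_level mu)) (h k).
    have rC : r <= C mu * r.
      by rewrite ler_peMl ?(ltW r0)// /C mulr_ege1// lerDr.
    split; rewrite -/r.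
    - apply: size_le => //; have l0 : 0 <= (lip_level mu)%:R :> R by [].
      move: (lip_level mu)%:R l0 => x x0.
      apply: (@le_trans _ _ (16 * W * L ^+ 2 * x)).
        rewrite (_ : 16 * x * W * L = 16 * W * x * L); last by ring.
        rewrite (_ : 16 * W * L ^+ 2 * x = 16 * W * x * L ^+ 2); last by ring.
        by rewrite ler_wpM2l// !mulr_ge0.
      by rewrite ler_wpM2l// lerDl.
    - apply: size_le; first exact: ltW.
      rewrite (_ : 16 * L * W * L = 16 * W * L ^+ 2); last by ring.
      by rewrite ler_peMr// lerDr.
    - by apply: le_trans rC; rewrite ge_min lexx.
    - by apply: le_trans rC; rewrite ge_min lexx.
  exists (fun k => (fun l => sample_size L W r l%:R) \o lip_level).
  exists (fun k => (fun=> sample_size L W r L) \o lip_level).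
  exists (fun k => b \o lip_level), (fun k => (fun=> h k) \o lip_level).
  split.
  + by move=> k; split; exact: borel_rule_level.
  + by move=> k mu; split; [split => /=|exact: growth].
  move=> d Omega P s sch rule; split.
  + by exists set0; split => // o /= H; apply: H => k; have [-> -> -> ->] := rule k o; exact: growth.
  + move=> k; rewrite -r2; apply: (condexp_prescribed lo_lt_hi kappa0_kernel kappa_kernel w0 wsum L0p
      mu0L sch (L := L) (W := W) (h := h k) (b := b)) => //.
    * by move=> l z x; apply: (HbX l).2; rewrite b0/= ge_min lexx orbT.
    * by move=> z x; apply: (HbY k).2; rewrite h0/= ge_min lexx orbT.
  + by apply: condexp_push sch _ _ _; rewrite exprn_ge0// ltW//; case/andP: beta01.
- exists (bary w nu); split.
    split; last by apply: Gmap_bary => //; exact: cdf_lip_atomless baryL.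
    by split => //; exact: cdf_lip_ac baryL.
  move=> mu [[mu2 muac] fix_mu] A mA.
  by rewrite -fix_mu//; apply: Gmap_bary => //; exact: ac_atomless.
- move=> d Omega P s sch t.
  rewrite (expected_Vbar lo_lt_hi kappa0_kernel kappa_kernel w0 wsum sch nuP2).
  have GE := W2_Gmap_muhat lo_lt_hi kappa0_kernel kappa_kernel w0 wsum L0p mu0L sch nuP2.
  by split; [under [leRHS]eq_integral do rewrite GE|under eq_integral do rewrite W2_sqr].
move=> d Omega P s C' beta sch beta01 good.
have b0 : 0 < beta by case/andP: beta01.
have le4 t : (0 < t)%N -> (\int[P]_o qdist (muhat s t o) (bary w nu) <= (4 * beta ^+ t)%:E)%E.
  case: t => // t _.
  apply: le_trans (expected_qdist_le lo_lt_hi kappa0_kernel kappa_kernel w0 wsum L0p mu0L sch nuP2 beta01 good t) _.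
  by rewrite lee_fin ler_peMl// ?exprn_ge0 ?ltW// ltr1n.
split.
- exact: (ae_cvg_mubar lo_lt_hi kappa0_kernel kappa_kernel w0 wsum L0p mu0L sch nuP2 beta01 good).
- move=> t t0; rewrite (expected_Vbar lo_lt_hi kappa0_kernel kappa_kernel w0 wsum sch nuP2).
  exact: le4.
- by move=> t t0; under eq_integral do rewrite W2_sqr; exact: le4.
Qed.
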